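(* For every $T>0$ there is a constant $c$, depending only on $T$, such that the following holds. Let $g\in L^2(0,T;H)$, $u_0\in V$, $v_0\in H$, and let $\eta$ be a weak solution of $$\eta''+\mathcal{A}\eta=f(t,\eta),\qquad \eta(0)=u_0,\quad \eta'(0)=v_0,$$ where $f(t,\eta)=\epsilon^{-1}\big(\sin\phi(\cdot,t)-\sin(\phi(\cdot,t)+\epsilon\eta)\big)+g(\cdot,t)$. Then $\eta\in C([0,T];V)$, $\eta'\in C([0,T];H)$ (after modification on a null set), and $$|\eta'(t)|^2+\|\eta(t)\|^2\le c\left(|v_0|^2+\|u_0\|^2+\int_0^t|g(s)|^2\,ds\right)\qquad\text{for all } t\in[0,T].$$
   Context: Let $L\in(0,\infty]$ and $I=(-L,L)$; all functions are real-valued. $H=L^2(I)$ with inner product $(u,v)=\int_I uv\,dx$ and norm $|u|$. $V$ is either $H^1_0(I)$ (Dirichlet boundary conditions) or $H^1(I)$ (homogeneous Neumann conditions, imposed weakly), with the $H^1$ inner product and norm $\|u\|^2=|u|^2+|u_x|^2$. $V^*$ is the dual of $V$, with pairing $\langle\cdot,\cdot\rangle$ extending $(\cdot,\cdot)$, so that $V\subset H\subset V^*$. The operator $\mathcal{A}\in\mathcal{L}(V,V^* )$ is defined by $\langle\mathcal{A}u,v\rangle=a(u,v)=(u_x,v_x)$ for $u,v\in V$. $\phi:\mathbb{R}\times[0,\infty)\to\mathbb{R}$ is a fixed smooth (soliton) solution of the sine-Gordon equation $\phi_{tt}-\phi_{xx}+\sin\phi=0$, and $0<\epsilon\le1$ is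 fixed. $'$ denotes the distributional time derivative of vector-valued functions. $W(0,T)=\{u: u\in L^2(0,T;V),\ u'\in L^2(0,T;H),\ u''\in L^2(0,T;V^* )\}$. A weak solution of the problem (with $u_0\in V$, $v_0\in H$, $g\in L^2(0,T;H)$) is a function $\eta\in W(0,T)$ that satisfies $\eta''+\mathcal{A}\eta=f(t,\eta)$ in $V^*$ for a.e. $t\in[0,T]$ and the initial conditions $\eta(0)=u_0$, $\eta'(0)=v_0$ (functions in $W(0,T)$ have representatives with $\eta\in C([0,T];H)$, $\eta'\in C([0,T];V^* )$, so these make sense). *)

(* Defs.v *)
From HB Require Import structures.
From mathcomp Require Import all_boot all_order all_algebra.
From mathcomp Require Import all_classical all_reals all_analysis.

Set Implicit Arguments.
Unset Strict Implicit.
Unset Printing Implicit Defensive.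

Import Order.TTheory GRing.Theory Num.Theory.
Import numFieldNormedType.Exports.

Local Open Scope classical_set_scope.
Local Open Scope ring_scope.

(* Elements of the function spaces are represented by everywhere defined
   functions, not by classes modulo null sets. A normed space is thus given by
   a carrier and a seminorm, and two points are identified when the seminorm of
   their difference is zero. *)
Record nspace (R : realType) (E : lmodType R) := NSpace {
  pts : set E;
  nrm : E -> R }.

Section Bochner.
Context {R : realType} {E : lmodType R}.
Implicit Types (X : nspace E) (D : set R) (u w : R -> E).

Local Notation mu := (@lebesgue_measure R).

Definition simple X (s : R -> E) : Prop :=
  [/\ finite_set (range s),
      forall e, measurable (s @^-1` [set e]) &
      forall t, pts X (s t)].

(* Meaningful when [mu D] is finite. *)
Definition simple_integral D (s : R -> E) : E :=
  \sum_(e \in range s) (fine (mu (D `&` s @^-1` [set e])) *: e).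

Definition approximates X D u (s : nat -> R -> E) : Prop :=
  (forall n, simple X (s n)) /\
  (forall t, D t -> nrm X (u t - s n t) @[n --> \oo] --> (0 : R)).

(* Strong (Bochner) measurability. Every class modulo null sets of almost
   everywhere limits of simple functions has a representative which is a limit
   at every point of [D]. *)
Definition strongly_measurable X D u : Prop :=
  (forall t, D t -> pts X (u t)) /\ exists s, approximates X D u s.

Definition is_bochner_integral X D u (y : E) : Prop :=
  pts X y /\
  exists s, [/\ approximates X D u s,
    (\int[mu]_(t in D) (nrm X (u t - s n t))%:E)%E @[n --> \oo] --> 0%E &
    nrm X (simple_integral D (s n) - y) @[n --> \oo] --> (0 : R)].

(* u \in L^2(0, T; X) *)
Definition L2T X (T : R) u : Prop :=
  strongly_measurable X `]0, T[ u /\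
  mu.-integrable `]0, T[ (fun t => (nrm X (u t) ^+ 2)%:E).

(* u \in C([0, T]; X) *)
Definition C0T X (T : R) u : Prop :=
  (forall t, t \in `[0, T] -> pts X (u t)) /\
  (forall t, t \in `[0, T] ->
     nrm X (u s - u t) @[s --> within [set` `[0, T]] (nbhs t)] --> (0 : R)).

Definition ae_equal X (T : R) u w : Prop :=
  {ae mu, forall t, t \in `]0, T[ -> nrm X (u t - w t) = 0}.

(* u(0) = a, read on the continuous representative of u *)
Definition initial_value X (T : R) u (a : E) : Prop :=
  exists w, [/\ C0T X T w, ae_equal X T w u & nrm X (w 0 - a) = 0].

End Bochner.

(* C_c^oo(U) *)
Definition test_fun (R : realType) (U : set R) (theta : R -> R) : Prop :=
  [/\ forall n (x : R), derivable (derive1n n theta) x 1,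
      compact (closure [set x | theta x != 0]) &
      closure [set x | theta x != 0] `<=` U].

(* w is the X-valued distributional derivative of u on ]0, T[. *)
Definition dist_deriv (R : realType) (E : lmodType R) (X : nspace E) (T : R)
    (u w : R -> E) : Prop :=
  forall theta, test_fun `]0, T[ theta ->
  exists y, is_bochner_integral X `]0, T[ (fun t => derive1 theta t *: u t) y /\
            is_bochner_integral X `]0, T[ (fun t => theta t *: w t) (- y).

Section Spaces.
Context {R : realType}.
Variable L : \bar R.
Implicit Types u v w : R -> R.

Local Notation mu := (@lebesgue_measure R).

Definition itvL : set R := [set x | (- L < x%:E)%E /\ (x%:E < L)%E].

Definition ip u v : R := \int[mu]_(x in itvL) (u x * v x).

Definition spaceH : nspace (R -> R) :=
  NSpace [set u | u \_ itvL \in Lfun mu 2%:E] (fun u => Num.sqrt (ip u u)).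

Definition L2_weak_deriv u w : Prop :=
  pts spaceH w /\
  forall theta, test_fun itvL theta -> ip u (derive1 theta) = - ip w theta.

(* u_x, determined up to a null set; zero if u is not in H^1(I) *)
Definition dx u : R -> R := xget (cst 0) [set w | L2_weak_deriv u w].

Definition spaceH1 : nspace (R -> R) :=
  NSpace [set u | pts spaceH u /\ exists w, L2_weak_deriv u w]
         (fun u => Num.sqrt (nrm spaceH u ^+ 2 + nrm spaceH (dx u) ^+ 2)).

(* closure of C_c^oo(I) in H^1(I) *)
Definition spaceH10 : nspace (R -> R) :=
  NSpace [set u | pts spaceH1 u /\
                  forall e : R, 0 < e ->
                  exists2 theta, test_fun itvL theta & nrm spaceH1 (u - theta) < e]
         (nrm spaceH1).

End Spaces.

Inductive boundary_condition := Dirichlet | Neumann.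

Section WeakSolutions.
Context {R : realType}.
Variables (L : \bar R) (bc : boundary_condition).

Local Notation mu := (@lebesgue_measure R).

Definition spaceV : nspace (R -> R) :=
  match bc with Dirichlet => spaceH10 L | Neumann => spaceH1 L end.

(* Functionals are total on R -> R; only their values on V matter. *)
Definition spaceVdual : nspace ((R -> R) -> R) :=
  NSpace
    [set F | (forall (a : R) u v, pts spaceV u -> pts spaceV v ->
                F (a *: u + v) = a * F u + F v) /\
             exists C : R, forall v, pts spaceV v -> `|F v| <= C * nrm spaceV v]
    (fun F => sup [set `|F v| | v in
                     [set v | pts spaceV v /\ nrm spaceV v <= 1]]).

(* the embedding of H into V^* *)
Definition emb (h : R -> R) : (R -> R) -> R := fun v => ip L h v.

Definition opA (u : R -> R) : (R -> R) -> R :=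
  fun v => ip L (dx L u) (dx L v).

(* eta \in W(0, T), with eta' = deta and eta'' = ddeta *)
Definition in_W (T : R) (eta deta : R -> R -> R) (ddeta : R -> (R -> R) -> R)
    : Prop :=
  [/\ L2T spaceV T eta,
      L2T (spaceH L) T deta,
      L2T spaceVdual T ddeta,
      dist_deriv (spaceH L) T eta deta &
      dist_deriv spaceVdual T (emb \o deta) ddeta].

(* [phi] takes x first, then t; [g t] and [eta t] are functions of x. *)
Definition rhs (eps : R) (phi g eta : R -> R -> R) (t : R) : R -> R :=
  fun x => eps^-1 * (sin (phi x t) - sin (phi x t + eps * eta t x)) + g t x.

Definition weak_solution (T eps : R) (phi g : R -> R -> R) (u0 v0 : R -> R)
    (eta deta : R -> R -> R) (ddeta : R -> (R -> R) -> R) : Prop :=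
  [/\ in_W T eta deta ddeta,
      {ae mu, forall t, t \in `]0, T[ -> forall v, pts spaceV v ->
         ddeta t v + opA (eta t) v = emb (rhs eps phi g eta t) v},
      initial_value (spaceH L) T eta u0 &
      initial_value spaceVdual T (emb \o deta) (emb v0)].

End WeakSolutions.

(* C^oo up to the boundary t = 0: [d i j] is the derivative of order i in x and
   j in t, extended continuously to t = 0. *)
Definition smooth_halfplane (R : realType) (phi : R -> R -> R) : Prop :=
  exists d : nat -> nat -> R -> R -> R,
  [/\ forall x t : R, 0 <= t -> d 0%N 0%N x t = phi x t,
      forall i j, {within [set p : R * R | 0 <= p.2],
                   continuous (fun p : R * R => d i j p.1 p.2)} &
      forall i j (x t : R), 0 < t ->
        is_derive x 1 (fun y => d i j y t) (d i.+1 j x t) /\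
        is_derive t 1 (d i j x) (d i j.+1 x t)].

(* The values of [phi] for negative times are irrelevant. *)
Definition sine_gordon_solution (R : realType) (phi : R -> R -> R) : Prop :=
  smooth_halfplane phi /\
  forall x t, 0 < t ->
    derive1n 2%N (phi x) t - derive1n 2%N (fun y => phi y t) x + sin (phi x t) = 0.

(* Main.v *)
Require Import Defs.
From HB Require Import structures.
From mathcomp Require Import all_boot all_order all_algebra.
From mathcomp Require Import all_classical all_reals all_analysis.
From mathcomp Require Import finmap measurable_realfun ring lra.

(* Every Hilbert-space operation is carried out on seminormed spaces of functions.
   Mollifying eta in time, with means defined weakly by the Riesz representation
   theorem, makes the energy |eta'|^2 + ||eta||^2 of the mollified solution
   differentiable, and its derivative only involves the forcing term: the
   contributions of the operator A cancel. Applied to differences of two mollifiers,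
   this shows that the mollified solutions are uniformly Cauchy, which gives the
   continuous representatives and the energy inequality on intervals; mollifiers
   supported on one side of the origin allow to reach both ends of [0, T]. As
   |f(t, eta) + eta| <= 2 |eta| + |g|, Gronwall's lemma concludes. *)

(** Formally the estimate is the equation tested with [eta'], but [eta'] takes its values only in H
    while the equation holds in the dual of V. After mollification the velocity agrees, up to sign
    and null vectors, with a mean of [eta] taken in V, and so becomes an admissible test vector. The
    form of V contains the zero-order term of the H^1 product; adding [eta] to both sides of the
    equation accounts for it, whence f + eta. The forcing is kept only through a scalar majorant
    [kap] of |f + eta|, so that f(t, eta(t)) is never treated as a measurable function with values
    in H. The price is that this majorant does not tend to zero for the difference of two
    mollifiers. In the energy estimate it multiplies the difference of the velocities, which tends
    to zero in L^2 in time by dominated convergence; Young's inequality, with a parameter fixed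
    before the mollification scales, then yields the uniform Cauchy property. The constant is
    [2 * expR (8 * T)]: both numbers come from [kap ^+ 2 <= 8 ||eta||^2 + 2 |g|^2]. *)

Set Implicit Arguments.
Unset Strict Implicit.
Unset Printing Implicit Defensive.

Import Order.TTheory GRing.Theory Num.Theory.
Import numFieldNormedType.Exports.

Local Open Scope classical_set_scope.
Local Open Scope ring_scope.

(** * Seminormed Hilbert spaces *)

(** Points are functions, not classes, so [B] may be degenerate. Linearity is asked only on [pts X],
    since integral forms are linear only where the integrals converge; symmetry and positivity hold
    for them on all of [E]. *)
Record hilbert_form (R : realType) (E : lmodType R) (X : nspace E)
    (B : E -> E -> R) : Prop := HilbertForm {
  hf0 : pts X 0;
  hfL : forall (a : R) u v, pts X u -> pts X v -> pts X (a *: u + v);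
  hf_sym : forall u v, B u v = B v u;
  hf_lin : forall (a : R) u v w, pts X u -> pts X v -> pts X w ->
    B (a *: u + v) w = a * B u w + B v w;
  hf_ge0 : forall u, 0 <= B u u;
  hf_nrm : forall u, nrm X u = Num.sqrt (B u u);
  hf_complete : forall s : nat -> E, (forall n, pts X (s n)) ->
    (forall e : R, 0 < e -> exists N, forall m n, (N <= m)%N -> (N <= n)%N ->
       nrm X (s m - s n) <= e) ->
    exists2 l, pts X l & nrm X (s n - l) @[n --> \oo] --> (0 : R) }.

Section HilbertForm.
Context {R : realType} {E : lmodType R} {X : nspace E} {B : E -> E -> R}.
Hypothesis hB : hilbert_form X B.
Implicit Types u v w : E.

Lemma hptsD u v : pts X u -> pts X v -> pts X (u + v).
Proof. by move=> pu pv; rewrite -[u]scale1r; exact: (hfL hB). Qed.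

Lemma hptsZ (a : R) u : pts X u -> pts X (a *: u).
Proof. by move=> pu; rewrite -[_ *: _]addr0; apply: (hfL hB) => //; exact: hf0 hB. Qed.

Lemma hptsN u : pts X u -> pts X (- u).
Proof. by move=> pu; rewrite -scaleN1r; exact: hptsZ. Qed.

Lemma hptsB u v : pts X u -> pts X v -> pts X (u - v).
Proof. by move=> pu pv; apply: hptsD => //; exact: hptsN. Qed.

Lemma hfDl u v w : pts X u -> pts X v -> pts X w -> B (u + v) w = B u w + B v w.
Proof. by move=> pu pv pw; rewrite -[u in LHS]scale1r (hf_lin hB)// mul1r. Qed.

Lemma hf0l w : pts X w -> B 0 w = 0.
Proof.
move=> pw; have := hfDl (hf0 hB) (hf0 hB) pw; rewrite addr0 => /eqP.
by rewrite -subr_eq0 opprD addrA subrr sub0r oppr_eq0 => /eqP.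
Qed.

Lemma hfZl (a : R) u w : pts X u -> pts X w -> B (a *: u) w = a * B u w.
Proof.
move=> pu pw; rewrite -[a *: u]addr0 (hf_lin hB)//; last exact: hf0 hB.
by rewrite hf0l// addr0.
Qed.

Lemma hfNl u w : pts X u -> pts X w -> B (- u) w = - B u w.
Proof. by move=> pu pw; rewrite -scaleN1r hfZl// mulN1r. Qed.

Lemma hfBl u v w : pts X u -> pts X v -> pts X w -> B (u - v) w = B u w - B v w.
Proof. by move=> pu pv pw; rewrite hfDl ?hfNl//; exact: hptsN. Qed.

Lemma hfDr u v w : pts X u -> pts X v -> pts X w -> B w (u + v) = B w u + B w v.
Proof. by move=> *; rewrite (hf_sym hB) hfDl// ![B _ w](hf_sym hB). Qed.

Lemma hfZr (a : R) u w : pts X u -> pts X w -> B w (a *: u) = a * B w u.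
Proof. by move=> *; rewrite (hf_sym hB) hfZl// (hf_sym hB). Qed.

Lemma hfBr u v w : pts X u -> pts X v -> pts X w -> B w (u - v) = B w u - B w v.
Proof. by move=> *; rewrite (hf_sym hB) hfBl// ![B _ w](hf_sym hB). Qed.

Lemma hnrm_ge0 u : 0 <= nrm X u.
Proof. by rewrite (hf_nrm hB) sqrtr_ge0. Qed.

Lemma hnrm_sqr u : nrm X u ^+ 2 = B u u.
Proof. by rewrite (hf_nrm hB) sqr_sqrtr// (hf_ge0 hB). Qed.

Lemma hf_sqrD u v : pts X u -> pts X v ->
  B (u + v) (u + v) = B u u + 2 * B u v + B v v.
Proof.
move=> pu pv; have puv := hptsD pu pv.
by rewrite hfDl// !hfDr// (hf_sym hB v u); ring.
Qed.

Lemma hf_sqrB u v : pts X u -> pts X v ->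
  B (u - v) (u - v) = B u u - 2 * B u v + B v v.
Proof.
move=> pu pv; have puv := hptsB pu pv.
by rewrite hfBl// !hfBr// (hf_sym hB v u); ring.
Qed.

Lemma hf_cauchy_schwarz u v : pts X u -> pts X v ->
  `|B u v| <= nrm X u * nrm X v.
Proof.
move=> pu pv.
have key a : 0 <= a ^+ 2 * B u u + 2 * a * B u v + B v v.
  have := hf_ge0 hB (a *: u + v); have pau := hptsZ a pu.
  by rewrite hf_sqrD// !hfZl// hfZr//; congr (_ <= _); ring.
have Bu := hf_ge0 hB u; have Bv := hf_ge0 hB v.
rewrite -(ler_pXn2r (n := 2))// ?nnegrE ?mulr_ge0 ?hnrm_ge0//.
rewrite exprMn !hnrm_sqr real_normK ?num_real//.
have [u0|u0] := eqVneq (B u u) 0.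
  rewrite u0 mul0r; suff -> : B u v = 0 by rewrite expr0n.
  apply/eqP; apply: contraT => uv0.
  (* When [B u u = 0] the quadratic is affine in [a]; a nonzero slope would let it take the value -1
     here. In the other case below, [a] is the minimizer of the quadratic. *)
  have := key (- (B v v + 1) / (2 * B u v)).
  rewrite u0 mulr0 add0r.
  have -> : 2 * (- (B v v + 1) / (2 * B u v)) * B u v + B v v = -1 by field.
  by rewrite oppr_ge0 ler10.
have := key (- B u v / B u u).
have -> : (- B u v / B u u) ^+ 2 * B u u + 2 * (- B u v / B u u) * B u v + B v v
  = (B u u * B v v - B u v ^+ 2) / B u u by field.
have up : 0 < B u u by rewrite lt_neqAle eq_sym u0.
by rewrite pmulr_lge0 ?invr_gt0// subr_ge0.
Qed.

Lemma hnrmD u v : pts X u -> pts X v -> nrm X (u + v) <= nrm X u + nrm X v.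
Proof.
move=> pu pv.
rewrite -(ler_pXn2r (n := 2))// ?nnegrE ?addr_ge0 ?hnrm_ge0//.
rewrite hnrm_sqr hf_sqrD// sqrrD !hnrm_sqr.
by have := le_trans (ler_norm _) (hf_cauchy_schwarz pu pv); lra.
Qed.

Lemma hnrmZ (a : R) u : pts X u -> nrm X (a *: u) = `|a| * nrm X u.
Proof.
move=> pu; rewrite !(hf_nrm hB) hfZl ?hfZr//; last exact: hptsZ.
by rewrite mulrA -expr2 sqrtrM ?sqr_ge0// sqrtr_sqr.
Qed.

Lemma hnrmN u : pts X u -> nrm X (- u) = nrm X u.
Proof. by move=> pu; rewrite -scaleN1r hnrmZ// normrN1 mul1r. Qed.

Lemma hnrmC u v : pts X u -> pts X v -> nrm X (u - v) = nrm X (v - u).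
Proof. by move=> pu pv; rewrite -opprB hnrmN//; exact: hptsB. Qed.

Lemma hnrmB u v : pts X u -> pts X v -> nrm X (u - v) <= nrm X u + nrm X v.
Proof. by move=> pu pv; rewrite -(hnrmN pv); apply: hnrmD => //; exact: hptsN. Qed.

Lemma hnrm0 : nrm X 0 = 0.
Proof. by rewrite (hf_nrm hB) (hf0l (hf0 hB)) sqrtr0. Qed.

Lemma hnrm_triangle u v w : pts X u -> pts X v -> pts X w ->
  nrm X (u - w) <= nrm X (u - v) + nrm X (v - w).
Proof.
by move=> pu pv pw; rewrite -[u - w](subrKA v); apply: hnrmD; exact: hptsB.
Qed.

Lemma hnrm_triangle_r u v w : pts X u -> pts X v -> pts X w ->
  nrm X (u - v) <= nrm X (u - w) + nrm X (v - w).
Proof. by move=> pu pv pw; rewrite [in leRHS](hnrmC pv pw); exact: hnrm_triangle. Qed.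

Lemma hnrm_dist u v : pts X u -> pts X v ->
  `|nrm X u - nrm X v| <= nrm X (u - v).
Proof.
move=> pu pv; rewrite ler_norml; apply/andP; split.
  rewrite lerNl opprB lerBlDr hnrmC//.
  by rewrite -{1}[v](subrK u); apply: hnrmD => //; exact: hptsB.
by rewrite lerBlDr -{1}[u](subrK v); apply: hnrmD => //; exact: hptsB.
Qed.

Lemma hnrm_eq0P u : nrm X u = 0 <-> B u u = 0.
Proof.
rewrite -hnrm_sqr; split => [->|/eqP]; first by rewrite expr0n.
by rewrite sqrf_eq0 => /eqP.
Qed.

Lemma hf_nrm0l u v : pts X u -> pts X v -> nrm X u = 0 -> B u v = 0.
Proof.
move=> pu pv u0; apply/eqP; rewrite -normr_le0.
by rewrite (le_trans (hf_cauchy_schwarz pu pv))// u0 mul0r.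
Qed.

(** Vectors known only through their pairings are estimated by testing with the vector itself; this
    is how norms of means are bounded later. *)
Lemma hnrm_le_form u C : 0 <= C ->
  B u u <= C * nrm X u -> nrm X u <= C.
Proof.
move=> C0; rewrite -hnrm_sqr => h.
have [->//|u0] := eqVneq (nrm X u) 0.
have up : 0 < nrm X u by rewrite lt_neqAle eq_sym u0 hnrm_ge0.
by rewrite expr2 ler_pM2r in h.
Qed.

Lemma hf_cvgl (s : nat -> E) l v : (forall n, pts X (s n)) -> pts X l -> pts X v ->
  nrm X (s n - l) @[n --> \oo] --> (0 : R) ->
  B (s n) v @[n --> \oo] --> B l v.
Proof.
move=> ps pl pv sl; apply/subr_cvg0.
apply: norm_cvg0.
apply: (@squeeze_cvgr _ _ _ _ (cst 0) (fun n => nrm X (s n - l) * nrm X v)).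
- near=> n; rewrite normr_ge0/= -hfBl//.
  by apply: hf_cauchy_schwarz => //; exact: hptsB.
- exact: cvg_cst.
- by rewrite -(mul0r (nrm X v)); apply: cvgMl.
Unshelve. all: by end_near. Qed.

Lemma two_piece e x y z : pts X x -> pts X y -> pts X z ->
  nrm X (x - y) <= e / 2 -> nrm X (x - z) <= e / 2 -> nrm X (y - z) <= e.
Proof.
move=> px py pz h1 h2; rewrite (le_trans (hnrm_triangle py px pz))//.
by rewrite [in leLHS]hnrmC// [leRHS]splitr lerD.
Qed.

Lemma three_piece e x y x' y' : pts X x -> pts X y -> pts X x' -> pts X y' ->
  nrm X (x - x') <= e / 3 -> nrm X (y - y') <= e / 3 -> nrm X (x - y) <= e / 3 ->
  nrm X (x' - y') <= e.
Proof.
move=> px py px' py' h1 h2 h3.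
have := hnrm_triangle px' px py'; have := hnrm_triangle px py py'.
by rewrite [nrm X (x' - x)]hnrmC//; lra.
Qed.

Lemma five_piece e x x' w y' y : pts X x -> pts X x' -> pts X w -> pts X y' -> pts X y ->
  nrm X (x' - x) <= e / 2 -> nrm X (y' - y) <= e / 2 ->
  nrm X (x' - w) = 0 -> nrm X (y' - w) = 0 -> nrm X (x - y) <= e.
Proof.
move=> px px' pw py' py h1 h2 h3 h4.
have := hnrm_triangle px px' py; have := hnrm_triangle px' pw py.
have := hnrm_triangle pw py' py.
by rewrite [nrm X (x - x')]hnrmC// [nrm X (w - y')]hnrmC//; lra.
Qed.

Lemma hf_sqr_cvg (s : nat -> E) l : (forall n, pts X (s n)) -> pts X l ->
  nrm X (s n - l) @[n --> \oo] --> (0 : R) ->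
  B (s n) (s n) @[n --> \oo] --> nrm X l ^+ 2.
Proof.
move=> ps pl sl.
have nl : nrm X (s n) @[n --> \oo] --> nrm X l.
  apply/subr_cvg0; apply: norm_cvg0.
  apply: (@squeeze_cvgr _ _ _ _ (cst 0) (fun n => nrm X (s n - l))) => //.
  - by near=> n; rewrite normr_ge0/= hnrm_dist.
  - exact: cvg_cst.
have -> : (fun n => B (s n) (s n)) = (fun n => nrm X (s n) * nrm X (s n)).
  by apply/funext => n; rewrite -expr2 hnrm_sqr.
by rewrite expr2; apply: cvgM.
Unshelve. all: by end_near. Qed.

End HilbertForm.

(* The representing vector is the limit of a minimizing sequence of
   [v |-> B v v - 2 * l v]. *)
Lemma hf_riesz (R : realType) (E : lmodType R) (X : nspace E) (B : E -> E -> R)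
    (hB : hilbert_form X B) (l : E -> R) (C : R) :
  (forall (a : R) u v, pts X u -> pts X v -> l (a *: u + v) = a * l u + l v) ->
  (forall v, pts X v -> `|l v| <= C * nrm X v) ->
  exists2 y, pts X y & forall v, pts X v -> B y v = l v.
Proof.
move=> lL lC.
have l0 : l 0 = 0.
  have := lL 1 0 0 (hf0 hB) (hf0 hB).
  by rewrite scaler0 addr0 mul1r => h; lra.
have lZ a u : pts X u -> l (a *: u) = a * l u.
  by move=> pu; rewrite -[a *: u]addr0 lL ?l0 ?addr0//; exact: hf0 hB.
have lD u v : pts X u -> pts X v -> l (u + v) = l u + l v.
  by move=> pu pv; rewrite -[u in LHS]scale1r lL// mul1r.
pose J v := B v v - 2 * l v.
have J_ge v : pts X v -> - C ^+ 2 <= J v.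
  move=> pv; have := lC v pv; rewrite /J -(hnrm_sqr hB) ler_norml => /andP[_ h].
  by have := sqr_ge0 (nrm X v - C); nra.
pose A := [set J v | v in pts X].
have hA : has_inf A.
  split; first by exists (J 0), 0 => //; exact: hf0 hB.
  by exists (- C ^+ 2) => _ [v pv <-]; exact: J_ge.
pose m := inf A.
have mJ v : pts X v -> m <= J v.
  by move=> pv; apply: ge_inf; [case: hA|exists v].
have ex n : exists v, pts X v /\ J v < m + n.+1%:R^-1.
  have n0 : 0 < n.+1%:R^-1 :> R by rewrite invr_gt0.
  have [_ [v pv <-] Jv] := inf_adherent n0 hA.
  by exists v.
have [s hs] := choice ex.
have ps n : pts X (s n) by case: (hs n).
have sJ n : J (s n) < m + n.+1%:R^-1 by case: (hs n).
(* Parallelogram law: [m] is also a lower bound for [J] at the midpoint of [s i] and [s j], so their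
   distance is controlled by how far [J (s i)] and [J (s j)] exceed [m]. *)
have dist i j : nrm X (s i - s j) ^+ 2 <= 2 * (i.+1%:R^-1 + j.+1%:R^-1).
  rewrite (hnrm_sqr hB) (hf_sqrB hB)//.
  have := mJ (2^-1 *: (s i + s j)) (hptsZ hB _ (hptsD hB (ps i) (ps j))).
  have := sJ i; have := sJ j; rewrite /J.
  rewrite lZ; last exact: (hptsD hB).
  rewrite (hfZl hB) ?(hfZr hB) ?(hf_sqrD hB)//;
    do ?[apply: (hptsZ hB)]; do ?[exact: (hptsD hB)].
  rewrite lD// ; move: i.+1%:R^-1 j.+1%:R^-1 => x y; lra.
have [y py sy] : exists2 l, pts X l & nrm X (s n - l) @[n --> \oo] --> (0 : R).
  apply: (hf_complete hB) => // e e0.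
  have e2 : 0 < e ^+ 2 / 4 by rewrite divr_gt0// exprn_gt0.
  have [N hN] : exists N : nat, N.+1%:R^-1 <= e ^+ 2 / 4.
    exists (Num.truncn ((e ^+ 2 / 4)^-1)); rewrite invf_ple ?posrE//.
    by apply/ltW; exact: truncnS_gt.
  exists N => i j Ni Nj.
  rewrite -(ler_pXn2r (n := 2))// ?nnegrE ?(hnrm_ge0 hB) ?(ltW e0)//.
  rewrite (le_trans (dist i j))//.
  have le k : (N <= k)%N -> k.+1%:R^-1 <= e ^+ 2 / 4.
    move=> Nk; apply: le_trans hN; rewrite lef_pV2 ?posrE//.
    by rewrite ler_nat ltnS.
  by have := le _ Ni; have := le _ Nj; move: i.+1%:R^-1 j.+1%:R^-1 => x y; lra.
exists y => // v pv.
(* The first variation of [J] in the direction [v]. It is computed at [s n], where [J] is within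
   [n.+1%:R^-1] of its infimum, and then passed to the limit. *)
have key t : 0 <= t ^+ 2 * B v v + 2 * t * (B y v - l v).
  have lim : (t ^+ 2 * B v v + 2 * t * (B (s n) v - l v) + n.+1%:R^-1)
      @[n --> \oo] --> t ^+ 2 * B v v + 2 * t * (B y v - l v) + 0.
    apply: cvgD; last exact: cvg_harmonic.
    apply: cvgD; first exact: cvg_cst.
    apply: cvgMr; apply: cvgB; last exact: cvg_cst.
    exact: (hf_cvgl hB).
  rewrite -[leRHS]addr0 -(cvg_lim _ lim)//; apply: limr_ge.
    by apply/cvg_ex; eexists; exact: lim.
  near=> n; have := mJ _ (hfL hB t pv (ps n)); have := sJ n; rewrite /J.
  have ptv := hptsZ hB t pv.
  by rewrite lL// (hf_sqrD hB)// (hfZl hB)// (hfZr hB)// (hfZl hB)// (hf_sym hB v); move: n.+1%:R^-1 => x; lra.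
have Bv := hf_ge0 hB v.
apply/eqP; rewrite -subr_eq0; apply: contraT => d0.
set d := B y v - l v in key d0 *.
have [v0|v0] := eqVneq (B v v) 0.
  by have := key (- d); rewrite v0; have := exprn_even_gt0 (n := 2) d erefl; rewrite d0 /=; nra.
have vp : 0 < B v v by rewrite lt_neqAle eq_sym v0.
have := key (- d / B v v).
have -> : (- d / B v v) ^+ 2 * B v v + 2 * (- d / B v v) * d = - (d ^+ 2 / B v v).
  by field.
by rewrite oppr_ge0 leNgt divr_gt0// exprn_even_gt0.
Unshelve. all: by end_near. Qed.

(** * Integration *)

Notation integ D f :=
  ((@lebesgue_measure _).-integrable D (EFin \o f)) (only parsing).

Section Integration.
Context {R : realType}.
Local Notation mu := (@lebesgue_measure R).
Implicit Types (D : set R) (f g : R -> R).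

Lemma ae_imp (P Q : R -> Prop) : (forall t, P t -> Q t) ->
  {ae mu, forall t, P t} -> {ae mu, forall t, Q t}.
Proof.
by move=> PQ; apply: filterS PQ; exact: (ae_filter_ringOfSetsType mu).
Qed.

Lemma ae_imp2 (P1 P2 Q : R -> Prop) : (forall t, P1 t -> P2 t -> Q t) ->
  {ae mu, forall t, P1 t} -> {ae mu, forall t, P2 t} -> {ae mu, forall t, Q t}.
Proof.
by move=> PQ; apply: filterS2 PQ; exact: (ae_filter_ringOfSetsType mu).
Qed.

Lemma integ_measurable D f : integ D f -> measurable_fun D f.
Proof. by move=> /integrableP[/measurable_EFinP]. Qed.

Lemma le_integ D f g : measurable D -> measurable_fun D f ->
  (forall t, D t -> `|f t| <= g t) -> integ D g -> integ D f.
Proof.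
move=> mD mf fg; apply: le_integrable => //; first exact/measurable_EFinP.
by move=> t Dt; rewrite /= lee_fin (le_trans (fg _ Dt))// ler_norm.
Qed.

(* Unlike [ge0_le_integral], without any measurability hypothesis. *)
Lemma le_nnintegral D (f g : R -> \bar R) :
  (forall t, D t -> (0 <= f t)%E) -> (forall t, D t -> (f t <= g t)%E) ->
  (\int[mu]_(t in D) f t <= \int[mu]_(t in D) g t)%E.
Proof.
move=> f0 fg; rewrite integral_mkcond [leRHS]integral_mkcond.
have fg' t : ((f \_ D) t <= (g \_ D) t)%E.
  by rewrite !patchE; case: ifP => // /set_mem; exact: fg.
have f0' t : (0 <= (f \_ D) t)%E.
  by rewrite patchE; case: ifP => // /set_mem; exact: f0.
rewrite !ge0_integralTE//; last by move=> t; rewrite (le_trans _ (fg' t)).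
apply: le_ereal_sup => _ [h hf <-]; exists h => // t.
exact: le_trans (hf t) (fg' t).
Qed.

Lemma integ_cst D (c : R) : measurable D -> (mu D < +oo)%E -> integ D (cst c).
Proof.
move=> mD Doo; apply/integrableP; split; first exact/measurable_EFinP/measurable_cst.
by rewrite /= integral_cst// lte_mul_pinfty.
Qed.

Lemma integZ D (c : R) f : measurable D -> integ D f -> integ D (fun t => c * f t).
Proof. by move=> mD h; exact: (@integrableZl _ _ _ mu D mD c (EFin \o f) h). Qed.

Lemma integD D f g : measurable D -> integ D f -> integ D g ->
  integ D (fun t => f t + g t).
Proof. by move=> mD hf hg; exact: (@integrableD _ _ _ mu D mD (EFin \o f) (EFin \o g) hf hg). Qed.

Lemma integB D f g : measurable D -> integ D f -> integ D g ->
  integ D (fun t => f t - g t).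
Proof. by move=> mD hf hg; exact: (@integrableB _ _ _ mu D mD (EFin \o f) (EFin \o g) hf hg). Qed.

Lemma integ_norm D f : measurable D -> integ D f -> integ D (fun t => `|f t|).
Proof. by move=> mD h; exact: (@integrable_abse _ _ _ mu D (EFin \o f) h). Qed.

Lemma normr_Rintegral_le D f : measurable D -> integ D f ->
  `|\int[mu]_(t in D) f t| <= \int[mu]_(t in D) `|f t|.
Proof. exact: (@le_normr_Rintegral _ _ _ mu D f). Qed.

Lemma integ_bndM D f g (C : R) : measurable D -> measurable_fun D f ->
  (forall t, D t -> `|f t| <= C) -> integ D g -> integ D (fun t => f t * g t).
Proof.
move=> mD mf fC ig; apply: (le_integ (g := fun t => C * `|g t|)) => //.
- by apply: measurable_funM => //; exact: integ_measurable ig.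
- by move=> t Dt; rewrite normrM ler_wpM2r// fC.
- by apply: integZ => //; exact: integ_norm.
Qed.

Lemma Rintegral_dominated D (h : nat -> R -> R) f g : measurable D ->
  (forall n, measurable_fun D (h n)) -> measurable_fun D f ->
  {ae mu, forall t, D t -> h n t @[n --> \oo] --> f t} -> integ D g ->
  (forall n t, D t -> `|h n t| <= g t) ->
  integ D f /\ \int[mu]_(t in D) h n t @[n --> \oo] --> \int[mu]_(t in D) f t.
Proof.
move=> mD mh mf hf ig hg.
have [|||||i _ c] := @dominated_convergence _ _ _ mu D mD
  (fun n t => (h n t)%:E) (EFin \o f) (EFin \o g).
- by move=> n; apply/measurable_EFinP; exact: mh.
- exact/measurable_EFinP.
- apply: ae_imp hf => t ht Dt.
  by apply: cvg_EFin; [near=> n|exact: ht].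
- exact: ig.
- by apply: aeW => t n Dt; rewrite /= lee_fin hg.
split=> //; apply: fine_cvg.
rewrite /= fineK; first exact: c.
exact: integrable_fin_num.
Unshelve. all: by end_near. Qed.

Lemma Rintegral_dct D (h : nat -> R -> R) f g : measurable D ->
  (forall n, measurable_fun D (h n)) ->
  (forall t, D t -> h n t @[n --> \oo] --> f t) -> integ D g ->
  (forall n t, D t -> `|h n t| <= g t) ->
  integ D f /\ \int[mu]_(t in D) h n t @[n --> \oo] --> \int[mu]_(t in D) f t.
Proof.
move=> mD mh hf ig hg; apply: Rintegral_dominated ig hg => //.
  exact: measurable_fun_cvg hf.
exact: aeW.
Qed.

Lemma Rintegral_sum (I : Type) (r : seq I) D (F : I -> R -> R) : measurable D ->
  (forall i, integ D (F i)) ->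
  integ D (fun t => \sum_(i <- r) F i t) /\
  \int[mu]_(t in D) (\sum_(i <- r) F i t) = \sum_(i <- r) \int[mu]_(t in D) F i t.
Proof.
move=> mD iF; elim: r => [|i r [ir IH]].
  have -> : (fun t => \sum_(i <- [::]) F i t) = cst 0.
    by apply/funext => t; rewrite big_nil.
  by rewrite big_nil Rintegral_cst// mul0r; split => //; exact: integrable0.
have -> : (fun t => \sum_(j <- i :: r) F j t) =
    (fun t => F i t + \sum_(j <- r) F j t).
  by apply/funext => t; rewrite big_cons.
by split; [exact: integD|rewrite RintegralD// IH big_cons].
Qed.

End Integration.

(** * Simple functions, and Bochner integrals seen through functionals *)

Section Simple.
Context {R : realType} {E : lmodType R} {X : nspace E}.
Local Notation mu := (@lebesgue_measure R).
Implicit Types (D : set R) (s : R -> E).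

(** Only the term [e = s t] survives. Measurability and integration of scalar functions of a simple
    function thus reduce to finite sums of indicators, although [E] carries no sigma-algebra. *)
Lemma simple_compE s (phi : E -> R -> R) t : simple X s ->
  phi (s t) t = \sum_(e <- fset_set (range s)) phi e t * \1_(s @^-1` [set e]) t.
Proof.
move=> [fs _ _].
rewrite (bigD1_seq (s t)) ?fset_uniq//=; last first.
  by rewrite in_fset_set//; apply/mem_set; exists t.
rewrite indicE mem_set// mulr1 big1 ?addr0// => e est.
by rewrite indicE memNset ?mulr0//= => h; rewrite h eqxx in est.
Qed.

Lemma measurable_simple_comp D s (phi : E -> R -> R) : simple X s ->
  (forall e, measurable_fun D (phi e)) -> measurable_fun D (fun t => phi (s t) t).
Proof.
move=> ss mphi.
under eq_fun do rewrite (simple_compE _ _ ss).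
apply: measurable_sum => e; apply: measurable_funM => //.
by apply: measurable_indic; case: ss.
Qed.

Lemma integ_simple_comp D s (phi : E -> R) : measurable D -> (mu D < +oo)%E ->
  simple X s -> integ D (phi \o s).
Proof.
move=> mD Doo ss; have -> : phi \o s = fun t => (fun e _ => phi e) (s t) t by [].
have e t := simple_compE (fun e _ => phi e) t ss.
under eq_fun do rewrite e.
apply: (proj1 (Rintegral_sum _ mD _)) => i.
apply: (le_integ (g := cst `|phi i|)) => //.
- apply: measurable_funM => //.
  by apply: measurable_indic; case: ss.
- move=> t _; rewrite normrM ler_piMr// indicE.
  by case: (_ \in _); rewrite ?normr1 ?normr0.
- exact: integ_cst.
Qed.

Lemma Rintegral_simple_comp D s (phi : E -> R) : measurable D ->
  (mu D < +oo)%E -> simple X s ->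
  \int[mu]_(t in D) phi (s t) =
    \sum_(e <- fset_set (range s)) fine (mu (D `&` s @^-1` [set e])) * phi e.
Proof.
move=> mD Doo ss.
have e t := simple_compE (fun e _ => phi e) t ss.
under eq_Rintegral do rewrite e.
have i1 i : integ D (\1_(s @^-1` [set i])).
  apply: (le_integ (g := cst 1)) => //.
  - by apply: measurable_indic; case: ss.
  - by move=> t _; rewrite indicE; case: (_ \in _); rewrite ?normr1 ?normr0.
  - exact: integ_cst.
have i2 i : integ D (fun t => phi i * \1_(s @^-1` [set i]) t).
  exact: (integZ (phi i) mD (i1 i)).
rewrite (proj2 (Rintegral_sum _ mD i2)).
apply: eq_bigr => i _; rewrite RintegralZl// mulrC; congr (_ * _).
have [_ ms _] := ss.
rewrite setIC /Rintegral integral_indic//; exact: ms.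
Qed.

(** The scalar function is the pointwise limit of its values along the approximating simple
    functions; a Lipschitz constant for each fixed [t] is enough for that. *)
Lemma approximates_measurable D (u : R -> E) (s : nat -> R -> E) (phi : E -> R -> R) (C : R -> R) :
  (forall e, measurable_fun D (phi e)) ->
  (forall t, D t -> pts X (u t)) ->
  (forall e e' t, D t -> pts X e -> pts X e' ->
     `|phi e t - phi e' t| <= C t * nrm X (e - e')) ->
  approximates X D u s ->
  measurable_fun D (fun t => phi (u t) t).
Proof.
move=> mphi pu phiC [ss us].
apply: (measurable_fun_cvg (h := fun n t => phi (s n t) t)).
  by move=> n; exact: measurable_simple_comp.
move=> t Dt; apply/subr_cvg0; apply: norm_cvg0.
apply: (@squeeze_cvgr _ _ _ _ (cst 0) (fun n => C t * nrm X (u t - s n t))).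
- near=> n; rewrite normr_ge0/= distrC phiC//; first exact: pu.
  by case: (ss n).
- exact: cvg_cst.
- by rewrite -(mulr0 (C t)); apply: cvgMr; exact: us.
Unshelve. all: by end_near. Qed.

End Simple.

Section BochnerFunctional.
Context {R : realType} {E : lmodType R} {X : nspace E}.
Local Notation mu := (@lebesgue_measure R).
Variables (l : E -> R) (C : R).
Hypothesis p0 : pts X 0.
Hypothesis pL : forall (a : R) u v, pts X u -> pts X v -> pts X (a *: u + v).
Hypothesis lL : forall (a : R) u v, pts X u -> pts X v ->
  l (a *: u + v) = a * l u + l v.
Hypothesis lC : forall u, pts X u -> `|l u| <= C * nrm X u.

Lemma functional0 : l 0 = 0.
Proof. by have := lL 1 p0 p0; rewrite scaler0 addr0 mul1r => h; lra. Qed.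

Lemma functionalB u v : pts X u -> pts X v -> l (u - v) = l u - l v.
Proof.
move=> pu pv; rewrite addrC -scaleN1r lL// mulN1r addrC.
by [].
Qed.

Lemma ptsB u v : pts X u -> pts X v -> pts X (u - v).
Proof. by move=> pu pv; rewrite addrC -scaleN1r; exact: pL. Qed.

Lemma functional_sum (r : seq E) (c : E -> R) : (forall e, e \in r -> pts X e) ->
  pts X (\sum_(e <- r) c e *: e) /\
  l (\sum_(e <- r) c e *: e) = \sum_(e <- r) c e * l e.
Proof.
elim: r => [|e r IH] h; first by rewrite !big_nil functional0.
have [|pr lr] := IH; first by move=> e' er; apply: h; rewrite inE er orbT.
have pe : pts X e by apply: h; rewrite inE eqxx.
by rewrite !big_cons; split; [exact: pL|rewrite lL// lr].
Qed.

Lemma functional_simple_integral (D : set R) s : measurable D -> (mu D < +oo)%E ->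
  simple X s -> pts X (simple_integral D s) /\
  l (simple_integral D s) = \int[mu]_(t in D) l (s t).
Proof.
move=> mD Doo ss; rewrite (Rintegral_simple_comp _ mD Doo ss) /simple_integral.
have [fs _ ps] := ss.
rewrite fsbig_finite//; apply: (functional_sum (fun e => fine (mu (D `&` s @^-1` [set e])))).
by move=> e; rewrite in_fset_set// => /set_mem[t _ <-].
Qed.

(** The only bridge from [is_bochner_integral] to scalar integrals: bounded linear functionals
    commute with the integral of simple functions, and both sides pass to the limit. *)
Lemma functional_bochner (D : set R) (u : R -> E) y : measurable D -> (mu D < +oo)%E -> 0 <= C ->
  (forall t, D t -> pts X (u t)) -> is_bochner_integral X D u y ->
  integ D (l \o u) /\ \int[mu]_(t in D) l (u t) = l y.
Proof.
move=> mD Doo C0 pu [py [s [us su sy]]].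
have [ss us'] := us.
have ps n t : pts X (s n t) by case: (ss n).
have mlu : measurable_fun D (l \o u).
  apply: (approximates_measurable (phi := fun e _ => l e) (C := cst C) _ pu _ us) => //.
  by move=> e e' t _ pe pe'; rewrite -functionalB//; apply: lC; exact: ptsB.
have ils n : integ D (l \o s n) by exact: integ_simple_comp.
have mls n : measurable_fun D (fun t => l (s n t)) := integ_measurable (ils n).
have le n : (\int[mu]_(t in D) (`|l (u t) - l (s n t)|)%:E <=
   C%:E * \int[mu]_(t in D) (nrm X (u t - s n t))%:E)%E.
  (* The constant has to be moved to the left-hand integrand, which is measurable, because nothing
     is known about the measurability of [nrm X (u t - s n t)]. This divides by [C], hence the
     separate case [C = 0]. *)
  have [C1|C1] := eqVneq C 0.
    rewrite C1 mul0e integral0_eq// => t Dt; rewrite -functionalB//; last exact: pu.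
    congr EFin; apply/eqP; rewrite -normr_le0 normr_id.
    by rewrite (le_trans (lC _))// ?C1 ?mul0r//; apply: ptsB => //; exact: pu.
  have Cp : 0 < C by rewrite lt_neqAle eq_sym C1.
  rewrite -lee_pdivrMl//; rewrite -ge0_integralZl_EFin//; last 2 first.
    by apply/measurable_EFinP; apply: measurableT_comp => //;
      apply: measurable_funB => //; exact: mls.
    by rewrite invr_ge0.
  apply: le_nnintegral => t Dt; first by rewrite mule_ge0// lee_fin invr_ge0.
  rewrite -EFinM lee_fin ler_pdivrMl// -functionalB//; last exact: pu.
  by apply: lC; apply: ptsB => //; exact: pu.
have clim : (\int[mu]_(t in D) (`|l (u t) - l (s n t)|)%:E)%E @[n --> \oo] --> 0%E.
  apply: (@squeeze_cvge _ _ _ _ (cst 0%E) _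
    (fun n => C%:E * \int[mu]_(t in D) (nrm X (u t - s n t))%:E)%E).
  - near=> n; rewrite le integral_ge0//.
  - exact: cvg_cst.
  - by rewrite -(mule0 C%:E); apply: cvgeZl.
have ilu : integ D (l \o u).
  have [n hn] : exists n, (\int[mu]_(t in D) (`|l (u t) - l (s n t)|)%:E < +oo)%E.
    have /fine_cvgP[[n _ /(_ n (leqnn n)) h] _] := clim.
    by exists n; rewrite -ge0_fin_numE// integral_ge0.
  have i2 : integ D (fun t => l (u t) - l (s n t)).
    apply/integrableP; split => //.
    by apply/measurable_EFinP; apply: measurable_funB => //; exact: mls.
  have := integD mD i2 (ils n).
  by under eq_fun do rewrite subrK.
split=> //.
have lims : \int[mu]_(t in D) l (s n t) @[n --> \oo] --> l y.
  apply/subr_cvg0; apply: norm_cvg0.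
  apply: (@squeeze_cvgr _ _ _ _ (cst 0) (fun n => C * nrm X (simple_integral D (s n) - y))).
  - near=> n; rewrite normr_ge0/=.
    have [p <-] := functional_simple_integral mD Doo (ss n).
    by rewrite -functionalB//; apply: lC; exact: ptsB.
  - exact: cvg_cst.
  - by rewrite -(mulr0 C); apply: cvgMr.
apply: cvg_unique lims => //.
apply/subr_cvg0; apply: norm_cvg0.
apply: (@squeeze_cvgr _ _ _ _ (cst 0)
   (fun n => \int[mu]_(t in D) `|l (u t) - l (s n t)|)).
- near=> n; rewrite normr_ge0/= -RintegralB; last 3 first.
    exact: mD.
    exact: ils.
    exact: ilu.
  under [leRHS]eq_Rintegral do rewrite distrC.
  by apply: le_normr_Rintegral => //; exact: (integB mD (ils n) ilu).
- exact: cvg_cst.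
- by move/fine_cvgP : clim => [_ h]; exact: h.
Unshelve. all: by end_near. Qed.

End BochnerFunctional.

(** * Smooth functions of one variable *)

Section RealDerive.
Context {R : realType}.
Implicit Types (f g : R -> R) (x a b : R).

Lemma derivable_is_derive1 f x : derivable f x 1 -> is_derive x 1 f (derive1 f x).
Proof. by move=> df; rewrite derive1E; exact/derivableP. Qed.

Lemma is_derive_derive1 f x a : is_derive x 1 f a -> derive1 f x = a.
Proof. by move=> df; rewrite derive1E; exact: (@derive_val _ _ _ _ _ _ _ df). Qed.

Lemma is_derive_add f g x a b : is_derive x 1 f a -> is_derive x 1 g b ->
  is_derive x 1 (fun x => f x + g x) (a + b).
Proof. exact: (@is_deriveD R R R f g x 1 a b). Qed.

Lemma is_derive_mul f g x a b : is_derive x 1 f a -> is_derive x 1 g b ->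
  is_derive x 1 (fun x => f x * g x) (a * g x + f x * b).
Proof.
move=> df dg; have := @is_deriveM R R f g x 1 a b df dg.
by rewrite addrC /GRing.scale/= [g x * a]mulrC.
Qed.

Lemma is_derive_scal f (c : R) x a : is_derive x 1 f a ->
  is_derive x 1 (fun x => c * f x) (c * a).
Proof. exact: (@is_deriveZ R R R f c x 1 a). Qed.

Lemma is_derive_sub f g x a b : is_derive x 1 f a -> is_derive x 1 g b ->
  is_derive x 1 (fun x => f x - g x) (a - b).
Proof. exact: (@is_deriveB R R R f g x 1 a b). Qed.

Lemma is_derive_pow f (n : nat) x a : is_derive x 1 f a ->
  is_derive x 1 (fun x => f x ^+ n) (n%:R * f x ^+ n.-1 * a).
Proof.
move=> df; have := @is_deriveX R R f n x 1 a df.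
by have -> : f ^+ n = (fun x => f x ^+ n) by apply/funext => z; rewrite exprfctE.
Qed.

Lemma is_derive_expR_comp f x a : is_derive x 1 f a ->
  is_derive x 1 (fun x => expR (f x)) (expR (f x) * a).
Proof.
by move=> df; exact: (@is_derive1_comp _ expR f x _ _ (is_derive_expR (f x)) df).
Qed.

Lemma is_derive_inv f x a : f x != 0 -> is_derive x 1 f a ->
  is_derive x 1 (fun x => (f x)^-1) (- (a * ((f x)^-1 * (f x)^-1))).
Proof.
move=> f0 df; have := @is_deriveV R f x a 1 f0 df.
by rewrite /GRing.scale/= -exprVn expr2 mulNr [_ * a]mulrC.
Qed.

Lemma is_derive_affine f (c d : R) x a : is_derive (c * x + d) 1 f a ->
  is_derive x 1 (fun x => f (c * x + d)) (c * a).
Proof.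
move=> df.
have h1 : is_derive x 1 (fun x : R => c * x + d) c.
  have := is_derive_add (is_derive_scal c (is_derive_id x 1)) (is_derive_cst d x 1).
  by rewrite addr0 mulr1.
have := @is_derive1_comp _ f (fun x : R => c * x + d) x _ _ df h1.
by rewrite /comp/= mulrC.
Qed.

Lemma is_derive_continuous f x a : is_derive x 1 f a -> {for x, continuous f}.
Proof.
by move=> [df _]; apply/differentiable_continuous; rewrite -derivable1_diffP.
Qed.

(** Taylor's formula for a smooth kernel gives a quadratic remainder uniform in the integration
    variable, so this criterion replaces differentiation under the integral sign. It also settles
    the differentiability of [flat] at 0. *)
Lemma is_derive_quadratic f x a (C : R) :
  (forall h, `|h| <= 1 -> `|f (h + x) - f x - h * a| <= C * h ^+ 2) ->
  is_derive x 1 f a.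
Proof.
move=> hC.
have C0 : 0 <= C.
  by have := hC 1; rewrite normr1 expr1n mulr1 => /(_ (lexx _)); exact: le_trans.
have lim : h^-1 *: ((f \o shift x) (h *: (1 : R)) - f x) @[h --> (0:R)^'] --> a.
  apply/subr_cvg0; apply: norm_cvg0.
  apply: (@squeeze_cvgr _ _ _ _ (cst 0) (fun h => C * `|h|)).
  - near=> h; rewrite normr_ge0/=.
    have h0 : h != 0 by near: h; exact: nbhs_dnbhs_neq.
    have h1 : `|h| <= 1.
      near: h; apply: cvg_within; apply/nbhs_normP; exists 1 => //= z /=.
      by rewrite sub0r normrN => /ltW.
    have -> : h^-1 *: (f (h *: (1:R) + x) - f x) - a =
      h^-1 * (f (h + x) - f x - h * a).
      by rewrite /GRing.scale/= mulr1; field.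
    rewrite normrM normfV ler_pdivrMl ?normr_gt0// mulrCA -expr2.
    by rewrite real_normK ?num_real//; exact: hC.
  - exact: cvg_cst.
  - have l : C * `|h| @[h --> (0:R)^'] --> C * `|0 : R|.
      by apply: cvgMr; apply: cvg_norm; exact: cvg_within.
    by rewrite normr0 mulr0 in l.
by split; [apply/cvg_ex; exists a|exact: cvg_lim lim].
Unshelve. all: by end_near. Qed.

End RealDerive.

Section Smooth.
Context {R : realType}.
Implicit Types f g : R -> R.

(** The derivative is taken before the recursive call, so that closure under sums, products and
    inverses follows by induction on the order from the formula for the first derivative. *)
Fixpoint derivable_n (n : nat) f : Prop :=
  (forall x : R, derivable f x 1) /\
  (if n is m.+1 then derivable_n m (derive1 f) else True).

Definition smooth f := forall n, derivable_n n f.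

Lemma derivable_n0 n f : derivable_n n f -> forall x : R, derivable f x 1.
Proof. by case: n => [|n] []. Qed.

Lemma derivable_nW n f : derivable_n n.+1 f -> derivable_n n f.
Proof.
elim: n f => [|n IH] f; first by move=> [df _]; split.
by move=> [df h]; split => //; exact: IH.
Qed.

Lemma smoothP f : smooth f <-> forall n (x : R), derivable (derive1n n f) x 1.
Proof.
split => [sf n|].
  elim: n f sf => [|n IH] f sf x; first exact: derivable_n0 (sf 0%N) x.
  by rewrite derive1Sn; apply: IH => k; have [] := sf k.+1.
move=> h n; elim: n f h => [|n IH] f h; split => //.
- by move=> x; have := h 0%N x.
- by move=> x; have := h 0%N x.
- by apply: IH => k x; rewrite -derive1Sn; exact: h.
Qed.

Lemma smooth_derivable f (x : R) : smooth f -> derivable f x 1.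
Proof. by move=> /(_ 0%N)[]. Qed.

Lemma smooth_derive1 f : smooth f -> smooth (derive1 f).
Proof. by move=> sf n; have [] := sf n.+1. Qed.

Lemma smooth_continuous f : smooth f -> continuous f.
Proof.
move=> sf x; apply/differentiable_continuous; rewrite -derivable1_diffP.
exact: smooth_derivable.
Qed.

Lemma derivable_n_cst n (c : R) : derivable_n n (cst c).
Proof.
elim: n c => [|n IH] c; split => //.
have -> : derive1 (cst c : R -> R) = cst 0; last exact: IH.
by apply/funext => x; rewrite derive1_cst.
Qed.

Lemma derivable_nS n f df : (forall x : R, is_derive x 1 f (df x)) ->
  derivable_n n df -> derivable_n n.+1 f.
Proof.
move=> h hdf; split; first by move=> x; have [] := h x.
by have -> : derive1 f = df by apply/funext => x; exact: is_derive_derive1.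
Qed.

Lemma derivable_n_is_derive n f : derivable_n n f ->
  forall x : R, is_derive x 1 f (derive1 f x).
Proof. by move=> /derivable_n0 df x; exact: derivable_is_derive1. Qed.

Lemma derivable_nD n f g : derivable_n n f -> derivable_n n g ->
  derivable_n n (fun x => f x + g x).
Proof.
elim: n f g => [|n IH] f g hf hg;
  have h x := is_derive_add (derivable_n_is_derive hf x) (derivable_n_is_derive hg x).
  by split => // x; have [] := h x.
by apply: (derivable_nS h); apply: IH; [case: hf|case: hg].
Qed.

Lemma derivable_nM n f g : derivable_n n f -> derivable_n n g ->
  derivable_n n (fun x => f x * g x).
Proof.
elim: n f g => [|n IH] f g hf hg;
  have h x := is_derive_mul (derivable_n_is_derive hf x) (derivable_n_is_derive hg x).
  by split => // x; have [] := h x.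
apply: (derivable_nS h); apply: derivable_nD; apply: IH.
- by case: hf.
- exact: derivable_nW.
- exact: derivable_nW.
- by case: hg.
Qed.

Lemma derivable_n_affine n f (a b : R) : derivable_n n f ->
  derivable_n n (fun x => f (a * x + b)).
Proof.
elim: n f => [|n IH] f hf;
  have h x := is_derive_affine (derivable_n_is_derive hf (a * x + b)).
  by split => // x; have [] := h x.
apply: (derivable_nS h); apply: derivable_nM; first exact: derivable_n_cst.
by apply: IH; case: hf.
Qed.

Lemma derivable_nV n f : (forall x, f x != 0) -> derivable_n n f ->
  derivable_n n (fun x => (f x)^-1).
Proof.
move=> f0; elim: n => [|n IH] hf;
  have h x := is_derive_inv (f0 x) (derivable_n_is_derive hf x).
  by split => // x; have [] := h x.
apply: (derivable_nS h).
under eq_fun do rewrite -mulN1r.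
apply: derivable_nM; first exact: derivable_n_cst.
have hV := IH (derivable_nW hf).
apply: derivable_nM; first by case: hf.
exact: derivable_nM.
Qed.

Lemma smoothD f g : smooth f -> smooth g -> smooth (fun x => f x + g x).
Proof. by move=> hf hg n; exact: derivable_nD. Qed.

Lemma smoothM f g : smooth f -> smooth g -> smooth (fun x => f x * g x).
Proof. by move=> hf hg n; exact: derivable_nM. Qed.

Lemma smooth_affine f (a b : R) : smooth f -> smooth (fun x => f (a * x + b)).
Proof. by move=> hf n; exact: derivable_n_affine. Qed.

Lemma smoothZ f (c : R) : smooth f -> smooth (fun x => c * f x).
Proof. by move=> hf; apply: smoothM => // n; exact: derivable_n_cst. Qed.

Lemma smoothV f : (forall x, f x != 0) -> smooth f -> smooth (fun x => (f x)^-1).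
Proof. by move=> f0 hf n; exact: derivable_nV. Qed.

End Smooth.

(** * A flat function and a smooth step *)

Section Flat.
Context {R : realType}.

(** The classical function exp(-1/x), with the powers of 1/x built in: the derivative of [flat k] is
    a combination of [flat k.+2] and [flat k.+1], so the family is stable under differentiation and
    a single induction proves smoothness. *)
Definition flat (k : nat) (x : R) : R :=
  if x <= 0 then 0 else x^-1 ^+ k * expR (- x^-1).

Lemma flat_ge0 k x : 0 <= flat k x.
Proof.
rewrite /flat; case: (leP x 0) => // x0.
by rewrite mulr_ge0 ?expR_ge0// exprn_ge0// invr_ge0 ltW.
Qed.

Lemma flat_eq0 k x : x <= 0 -> flat k x = 0.
Proof. by rewrite /flat => ->. Qed.

Lemma flat_gt0 k x : 0 < x -> 0 < flat k x.
Proof.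
move=> x0; rewrite /flat leNgt x0/=.
by rewrite mulr_gt0 ?expR_gt0// exprn_gt0// invr_gt0.
Qed.

Lemma flat_le_sqr k : exists2 C : R, 0 <= C & forall x, flat k x <= C * x ^+ 2.
Proof.
(* With y = 1/x, exp(y) is the m-th power of exp(y/m), hence at least (y/m)^m. Of the [k.+2] powers,
   [k] absorb the factor y^k and the remaining two give x^2. *)
pose m := k.+2; exists (m%:R ^+ m); first exact: exprn_ge0.
move=> x; rewrite /flat; case: (leP x 0) => x0; first by rewrite mulr_ge0 ?sqr_ge0 ?exprn_ge0.
set y := x^-1; have y0 : 0 < y by rewrite invr_gt0.
have h : (y / m%:R) ^+ m <= expR y.
  have -> : expR y = expR (y / m%:R) ^+ m.
    by rewrite -expRM_natl mulrCA mulfV ?mulr1// pnatr_eq0.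
  rewrite lerXn2r ?nnegrE ?divr_ge0 ?expR_ge0 ?(ltW y0)//.
  by apply: le_trans (expR_ge1Dx _); rewrite lerDr.
rewrite expRN ler_pdivrMr ?expR_gt0//.
have c0 : 0 <= m%:R ^+ m * x ^+ 2 by rewrite mulr_ge0 ?sqr_ge0// exprn_ge0.
apply: le_trans (ler_wpM2l c0 h).
suff -> : m%:R ^+ m * x ^+ 2 * (y / m%:R) ^+ m = y ^+ k by [].
rewrite expr_div_n; set M := _ ^+ m.
have M0 : M != 0 by rewrite expf_neq0// pnatr_eq0.
have -> : y ^+ m = y * (y * y ^+ k) by rewrite /m !exprS.
rewrite -[x]invrK -/y.
by field; rewrite M0 gt_eqF.
Qed.

Lemma flat_derive k (x : R) :
  is_derive x 1 (flat k) (flat k.+2 x - k%:R * flat k.+1 x).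
Proof.
have [x0|x0|->] := ltgtP x 0.
- rewrite !flat_eq0 ?ltW// mulr0 subr0.
  apply: (@near_eq_is_derive _ R R (cst (0 : R))).
  by near=> z; rewrite flat_eq0//; apply: ltW; near: z; exact: lt_nbhsl.
-  have x1 : x != 0 by rewrite gt_eqF.
  have dV : is_derive x 1 (fun x : R => x^-1) (- (x^-1 * x^-1)).
    have := @is_derive_inv _ id x 1 x1 (is_derive_id x 1); rewrite mul1r.
    exact.
  have dX : is_derive x 1 (fun x : R => x^-1 ^+ k)
      (- (k%:R * x^-1 ^+ k.-1 * (x^-1 * x^-1))).
    by have := is_derive_pow k dV; rewrite mulrN.
  have dE : is_derive x 1 (fun x : R => expR (- x^-1)) (expR (- x^-1) * (x^-1 * x^-1)).
    have := is_derive_expR_comp (is_derive_scal (-1) dV).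
    rewrite !mulN1r opprK.
    by under eq_fun do rewrite mulN1r.
  have dXE := is_derive_mul dX dE.
  have e : \near x, x^-1 ^+ k * expR (- x^-1) = flat k x.
    near=> z; rewrite /flat leNgt; suff -> : 0 < z by [].
    by near: z; exact: lt_nbhsr.
  apply: (is_derive_eq (@near_eq_is_derive _ R R _ _ x 1 _ e dXE)).
  rewrite /flat leNgt x0/=.
  case: k {dX dXE e} => [|k]; first by rewrite !mul0r; ring.
  by rewrite /= !exprS; ring.
rewrite !(flat_eq0 _ (lexx 0)) mulr0 subr0.
have [C C0 hC] := flat_le_sqr k.
apply: (@is_derive_quadratic _ _ _ _ C) => h _.
rewrite addr0 (flat_eq0 k (lexx 0)) mulr0 !subr0 ger0_norm ?flat_ge0//.
Unshelve. all: by end_near. Qed.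

End Flat.

Section MeanValue.
Context {R : realType}.
Implicit Types f df : R -> R.

Lemma mean_value_le f df (x y C : R) :
  (forall z : R, is_derive z 1 f (df z)) ->
  (forall z, `|z - x| <= `|y - x| -> `|df z| <= C) ->
  `|f y - f x| <= C * `|y - x|.
Proof.
move=> hf hC.
have cf (A : set R) : {within A, continuous f}.
  by apply: continuous_subspaceT => z; exact: is_derive_continuous (hf z).
have [xy|yx] := leP x y.
  have [c] := MVT_segment xy (fun z _ => hf z) (cf _).
  rewrite in_itv/= => /andP[xc cy] ->.
  rewrite normrM ler_wpM2r// hC//.
  by rewrite !ger0_norm ?subr_ge0// lerD2r.
have [c] := MVT_segment (ltW yx) (fun z _ => hf z) (cf _).
rewrite in_itv/= => /andP[xc cy]; rewrite distrC => ->.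
rewrite normrM (distrC y x) ler_wpM2r// hC//.
by rewrite (distrC c x) (distrC y x) !ger0_norm ?subr_ge0// ?lerD2l ?lerN2// ltW.
Qed.

(** The mean value inequality is applied to [df], then to [f] minus its tangent; hence the constant
    is [C] rather than half of it. *)
Lemma taylor1_le f df ddf (x h C : R) :
  (forall z : R, is_derive z 1 f (df z)) -> (forall z : R, is_derive z 1 df (ddf z)) ->
  (forall z, `|ddf z| <= C) ->
  `|f (h + x) - f x - h * df x| <= C * h ^+ 2.
Proof.
move=> hf hdf hC.
have hg (z : R) : is_derive z 1 (fun y => f y - df x * y) (df z - df x).
  have := is_derive_sub (hf z) (is_derive_scal (df x) (is_derive_id z 1)).
  by rewrite mulr1.
have C0 : 0 <= C by exact: le_trans (hC 0).
have := @mean_value_le _ _ x (h + x) (C * `|h|) hg.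
rewrite addrK -mulrA -expr2 real_normK ?num_real// => H.
have -> : f (h + x) - f x - h * df x = f (h + x) - df x * (h + x) - (f x - df x * x).
  by ring.
apply: H => z zx; apply: le_trans (ler_wpM2l C0 zx).
exact: mean_value_le.
Qed.

Lemma nondecreasing_derive f df (x y : R) : x <= y ->
  (forall z : R, x <= z <= y -> is_derive z 1 f (df z)) ->
  (forall z, x <= z <= y -> 0 <= df z) ->
  f x <= f y.
Proof.
move=> xy hf df0.
have cf : {within `[x, y], continuous f}.
  apply: derivable_within_continuous => z; rewrite in_itv/= => /hf.
  by case.
have hf' z : z \in `]x, y[ -> is_derive z 1 f (df z).
  by rewrite in_itv/= => /andP[xz zy]; apply: hf; rewrite !ltW.
have [c] := MVT_segment xy hf' cf.
rewrite in_itv/= => cxy e; rewrite -subr_ge0 e mulr_ge0 ?subr_ge0//.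
exact: df0.
Qed.

Lemma derive1_support f (l r : R) : (forall x, f x != 0 -> l <= x <= r) ->
  forall x, derive1 f x != 0 -> l <= x <= r.
Proof.
move=> sf x; apply: contraNT; rewrite negb_and -!ltNge => h.
apply/eqP; apply: is_derive_derive1.
apply: (@near_eq_is_derive _ R R (cst (0 : R))).
have f0 z : (z < l) || (r < z) -> f z = 0.
  move=> h'; apply/eqP; apply: contraLR h' => /sf.
  by rewrite negb_or -!leNgt.
case/orP : h => h; near=> z; rewrite /cst f0//; apply/orP.
  by left; near: z; exact: lt_nbhsl.
by right; near: z; exact: lt_nbhsr.
Unshelve. all: by end_near. Qed.

Lemma bounded_support f (l r : R) : continuous f -> (forall x, f x != 0 -> l <= x <= r) ->
  exists2 C, 0 <= C & forall x, `|f x| <= C.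
Proof.
move=> cf sf; have [lr|rl] := leP l r; last first.
  exists 0 => // x; have [->|/sf] := eqVneq (f x) 0; first by rewrite normr0.
  by move=> /andP[/le_trans h /h]; rewrite leNgt rl.
have cn : {within `[l, r], continuous (fun x => `|f x|)}.
  apply: continuous_subspaceT => z.
  by apply: continuous_comp; [exact: cf|exact: norm_continuous].
have [c _ hc] := EVT_max lr cn.
exists `|f c| => // x; have [->|/sf xlr] := eqVneq (f x) 0; first by rewrite normr0.
by apply: hc; rewrite in_itv.
Qed.

Lemma test_fun_smooth f (l r : R) (U : set R) : smooth f ->
  (forall x, f x != 0 -> l <= x <= r) -> `[l, r] `<=` U -> test_fun U f.
Proof.
move=> /smoothP sf slr lrU.
have cl : closure [set x | f x != 0] `<=` `[l, r].
  have <- : closure `[l, r]%classic = `[l, r]%classic :> set R.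
    by apply/esym/closure_id; exact: interval_closed.
  by apply: closure_subset => x /= /slr; rewrite in_itv.
split => //; last exact: subset_trans cl lrU.
apply: (subclosed_compact (@closed_closure _ _) (@segment_compact _ l r)) => //.
Qed.

Lemma test_fun_comb (U : set R) (a : R) f g : test_fun U f -> test_fun U g ->
  test_fun U (a *: f + g).
Proof.
move=> [/smoothP sf cf fU] [/smoothP sg cg gU].
have sub : [set x | (a *: f + g) x != 0] `<=` [set x | f x != 0] `|` [set x | g x != 0].
  move=> x; rewrite /= -[(a *: f + g) x]/(a * f x + g x).
  have [->|f0] := eqVneq (f x) 0; last by left.
  by rewrite mulr0 add0r; right.
have cl : closure [set x | (a *: f + g) x != 0] `<=`
    closure [set x | f x != 0] `|` closure [set x | g x != 0].
  by rewrite -closureU; exact: closure_subset.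
split.
- by apply/smoothP; exact: smoothD (smoothZ a sf) sg.
- apply: (subclosed_compact (@closed_closure _ _) _ cl).
  exact: compactU.
- by apply: subset_trans cl _; rewrite subUset.
Qed.

Lemma test_funB (U : set R) f g : test_fun U f -> test_fun U g ->
  test_fun U (f - g).
Proof. by move=> tf tg; rewrite addrC -scaleN1r; exact: test_fun_comb. Qed.

End MeanValue.

Section Mollifier.
Context {R : realType}.

Lemma smooth_flat k : smooth (@flat R k).
Proof.
move=> n; elim: n k => [|n IH] k.
  by split => // x; have [] := flat_derive k x.
apply: (derivable_nS (flat_derive k)).
have -> : (fun x : R => flat k.+2 x - k%:R * flat k.+1 x) =
          (fun x => flat k.+2 x + (- k%:R) * flat k.+1 x).
  by apply/funext => x; rewrite mulNr.
apply: derivable_nD; first exact: IH.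
apply: derivable_nM; [exact: derivable_n_cst|exact: IH].
Qed.

(** [A] vanishes up to 1/3 and [B] from 2/3 on, never both, so [A / (A + B)] is a smooth step. Its
    transition lies strictly inside ]0, 1[, so that a translation by 0 or by 1 puts it strictly on
    one side of the origin. [A'] and [B'] use [flat 2], the derivative of [flat 0]. *)
Let A (x : R) := flat 0 (1 * x + - (3^-1)).
Let B (x : R) := flat 0 (-1 * x + 2 / 3).
Let A' (x : R) := flat 2 (1 * x + - (3^-1)).
Let B' (x : R) := flat 2 (-1 * x + 2 / 3).

Let AB x : A x + B x != 0.
Proof.
rewrite gt_eqF// /A /B; have [h|h] := leP x (1 / 2).
  by rewrite ltr_wpDl ?flat_ge0// flat_gt0//; lra.
by rewrite ltr_wpDr ?flat_ge0// flat_gt0//; lra.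
Qed.

Definition smooth_step (x : R) : R := A x * (A x + B x)^-1.

Lemma smooth_smooth_step : smooth smooth_step.
Proof.
have sA : smooth A by apply: smooth_affine; exact: smooth_flat.
have sB : smooth B by apply: smooth_affine; exact: smooth_flat.
apply: smoothM => //; apply: smoothV; first exact: AB.
exact: smoothD.
Qed.

Lemma derive1_smooth_step x :
  derive1 smooth_step x = (A' x * B x + A x * B' x) * ((A x + B x)^-1 ^+ 2).
Proof.
have dA : is_derive x 1 A (A' x).
  apply: is_derive_eq (is_derive_affine (flat_derive 0 _)) _.
  by rewrite mul0r subr0 mul1r.
have dB : is_derive x 1 B (- B' x).
  apply: is_derive_eq (is_derive_affine (flat_derive 0 _)) _.
  by rewrite mul0r subr0 mulN1r.
apply: is_derive_derive1.
have dV := @is_derive_inv _ (fun x => A x + B x) x _ (AB x) (is_derive_add dA dB).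
apply: (is_derive_eq (is_derive_mul dA dV)).
by have := AB x; move: (A x) (B x) => a b ab; field.
Qed.

Lemma derive1_smooth_step_ge0 x : 0 <= derive1 smooth_step x.
Proof.
rewrite derive1_smooth_step mulr_ge0 ?sqr_ge0// /A /B /A' /B'.
by rewrite addr_ge0// mulr_ge0// flat_ge0.
Qed.

Lemma smooth_step_eq0 x : x <= 3^-1 -> smooth_step x = 0.
Proof. by move=> h; rewrite /smooth_step /A flat_eq0 ?mul0r//; lra. Qed.

Lemma smooth_step_eq1 x : 2 / 3 <= x -> smooth_step x = 1.
Proof.
move=> h; rewrite /smooth_step.
have B0 : B x = 0 by rewrite /B flat_eq0//; lra.
by have := AB x; rewrite B0 addr0 => ?; rewrite mulfV.
Qed.

Lemma smooth_step_bnd x : 0 <= smooth_step x <= 1.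
Proof.
have a : 0 <= A x by exact: flat_ge0.
have b : 0 <= B x by exact: flat_ge0.
rewrite /smooth_step divr_ge0 ?addr_ge0//= ler_pdivrMr ?mul1r ?lerDl//.
by rewrite lt_neqAle eq_sym AB addr_ge0.
Qed.

Lemma derive1_smooth_step_support x : derive1 smooth_step x != 0 -> 3^-1 <= x <= 2 / 3.
Proof.
apply: contraNT; rewrite negb_and -!ltNge derive1_smooth_step => /orP[h|h].
  by rewrite /A /A' !(flat_eq0 _ (_ : 1 * x + - (3^-1) <= 0)) ?mul0r ?addr0 ?mul0r//; lra.
by rewrite /B /B' !(flat_eq0 _ (_ : -1 * x + 2 / 3 <= 0)) ?mulr0 ?addr0 ?mul0r//; lra.
Qed.

End Mollifier.

(** * Lebesgue points *)

Section LebesguePoints.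
Context {R : realType}.
Local Notation mu := (@lebesgue_measure R).

Lemma integrable_ball (D : set R) (f : R -> R) (a r : R) : ball a r `<=` D -> measurable D ->
  integ D f -> integ (ball a r) f.
Proof.
move=> aD mD; apply: integrableS => //.
exact: measurable_ball.
Qed.

Lemma lebesgue_pt_le (f : R -> R) (a e : R) : 0 < e -> lebesgue_pt f a ->
  exists2 d, 0 < d & forall r, 0 < r < d ->
    (\int[mu]_(y in ball a r) (`|f y - f a|)%:E <= (e * r)%:E)%E.
Proof.
move=> e0 fa.
have e2 : (0 < (e / 2)%:E)%E by rewrite lte_fin divr_gt0.
have /fine_cvgP[fn /cvgrPdist_lt/(_ (e / 2))] := fa.
rewrite divr_gt0// => /(_ isT) hn.
have : \forall r \near 0^'+, davg f a r \is a fin_num /\ `|0 - (fine \o davg f a) r| < e / 2.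
  by near=> r; split; near: r.
rewrite near_withinE/= => /nbhs_normP[d /= d0 hd].
exists d => // r /andP[r0 rd].
have [|//|fin] := hd r; first by rewrite /= sub0r normrN gtr0_norm.
rewrite sub0r normrN => lt.
have : (davg f a r <= (e / 2)%:E)%E.
  rewrite -(fineK fin) lee_fin ltW// (le_lt_trans _ lt)//= ler_norm//.
rewrite /davg /iavg lebesgue_measure_ball ?(ltW r0)// inver mulrn_eq0/= gt_eqF//.
rewrite lee_pdivrMl ?mulrn_wgt0//.
rewrite -EFinM => /le_trans; apply.
by rewrite lee_fin -mulr_natr; lra.
Unshelve. all: by end_near. Qed.

Lemma ball_average_bound (x y e r : R) : 0 < r ->
  x <= e / 2 * r -> y < e / 8 -> x + 2 * y * (r *+ 2) <= e * r.
Proof. by rewrite -mulr_natr => ? ? ?; nra. Qed.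

Lemma ae_lebesgue_pt (D : set R) (f : R -> R) : measurable D -> integ D f ->
  {ae mu, forall a, lebesgue_pt (f \_ D) a}.
Proof. by move=> mD iF; exact/lebesgue_differentiation/integrable_locally. Qed.

Lemma ae_exists_itv (P : R -> Prop) (a b : R) : a < b ->
  {ae mu, forall x, P x} -> exists2 x, a < x < b & P x.
Proof.
move=> ab [N [mN N0 PN]].
apply: contrapT => h.
have abN : `]a, b[%classic `<=` N.
  move=> x /=; rewrite in_itv/= => xab; apply: PN => /= Px.
  by apply: h; exists x.
have : (mu `]a, b[%classic <= mu N)%E.
  by apply: le_measure => //; apply/mem_set => //; exact: measurable_itv.
rewrite N0 lebesgue_measure_itv/= lte_fin ab -EFinB lee_fin.
by rewrite leNgt subr_gt0 ab.
Qed.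

Lemma ae_forall_seq (I : eqType) (r : seq I) (P : I -> R -> Prop) :
  (forall i, i \in r -> {ae mu, forall a, P i a}) ->
  {ae mu, forall a, forall i, i \in r -> P i a}.
Proof.
elim: r => [|i r IH] h; first by apply: aeW => a i.
apply: ae_imp2 (h i (mem_head _ _)) (IH _) => [a Pi Pr j|j jr].
  by rewrite inE => /predU1P[->//|]; exact: Pr.
by apply: h; rewrite inE jr orbT.
Qed.

End LebesguePoints.

Section VectorLebesgue.
Context {R : realType} {E : lmodType R} {X : nspace E} {B : E -> E -> R}.
Hypothesis hB : hilbert_form X B.
Local Notation mu := (@lebesgue_measure R).
Variables (D : set R) (u : R -> E).
Hypothesis mD : measurable D.
Hypothesis Dfin : (mu D < +oo)%E.
Hypothesis su : strongly_measurable X D u.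

Let pu t : D t -> pts X (u t) := su.1 t.

Lemma measurable_nrm_sub e : pts X e -> measurable_fun D (fun t => nrm X (u t - e)).
Proof.
move=> pe; have [s us] := su.2.
apply: (approximates_measurable (phi := fun v _ => nrm X (v - e)) (C := cst 1) _ pu _ us) => //.
move=> v v' t Dt pv pv'; rewrite mul1r.
rewrite (le_trans (hnrm_dist hB _ _))//; do ?[exact: (hptsB hB)].
by rewrite opprB addrA subrK.
Qed.

Lemma measurable_nrm : measurable_fun D (fun t => nrm X (u t)).
Proof.
have := measurable_nrm_sub (hf0 hB).
by under eq_fun do rewrite subr0.
Qed.

Lemma measurable_form v : pts X v -> measurable_fun D (fun t => B (u t) v).
Proof.
move=> pv; have [s us] := su.2.
apply: (approximates_measurable (phi := fun e _ => B e v) (C := cst (nrm X v)) _ pu _ us) => //.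
move=> w w' t Dt pw pw'; rewrite mulrC -(hfBl hB)//.
by apply: (hf_cauchy_schwarz hB) => //; exact: (hptsB hB).
Qed.

Hypothesis iu : integ D (nrm X \o u).

Lemma integ_nrm_sub e : pts X e -> integ D (fun t => nrm X (u t - e)).
Proof.
move=> pe; apply: (le_integ (g := fun t => nrm X (u t) + nrm X e)) => //.
- exact: measurable_nrm_sub.
- move=> t Dt; rewrite ger0_norm ?(hnrm_ge0 hB)//.
  by apply: (hnrmB hB) => //; exact: pu.
- by apply: integD => //; exact: integ_cst.
Qed.

(** The scalar Lebesgue theorem applies simultaneously to the countably many functions
    [nrm X (u t - e)], where [e] is a value of some approximating simple function. At [a] one such
    value [s n a] is within [e / 8] of [u a]. The Lebesgue point contributes [e / 2 * r], and the
    two replacements of [s n a] by [u a], over a ball of length [2 * r], at most another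
    [e / 2 * r]. *)
Lemma ae_vector_lebesgue_pt : open D ->
  {ae mu, forall a, D a -> forall e : R, 0 < e -> exists2 d : R, 0 < d &
    forall r, 0 < r < d -> ball a r `<=` D /\
      \int[mu]_(t in ball a r) nrm X (u t - u a) <= e * r}.
Proof.
move=> oD; have [s [ss us]] := su.2.
have aeP : {ae mu, forall a, forall n e, e \in (fset_set (range (s n)) : seq E) ->
    lebesgue_pt ((fun t => nrm X (u t - e)) \_ D) a}.
  apply: ae_foralln => n; apply: ae_forall_seq => e.
  have [fs _ ps] := ss n.
  rewrite in_fset_set// => /set_mem[t _ <-].
  by apply: ae_lebesgue_pt => //; exact: integ_nrm_sub.
apply: ae_imp aeP => a ha Da e e0.
have [n hn] : exists n, nrm X (u a - s n a) < e / 8.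
  have /cvgrPdist_lt/(_ (e / 8)) := us a Da.
  rewrite divr_gt0// => /(_ isT)[N _ /(_ N (leqnn N))].
  by rewrite sub0r normrN => h; exists N; exact: le_lt_trans (ler_norm _) h.
have [fs _ ps] := ss n.
have Leb : lebesgue_pt ((fun t => nrm X (u t - s n a)) \_ D) a.
  by apply: (ha n); rewrite in_fset_set//; apply/mem_set; exists a.
have e2 : 0 < e / 2 by rewrite divr_gt0.
have [d1 d10 h1] := lebesgue_pt_le e2 Leb.
have [d2 /= d20 h2] := open_subball oD Da.
exists (Num.min d1 d2); first by rewrite lt_min d10.
move=> r /andP[r0]; rewrite lt_min => /andP[rd1 rd2].
have aD : ball a r `<=` D.
  apply: h2 => //=; rewrite sub0r normrN gtr0_norm//.
split => //.
have pua := pu Da.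
have ib e' : pts X e' -> integ (ball a r) (fun t => nrm X (u t - e')).
  by move=> pe'; exact: integrable_ball (integ_nrm_sub pe').
have mb : measurable (ball a r) by exact: measurable_ball.
have bfin : (mu (ball a r) < +oo)%E by rewrite lebesgue_measure_ball ?(ltW r0)// ltry.
have rr : 0 < r < d1 by rewrite r0.
pose c := nrm X (u a - s n a).
have ic k : integ (ball a r) (cst k) by exact: integ_cst.
have i1 := ib _ (ps a).
apply: (@le_trans _ _ (\int[mu]_(t in ball a r)
    (`|nrm X (u t - s n a) - c| + 2 * c))).
  apply: le_Rintegral => //; first exact: ib.
    exact: (integD mb (integ_norm mb (integB mb i1 (ic c))) (ic (2 * c))).
  move=> t /aD Dt; have put := pu Dt.
  have := hnrm_triangle hB put (ps a) pua.
  rewrite (hnrmC hB (ps a) pua) -/c => h.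
  by have := ler_norm (nrm X (u t - s n a) - c); lra.
rewrite RintegralD//; [|exact: (integ_norm mb (integB mb i1 (ic c)))|exact: ic].
rewrite Rintegral_cst//.
have -> : fine (mu (ball a r)) = r *+ 2 by rewrite lebesgue_measure_ball ?(ltW r0).
have : \int[mu]_(t in ball a r) `|nrm X (u t - s n a) - c| <= e / 2 * r.
  have := h1 r rr.
  rewrite -lee_fin; apply: le_trans.
  rewrite fineK; last first.
    apply: integrable_fin_num => //; exact: (integ_norm mb (integB mb i1 (ic c))).
  rewrite le_eqVlt; apply/orP; left; apply/eqP.
  apply: eq_integral => t /set_mem /aD Dt.
  by rewrite !patchE !mem_set.
move=> h; have cn : c < e / 8 := hn.
exact: (ball_average_bound r0 h cn).
Qed.

End VectorLebesgue.

(** * Mollification in time *)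

Section Kernel.
Context {R : realType}.
Implicit Types Psi : R -> R.

(** The support is left free: primitives of mollifiers, which are smooth Heaviside functions, serve
    as weights in the energy estimates and must qualify as well. *)
Definition bounded_smooth Psi :=
  smooth Psi /\ forall n, exists2 C : R, 0 <= C & forall x, `|derive1n n Psi x| <= C.

Lemma kernel_derive1 Psi : bounded_smooth Psi -> bounded_smooth (derive1 Psi).
Proof.
move=> [sP bP]; split; first exact: smooth_derive1.
by move=> n; have [C C0 hC] := bP n.+1; exists C => // x; rewrite -derive1Sn.
Qed.

Lemma kernel_bnd Psi : bounded_smooth Psi -> exists2 C : R, 0 <= C & forall x, `|Psi x| <= C.
Proof. by move=> [_ /(_ 0%N)]. Qed.

Lemma kernel_is_derive Psi (x : R) : bounded_smooth Psi -> is_derive x 1 Psi (derive1 Psi x).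
Proof. by move=> [sP _]; apply: derivable_is_derive1; exact: smooth_derivable. Qed.

Lemma smooth_derive1nD Psi Phi n : smooth Psi -> smooth Phi ->
  derive1n n (fun x => Psi x + Phi x) = (fun x => derive1n n Psi x + derive1n n Phi x).
Proof.
elim: n Psi Phi => [|n IH] Psi Phi sP sF //.
rewrite derive1Sn !derive1Sn -IH; do ?[exact: smooth_derive1].
congr derive1n; apply/funext => x; apply: is_derive_derive1.
by apply: is_derive_add; apply: derivable_is_derive1; exact: smooth_derivable.
Qed.

Lemma smooth_derive1n_affine Psi (a b : R) n : smooth Psi ->
  derive1n n (fun x => Psi (a * x + b)) = (fun x => a ^+ n * derive1n n Psi (a * x + b)).
Proof.
elim: n Psi => [|n IH] Psi sP; first by apply/funext => x; rewrite mul1r.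
have d1 : derive1 (fun x => Psi (a * x + b)) = fun x => a * derive1 Psi (a * x + b).
  apply/funext => x; apply: is_derive_derive1; apply: is_derive_affine.
  by apply: derivable_is_derive1; exact: smooth_derivable.
rewrite derive1Sn d1.
have -> : forall F, smooth F ->
    derive1n n (fun x => a * F x) = (fun x => a * derive1n n F x).
  elim: n {IH} => [//|n IH] F sF.
  rewrite !derive1Sn -IH; last exact: smooth_derive1.
  congr derive1n; apply/funext => x; apply: is_derive_derive1.
  by apply: is_derive_scal; apply: derivable_is_derive1; exact: smooth_derivable.
  rewrite IH; last exact: smooth_derive1.
  by apply/funext => x; rewrite mulrA -exprS derive1Sn.
by apply: smooth_affine; exact: smooth_derive1.
Qed.

Lemma kernel_affine Psi (a b : R) : bounded_smooth Psi -> bounded_smooth (fun x => Psi (a * x + b)).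
Proof.
move=> [sP bP]; split; first exact: smooth_affine.
move=> n; have [C C0 hC] := bP n; exists (`|a ^+ n| * C); first exact: mulr_ge0.
move=> x; rewrite smooth_derive1n_affine// normrM.
by apply: ler_wpM2l.
Qed.

Lemma kernelD Psi Phi : bounded_smooth Psi -> bounded_smooth Phi -> bounded_smooth (fun x => Psi x + Phi x).
Proof.
move=> [sP bP] [sF bF]; split; first exact: smoothD.
move=> n; have [C C0 hC] := bP n; have [C' C'0 hC'] := bF n.
exists (C + C'); first exact: addr_ge0.
by move=> x; rewrite smooth_derive1nD// (le_trans (ler_normD _ _))// lerD.
Qed.

Lemma kernelN Psi : bounded_smooth Psi -> bounded_smooth (fun x => - Psi x).
Proof.
move=> [sP bP].
have sN (F : R -> R) : smooth F -> smooth (fun x => - F x).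
  by move=> sF; under eq_fun do rewrite -mulN1r; exact: smoothZ.
split; first exact: sN.
have dN n : derive1n n (fun x => - Psi x) = (fun x => - derive1n n Psi x).
  elim: n Psi sP {bP} => [//|n IH] F sF.
  rewrite !derive1Sn -IH; last exact: smooth_derive1.
  congr derive1n; apply/funext => x; apply: is_derive_derive1.
  have := is_derive_scal (-1) (derivable_is_derive1 (smooth_derivable (x := x) sF)).
  by rewrite mulN1r; under eq_fun do rewrite mulN1r.
by move=> n; have [C C0 hC] := bP n; exists C => // x; rewrite dN normrN.
Qed.

Lemma kernelB Psi Phi : bounded_smooth Psi -> bounded_smooth Phi -> bounded_smooth (fun x => Psi x - Phi x).
Proof. by move=> kP kF; apply: kernelD => //; exact: kernelN. Qed.

Lemma kernel_support Psi (l r : R) : smooth Psi ->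
  (forall x, Psi x != 0 -> l <= x <= r) -> bounded_smooth Psi.
Proof.
move=> sP suppP; split => // n.
suff [sn suppn] : smooth (derive1n n Psi) /\ forall x, derive1n n Psi x != 0 -> l <= x <= r.
  by apply: bounded_support suppn; exact: smooth_continuous.
elim: n => [//|n [sn suppn]]; rewrite derive1nS; split.
  exact: smooth_derive1.
exact: derive1_support.
Qed.

(** The step does not have compact support but its derivative does, so order 0 is treated apart. *)
Lemma kernel_smooth_step : bounded_smooth (@smooth_step R).
Proof.
split; first exact: smooth_smooth_step.
case=> [|n].
  exists 1 => // x; have /andP[h0 h1] := smooth_step_bnd x.
  by rewrite /derive1n/= ger0_norm.
have [_ /(_ n)[C C0 hC]] : bounded_smooth (derive1 (@smooth_step R)).
  apply: (@kernel_support _ 3^-1 (2 / 3)).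
    by apply: smooth_derive1; exact: smooth_smooth_step.
  exact: derive1_smooth_step_support.
by exists C => // x; rewrite derive1Sn.
Qed.

Lemma kernel_continuous_shift Psi (a : R) : bounded_smooth Psi -> continuous (fun t => Psi (t - a)).
Proof.
move=> [sP _].
have -> : (fun t => Psi (t - a)) = (fun t => Psi (1 * t + - a)).
  by apply/funext => t; rewrite mul1r.
by apply: smooth_continuous; exact: smooth_affine.
Qed.

Lemma kernel_shift_derive1 Psi (a : R) : bounded_smooth Psi ->
  derive1 (fun t => Psi (t - a)) = (fun t => derive1 Psi (t - a)).
Proof.
move=> kP; apply/funext => t; apply: is_derive_derive1.
have := is_derive_affine (kernel_is_derive (1 * t + - a) kP).
by rewrite !mul1r; under eq_fun do rewrite mul1r.
Qed.

Lemma kernel_taylor Psi : bounded_smooth Psi -> exists2 C, 0 <= C &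
  forall x h : R, `|Psi (h + x) - Psi x - h * derive1 Psi x| <= C * h ^+ 2.
Proof.
move=> kP; have [C C0 hC] := kP.2 2%N.
have hC' z : `|derive1 (derive1 Psi) z| <= C by exact: hC.
have kP' := kernel_derive1 kP.
exists C => // x h.
exact: (taylor1_le x h (fun z => kernel_is_derive z kP) (fun z => kernel_is_derive z kP') hC').
Qed.

End Kernel.

(** The scalar core of the derivative of [B (y a) (y a)] along a curve y(a+h) = y + h y' + r with
    |r| at most C h^2. Here [b], [b'], [p], [q] stand for B(y, y), B(y, y'), B(y, r), B(y', r), and
    [n], [n'], [r] for the norms. *)
Lemma curve_remainder_bound (R : realDomainType) (h n n' r C b b' p q : R) :
  `|h| <= 1 -> 0 <= n -> 0 <= n' -> 0 <= r -> 0 <= C -> r <= C * h ^+ 2 ->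
  `|q| <= n' * r -> `|p| <= n * r ->
  `|b + 2 * (h * b') + h * (h * n' ^+ 2) + 2 * (p + h * q) + r ^+ 2 - b - h * (2 * b')|
    <= (n' ^+ 2 + 2 * n * C + 2 * n' * C + C ^+ 2) * h ^+ 2.
Proof.
move=> h1 n0 n'0 r0 C0 rC qn pn.
have -> : b + 2 * (h * b') + h * (h * n' ^+ 2) + 2 * (p + h * q) + r ^+ 2 - b - h * (2 * b')
  = h ^+ 2 * n' ^+ 2 + 2 * p + 2 * (h * q) + r ^+ 2 by ring.
have h2 : h ^+ 2 <= 1 by rewrite -real_normK ?num_real// expr_le1.
have r1 : r ^+ 2 <= C ^+ 2 * h ^+ 2.
  rewrite expr2 [C ^+ 2]expr2 -mulrA; apply: ler_pM => //.
  by apply: le_trans rC _; rewrite ler_piMr.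
have p1 : `|p| <= n * C * h ^+ 2 by rewrite (le_trans pn)// -mulrA ler_wpM2l.
have q1 : `|h * q| <= n' * C * h ^+ 2.
  rewrite normrM -[leRHS]mul1r ler_pM// (le_trans qn)// -mulrA ler_wpM2l//.
rewrite ler_norml; move: p1 q1; rewrite !ler_norml => /andP[? ?] /andP[? ?].
by have := sqr_ge0 r; have := sqr_ge0 n'; have := sqr_ge0 h; nra.
Qed.

Lemma sqr_triangle_bound (R : realDomainType) (M x y z : R) : 0 <= z ->
  y ^+ 2 <= M -> x ^+ 2 <= M -> z <= x + y -> z ^+ 2 <= 4 * M.
Proof.
move=> z0 hy hx hz.
have : z ^+ 2 <= (x + y) ^+ 2 by rewrite lerXn2r// nnegrE// (le_trans z0).
by have := sqr_ge0 (x - y); rewrite sqrrB sqrrD; lra.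
Qed.

Lemma cvg_sqr_sum0 (R : realType) (x y : nat -> R) :
  x n @[n --> \oo] --> (0 : R) -> y n @[n --> \oo] --> (0 : R) ->
  (x n + y n) ^+ 2 @[n --> \oo] --> (0 : R).
Proof.
move=> xc yc.
have h : x n + y n @[n --> \oo] --> (0 + 0 : R) by exact: cvgD.
have : (x n + y n) * (x n + y n) @[n --> \oo] --> ((0 + 0) * (0 + 0) : R) by exact: cvgM.
by rewrite addr0 mulr0; under eq_fun do rewrite -expr2.
Qed.

Lemma quarter_sum_le (R : realFieldType) (e x0 x s k : R) : 0 <= e ->
  x0 <= e / 4 -> `|x - x0| <= s + k -> s <= e / 4 -> k <= e / 4 -> x <= e.
Proof. by move=> ? ?; rewrite ler_norml => /andP[? ?] ? ?; lra. Qed.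

Lemma telescope_le (R : numDomainType) (x y z s t : R) :
  y - x <= s -> z - y <= t -> z - x <= s + t.
Proof. by move=> h1 h2; rewrite -(subrKA y) addrC lerD// addrC. Qed.

Section Curve.
Context {R : realType} {E : lmodType R} {X : nspace E} {B : E -> E -> R}.
Hypothesis hB : hilbert_form X B.

Lemma is_derive_form_curve (y : R -> E) (y' : E) (a C : R) :
  (forall b, pts X (y b)) -> pts X y' ->
  (forall h, `|h| <= 1 -> nrm X (y (h + a) - y a - h *: y') <= C * h ^+ 2) ->
  is_derive a 1 (fun b => B (y b) (y b)) (2 * B (y a) y').
Proof.
move=> py py' hC.
have C0 : 0 <= C.
  have := hC 1; rewrite normr1 expr1n mulr1 => /(_ (lexx _)).
  exact: le_trans (hnrm_ge0 hB _).
set n := nrm X (y a); set n' := nrm X y'.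
have n0 : 0 <= n := hnrm_ge0 hB _.
have n'0 : 0 <= n' := hnrm_ge0 hB _.
apply: (@is_derive_quadratic _ _ _ _ (n' ^+ 2 + 2 * n * C + 2 * n' * C + C ^+ 2)).
move=> h h1; have := hC h h1.
set r := y (h + a) - y a - h *: y'.
have phy := hptsZ hB h py'.
have pr : pts X r by do 2 apply: (hptsB hB) => //.
have er : r = y (h + a) - (y a + h *: y') by rewrite /r opprD addrA.
have -> : y (h + a) = y a + h *: y' + r by rewrite er [RHS]addrC subrK.
have pz := hptsD hB (py a) phy.
clearbody r.
rewrite !(hf_sqrD hB)// (hfDl hB)// !(hfZl hB)// !(hfZr hB)//.
rewrite -(hnrm_sqr hB r) -(hnrm_sqr hB y') -/n'.
move=> rC; have r0 : 0 <= nrm X r := hnrm_ge0 hB _.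
have := hf_cauchy_schwarz hB (py a) pr; have := hf_cauchy_schwarz hB py' pr.
rewrite -/n -/n'.
by move=> q1 p1; apply: (@curve_remainder_bound _ h n n' (nrm X r) C (B (y a) (y a))).
Qed.

End Curve.

(** * Weighted means of a vector-valued function *)

Section WeightedMean.
Context {R : realType} {E : lmodType R} {X : nspace E} {B : E -> E -> R}.
Hypothesis hB : hilbert_form X B.
Local Notation mu := (@lebesgue_measure R).
Variables (D : set R) (u : R -> E).
Hypothesis mD : measurable D.
Hypothesis Dfin : (mu D < +oo)%E.
Hypothesis su : strongly_measurable X D u.
Hypothesis iu : integ D (nrm X \o u).
Implicit Types f g : R -> R.

Let pu t : D t -> pts X (u t) := su.1 t.

Definition weight f := measurable_fun D f /\ exists C : R, forall t, D t -> `|f t| <= C.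

Lemma weightB f g : weight f -> weight g -> weight (fun t => f t - g t).
Proof.
move=> [mf [C fC]] [mg [C' gC']]; split; first exact: measurable_funB.
by exists (C + C') => t Dt; rewrite (le_trans (ler_normB _ _))// lerD ?fC ?gC'.
Qed.

Lemma weightZ (c : R) f : weight f -> weight (fun t => c * f t).
Proof.
move=> [mf [C fC]]; split; first exact: measurable_funM.
by exists (`|c| * C) => t Dt; rewrite normrM ler_wpM2l ?fC.
Qed.

Lemma integ_weight f g : weight f -> integ D g -> integ D (fun t => f t * g t).
Proof. by move=> [mf [C fC]] ig; exact: (integ_bndM mD mf fC ig). Qed.

Lemma integ_weight_norm f g : weight f -> integ D g -> integ D (fun t => `|f t| * g t).
Proof.
move=> [mf [C fC]] ig; apply: (integ_bndM (C := C)) => //.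
  exact: measurableT_comp.
by move=> t Dt; rewrite normr_id fC.
Qed.

Lemma integ_form v : pts X v -> integ D (fun t => B (u t) v).
Proof.
move=> pv; apply: (le_integ (g := fun t => nrm X v * nrm X (u t))) => //.
- exact: measurable_form su _ pv.
- move=> t Dt; rewrite mulrC; apply: (hf_cauchy_schwarz hB) => //; exact: pu.
- exact: integZ.
Qed.

Lemma integ_form_sub z v : pts X z -> pts X v ->
  integ D (fun t => B (u t - z) v).
Proof.
move=> pz pv; apply: (le_integ (g := fun t => nrm X v * nrm X (u t - z))) => //.
- have [s us] := su.2.
  apply: (approximates_measurable (phi := fun e _ => B (e - z) v) (C := cst (nrm X v)) _ pu _ us) => //.
  move=> w w' t Dt pw pw'; rewrite mulrC -(hfBl hB)//; do ?[exact: (hptsB hB)].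
  have -> : w - z - (w' - z) = w - w' by rewrite opprB addrA subrK.
  by apply: (hf_cauchy_schwarz hB) => //; exact: (hptsB hB).
- move=> t Dt; rewrite mulrC; apply: (hf_cauchy_schwarz hB) => //.
  by apply: (hptsB hB) => //; exact: pu.
- by apply: integZ => //; exact: (integ_nrm_sub hB).
Qed.

(** The defining property fixes the mean only up to a null vector. The default 0 of [xget] keeps
    [mean f] in [pts X] for every [f], before existence is known. *)
Definition mean f : E :=
  xget 0 [set y | pts X y /\
    forall v, pts X v -> B y v = \int[mu]_(t in D) (f t * B (u t) v)].

Lemma mean_pts f : pts X (mean f).
Proof. by rewrite /mean; case: xgetP => [y _ []//|_]; exact: hf0 hB. Qed.

Lemma Rintegral_form_le f v z : weight f -> pts X v -> pts X z ->
  `|\int[mu]_(t in D) (f t * B (u t - z) v)| <=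
    \int[mu]_(t in D) (`|f t| * nrm X (u t - z)) * nrm X v.
Proof.
move=> wf pv pz.
have ig : integ D (fun t => f t * B (u t - z) v).
  by apply: integ_weight => //; exact: integ_form_sub.
have ik : integ D (fun t => `|f t| * nrm X (u t - z)).
  by apply: integ_weight_norm => //; exact: (integ_nrm_sub hB).
rewrite (le_trans (normr_Rintegral_le mD ig))// -RintegralZr//.
apply: le_Rintegral => //.
- exact: (integ_norm mD ig).
- by under eq_fun do rewrite mulrC; exact: (integZ (nrm X v) mD ik).
- move=> t Dt; have put := pu Dt; rewrite normrM -mulrA ler_wpM2l//.
  by apply: (hf_cauchy_schwarz hB) => //; exact: (hptsB hB).
Qed.

Lemma meanE f v : weight f -> pts X v ->
  B (mean f) v = \int[mu]_(t in D) (f t * B (u t) v).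
Proof.
move=> wf pv; rewrite /mean; case: xgetP => [y _ [_]|]; first exact.
move=> h; exfalso.
pose l v := \int[mu]_(t in D) (f t * B (u t) v).
have [y py hy] : exists2 y, pts X y & forall v, pts X v -> B y v = l v.
  apply: (hf_riesz hB (C := \int[mu]_(t in D) (`|f t| * nrm X (u t)))).
    move=> a x y px py; rewrite /l -RintegralZl//; last first.
      by apply: integ_weight => //; exact: integ_form.
    rewrite -RintegralD//; last 2 first.
      by apply: integZ => //; apply: integ_weight => //; exact: integ_form.
      by apply: integ_weight => //; exact: integ_form.
    apply: eq_Rintegral => t /set_mem Dt.
    by have put := pu Dt; rewrite (hfDr hB)// ?(hfZr hB)//; [ring|exact: (hptsZ hB)].
  move=> x px; have := Rintegral_form_le wf px (hf0 hB).
  by under eq_Rintegral do rewrite subr0; under [X in _ <= X * _]eq_Rintegral do rewrite subr0.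
by apply: (h y); split.
Qed.

(** A weight of integral 1 makes [z] its own mean, so [mean f - z] pairs like the mean of
    [u t - z]. *)
Lemma mean_dist_le f z : weight f -> pts X z -> \int[mu]_(t in D) f t = 1 ->
  nrm X (mean f - z) <= \int[mu]_(t in D) (`|f t| * nrm X (u t - z)).
Proof.
move=> wf pz f1; have pm := mean_pts f.
have pmz := hptsB hB pm pz.
apply: (hnrm_le_form hB).
  by apply: Rintegral_ge0 => t Dt; rewrite mulr_ge0// (hnrm_ge0 hB).
rewrite -[leLHS]ger0_norm ?(hf_ge0 hB)//.
rewrite [in leLHS](hfBl hB)// meanE//.
have intf : integ D f.
  by have := integ_weight wf (integ_cst 1 mD Dfin); under eq_fun do rewrite mulr1.
have -> : B z (mean f - z) = \int[mu]_(t in D) (f t * B z (mean f - z)).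
  by rewrite RintegralZr// f1 mul1r.
rewrite -RintegralB//; last 2 first.
  by apply: integ_weight => //; exact: integ_form.
  by under eq_fun do rewrite mulrC; exact: (integZ _ mD intf).
apply: le_trans (Rintegral_form_le wf pmz pz).
rewrite le_eqVlt; apply/orP; left; apply/eqP; congr `|_|.
apply: eq_Rintegral => t /set_mem Dt.
by rewrite -mulrBr -(hfBl hB)//; exact: pu.
Qed.

(** Means are linear in the weight only up to null vectors; the combination is therefore estimated
    in norm instead of being rewritten as a single mean. *)
Lemma mean_comb_le f g k (c : R) : weight f -> weight g -> weight k ->
  nrm X (mean f - mean g - c *: mean k) <=
    \int[mu]_(t in D) (`|f t - g t - c * k t| * nrm X (u t)).
Proof.
move=> wf wg wk.
set w := fun t => f t - g t - c * k t.
have ww : weight w by apply: weightB; [exact: weightB|exact: weightZ].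
have pf := mean_pts f; have pg := mean_pts g; have pk := mean_pts k.
have pfg := hptsB hB pf pg; have pck := hptsZ hB c pk.
set y := mean f - mean g - c *: mean k.
have py : pts X y by exact: (hptsB hB).
apply: (hnrm_le_form hB).
  by apply: Rintegral_ge0 => t Dt; rewrite mulr_ge0// (hnrm_ge0 hB).
have i h : weight h -> integ D (fun t => h t * B (u t) y).
  by move=> wh; apply: integ_weight => //; exact: integ_form.
have -> : B y y = \int[mu]_(t in D) (w t * B (u t) y).
  rewrite {1}/y !(hfBl hB)// (hfZl hB)// !meanE// -RintegralZl//; last exact: i.
  rewrite -!RintegralB//; do ?[exact: i].
  - by apply: eq_Rintegral => t _; rewrite /w; ring.
  - exact: (integB mD (i _ wf) (i _ wg)).
  - exact: (integZ c mD (i _ wk)).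
have := Rintegral_form_le ww py (hf0 hB).
under eq_Rintegral do rewrite subr0.
under [X in _ <= X * _ -> _]eq_Rintegral do rewrite subr0.
exact: le_trans (ler_norm _).
Qed.

(** Jensen's inequality: with m the mean, 2 B(u, m) is at most |u|^2 + |m|^2, and integrating
    against [f] turns the left-hand side into 2 |m|^2. *)
Lemma mean_sqr_le f : weight f -> \int[mu]_(t in D) f t = 1 ->
  (forall t, 0 <= f t) ->
  integ D (fun t => nrm X (u t) ^+ 2) ->
  nrm X (mean f) ^+ 2 <= \int[mu]_(t in D) (f t * nrm X (u t) ^+ 2).
Proof.
move=> wf f1 f0 iu2; have pm := mean_pts f.
have intf : integ D f.
  by have := integ_weight wf (integ_cst 1 mD Dfin); under eq_fun do rewrite mulr1.
set m := nrm X (mean f).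
have ifu : integ D (fun t => f t * nrm X (u t) ^+ 2) by exact: integ_weight.
have ifm : integ D (fun t => f t * m ^+ 2).
  by under eq_fun do rewrite mulrC; exact: (integZ _ mD intf).
have : 2 * m ^+ 2 <= \int[mu]_(t in D) (f t * nrm X (u t) ^+ 2 + f t * m ^+ 2).
  have -> : m ^+ 2 = \int[mu]_(t in D) (f t * B (u t) (mean f)).
    by rewrite -meanE// -(hnrm_sqr hB).
  rewrite -RintegralZl//; last by apply: integ_weight => //; exact: integ_form.
  rewrite /= -meanE// -(hnrm_sqr hB) -/m.
  apply: le_Rintegral => //.
  - apply: (integZ 2 mD); apply: integ_weight => //; exact: integ_form.
  - exact: (integD mD ifu ifm).
  move=> t Dt; rewrite mulrCA -mulrDr ler_wpM2l//.
  have := hf_cauchy_schwarz hB (pu Dt) pm; rewrite -/m.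
  move=> /(le_trans (ler_norm _)) h.
  by have := sqr_ge0 (nrm X (u t) - m); rewrite sqrrB; lra.
by rewrite RintegralD// RintegralZr// f1 mul1r; lra.
Qed.

End WeightedMean.

Section ScalarWeight.
Context {R : realType}.
Local Notation mu := (@lebesgue_measure R).
Variables (D : set R).
Hypothesis mD : measurable D.
Hypothesis Dfin : (mu D < +oo)%E.

(** The kernel is translated and not reflected. As a function of [t] its derivative is the shifted
    [derive1 Psi], ready for the weak formulation; as a function of [a] it is the opposite, the
    source of the minus signs below. *)
Definition shift_kernel (Psi : R -> R) (a t : R) : R := Psi (t - a).

Lemma shift_kernel_derive1 Psi a : bounded_smooth Psi ->
  derive1 (shift_kernel Psi a) = shift_kernel (derive1 Psi) a.
Proof. exact: kernel_shift_derive1. Qed.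

Lemma weight_kernel Psi a : bounded_smooth Psi -> weight D (shift_kernel Psi a).
Proof.
move=> kP; split.
  by apply: measurable_funTS; apply: continuous_measurable_fun;
    exact: kernel_continuous_shift.
by have [C _ hC] := kernel_bnd kP; exists C => t _; exact: hC.
Qed.

Lemma kernel_remainder_le Psi : bounded_smooth Psi -> exists2 C : R, 0 <= C & forall a h t,
  `|shift_kernel Psi (h + a) t - shift_kernel Psi a t -
    (- h) * shift_kernel (derive1 Psi) a t| <= C * h ^+ 2.
Proof.
move=> kP; have [C C0 hC] := kernel_taylor kP; exists C => // a h t.
have := hC (t - a) (- h); rewrite sqrrN /shift_kernel.
by have -> : - h + (t - a) = t - (h + a) by ring.
Qed.

Lemma Rintegral_const_le (f g : R -> R) (C : R) : 0 <= C ->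
  measurable_fun D f -> (forall t, D t -> `|f t| <= C) ->
  (forall t, D t -> 0 <= g t) -> integ D g ->
  `|\int[mu]_(t in D) (f t * g t)| <= C * \int[mu]_(t in D) g t.
Proof.
move=> C0 mf fC g0 ig.
have ifg : integ D (fun t => f t * g t) by apply: (integ_bndM mD mf fC).
rewrite (le_trans (normr_Rintegral_le mD ifg))// -RintegralZl//.
apply: le_Rintegral => //.
- exact: (integ_norm mD ifg).
- exact: (integZ C mD ig).
- by move=> t Dt; rewrite normrM (ger0_norm (g0 _ Dt)) ler_wpM2r ?g0 ?fC.
Qed.

Lemma is_derive_weighted_integral (W K : R -> R) (a : R) : bounded_smooth W ->
  (forall t, D t -> 0 <= K t) -> integ D K ->
  is_derive a 1 (fun a => \int[mu]_(t in D) (shift_kernel W a t * K t))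
    (- \int[mu]_(t in D) (shift_kernel (derive1 W) a t * K t)).
Proof.
move=> kW K0 iK; have [C C0 hC] := kernel_remainder_le kW.
have i F b : bounded_smooth F -> integ D (fun t => shift_kernel F b t * K t).
  by move=> kF; apply: (integ_weight mD _ iK); exact: weight_kernel.
have kW' := kernel_derive1 kW.
apply: (@is_derive_quadratic _ _ _ _ (C * \int[mu]_(t in D) K t)) => h _.
rewrite mulrN -mulNr -(RintegralZl (- h))//; last exact: (i _ _ kW').
rewrite -RintegralB//; [|exact: (i _ _ kW)|exact: (i _ _ kW)].
rewrite -RintegralB//; last 2 first.
- exact: (integB mD (i _ _ kW) (i _ _ kW)).
- exact: (integZ _ mD (i _ _ kW')).
rewrite mulrAC.
have -> : (fun t => shift_kernel W (h + a) t * K t - shift_kernel W a t * K t -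
    - h * (shift_kernel (derive1 W) a t * K t)) =
  (fun t => (shift_kernel W (h + a) t - shift_kernel W a t -
    - h * shift_kernel (derive1 W) a t) * K t).
  by apply/funext => t; ring.
apply: Rintegral_const_le => //; first by rewrite mulr_ge0 ?sqr_ge0.
apply: measurable_funB.
  by apply: measurable_funB; apply: (weight_kernel _ _).1.
by apply: measurable_funM => //; exact: (weight_kernel _ _).1.
Qed.

Lemma integ_of_sqr (f : R -> R) : measurable_fun D f ->
  integ D (fun t => f t ^+ 2) -> integ D f.
Proof.
move=> mf i2; apply: (le_integ (g := fun t => 1 + f t ^+ 2)) => //.
  move=> t _; rewrite -[f t ^+ 2]real_normK ?num_real//.
  by have := sqr_ge0 (`|f t| - 1); have := normr_ge0 (f t); rewrite sqrrB; lra.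
exact: (integD mD (integ_cst 1 mD Dfin) i2).
Qed.

End ScalarWeight.

Section MeanCurve.
Context {R : realType} {E : lmodType R} {X : nspace E} {B : E -> E -> R}.
Hypothesis hB : hilbert_form X B.
Local Notation mu := (@lebesgue_measure R).
Variables (D : set R) (u : R -> E).
Hypothesis mD : measurable D.
Hypothesis Dfin : (mu D < +oo)%E.
Hypothesis su : strongly_measurable X D u.
Hypothesis iu : integ D (nrm X \o u).

Definition mollified (Psi : R -> R) (a : R) : E := mean (X:=X) (B:=B) D u (shift_kernel Psi a).

(** The Taylor remainder of the curve of means is bounded through a weight of size [C * h ^+ 2], by
    [mean_comb_le] and [kernel_remainder_le]. *)
Lemma is_derive_mollified (Psi : R -> R) (a : R) : bounded_smooth Psi ->
  is_derive a 1 (fun a => B (mollified Psi a) (mollified Psi a))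
    (- 2 * B (mollified Psi a) (mollified (derive1 Psi) a)).
Proof.
move=> kP; have [C C0 hC] := kernel_remainder_le kP.
have pm F b : pts X (mollified F b) by exact: (mean_pts hB).
have w F b : bounded_smooth F -> weight D (shift_kernel F b) by exact: weight_kernel.
have kP' := kernel_derive1 kP.
have : is_derive a 1 (fun a => B (mollified Psi a) (mollified Psi a))
    (2 * B (mollified Psi a) (- mollified (derive1 Psi) a)).
  apply: (is_derive_form_curve hB (C := C * \int[mu]_(t in D) (nrm X (u t)))) => //.
    exact: (hptsN hB).
  move=> h _; rewrite scalerN -scaleNr.
  apply: le_trans (mean_comb_le hB mD Dfin su iu (- h) (w _ _ kP) (w _ _ kP) (w _ _ kP')) _.
  rewrite mulrAC; apply: le_trans (ler_norm _) _.
  apply: Rintegral_const_le => //.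
  - by rewrite mulr_ge0 ?sqr_ge0.
  - apply: measurableT_comp => //; apply: measurable_funB.
      by apply: measurable_funB; apply: (w _ _ _).1.
    by apply: measurable_funM => //; exact: (w _ _ _).1.
  - by move=> t Dt; rewrite normr_id; exact: hC.
  - by move=> t _; exact: (hnrm_ge0 hB).
by rewrite -scaleN1r (hfZr hB)// mulN1r mulrN mulNr.
Qed.

Lemma mollified_lipschitz (Psi : R -> R) : bounded_smooth Psi ->
  exists2 L : R, 0 <= L &
    forall a b, nrm X (mollified Psi b - mollified Psi a) <= L * `|b - a|.
Proof.
move=> kP; have kP' := kernel_derive1 kP.
have [C C0 hC] := kernel_bnd kP'.
have i0 : 0 <= \int[mu]_(t in D) nrm X (u t).
  by apply: Rintegral_ge0 => t _; exact: (hnrm_ge0 hB).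
exists (C * \int[mu]_(t in D) nrm X (u t)); first exact: mulr_ge0.
move=> a b; have w c := weight_kernel D c kP.
have pm c : pts X (mollified Psi c) by exact: (mean_pts hB).
(* The coefficient 0 makes the third weight a placeholder. *)
have := mean_comb_le hB mD Dfin su iu 0 (w b) (w a) (w a).
rewrite scale0r subr0 => /le_trans; apply.
rewrite mulrAC; apply: le_trans (ler_norm _) _.
apply: Rintegral_const_le => //.
- exact: mulr_ge0.
- apply: measurableT_comp => //; apply: measurable_funB.
    by apply: measurable_funB; apply: (w _).1.
  by apply: measurable_funM => //; exact: (w _).1.
- move=> t Dt; rewrite normr_id mul0r subr0 /shift_kernel.
  have -> : `|b - a| = `|t - b - (t - a)|.
    by rewrite distrC; congr `|_|; ring.
  apply: (@mean_value_le _ Psi (derive1 Psi)) => // z; exact: kernel_is_derive.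
- by move=> t _; exact: (hnrm_ge0 hB).
Qed.

End MeanCurve.

Section MollifiedLimit.
Context {R : realType} {E : lmodType R} {X : nspace E} {B : E -> E -> R}.
Hypothesis hB : hilbert_form X B.
Local Notation mu := (@lebesgue_measure R).
Variables (D : set R) (u : R -> E).
Hypothesis mD : measurable D.
Hypothesis Dfin : (mu D < +oo)%E.
Hypothesis su : strongly_measurable X D u.
Hypothesis iu : integ D (nrm X \o u).
Local Notation molu := (mollified (X := X) (B := B) D u).

Lemma mollified_sub (Psi Phi : R -> R) (a : R) : bounded_smooth Psi -> bounded_smooth Phi ->
  B (molu (fun x => Psi x - Phi x) a) (molu (fun x => Psi x - Phi x) a) =
  nrm X (molu Psi a - molu Phi a) ^+ 2.
Proof.
move=> kP kF; have kPF := kernelB kP kF.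
have pm F b : pts X (molu F b) by exact: (mean_pts hB).
have py := hptsB hB (pm Psi a) (pm Phi a).
have key v : pts X v ->
    B (molu (fun x => Psi x - Phi x) a) v = B (molu Psi a - molu Phi a) v.
  move=> pv; rewrite (hfBl hB)// !(meanE hB)//; do ?[exact: weight_kernel].
  rewrite -RintegralB//; do ?[apply: integ_weight => //;
    [exact: weight_kernel|exact: (integ_form hB)]].
  by apply: eq_Rintegral => t _; rewrite /shift_kernel mulrBl.
by rewrite key// (hf_sym hB) key// (hnrm_sqr hB).
Qed.

(** Approximate identity at a Lebesgue point: the kernel has height at most [C / d n] on a ball of
    radius [d n], over which the integral of [nrm X (u t - u a)] is a small multiple of [d n]. *)
Lemma mollified_cvg (rho : nat -> R -> R) (d : nat -> R) (C a : R) :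
  (forall n, bounded_smooth (rho n)) -> (forall n x, 0 <= rho n x) ->
  (forall n, \int[mu]_(t in D) (shift_kernel (rho n) a t) = 1) ->
  (forall n, 0 < d n) -> d n @[n --> \oo] --> (0 : R) ->
  (forall n x, rho n x != 0 -> `|x| < d n) ->
  (forall n x, rho n x <= C / d n) ->
  D a ->
  (forall e : R, 0 < e -> exists2 d : R, 0 < d &
    forall r, 0 < r < d -> ball a r `<=` D /\
      \int[mu]_(t in ball a r) nrm X (u t - u a) <= e * r) ->
  nrm X (molu (rho n) a - u a) @[n --> \oo] --> (0 : R).
Proof.
move=> krho rho0 mass d0 dlim rsupp rC Da leb.
have C0 : 0 <= C.
  have := le_trans (rho0 0%N 0) (rC 0%N 0).
  by rewrite pmulr_lge0// invr_gt0.
have pua : pts X (u a) := su.1 a Da.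
have inu := integ_nrm_sub hB mD Dfin su iu pua.
apply/cvgrPdist_le => /= e e0.
have e1 : 0 < e / (C + 1) by rewrite divr_gt0// ltr_wpDl.
have [r0 r00 hr] := leb _ e1.
near=> n.
have dn : 0 < d n < r0.
  rewrite d0/=; near: n; move/cvgrPdist_lt : dlim => /(_ r0 r00).
  apply: filterS => n; rewrite sub0r normrN; exact: le_lt_trans (ler_norm _).
have [aD hint] := hr _ dn.
rewrite sub0r normrN ger0_norm ?(hnrm_ge0 hB)//.
have w := weight_kernel D a (krho n).
apply: le_trans (mean_dist_le hB mD Dfin su iu w pua (mass n)) _.
have -> : \int[mu]_(t in D) (`|shift_kernel (rho n) a t| * nrm X (u t - u a)) =
    \int[mu]_(t in ball a (d n)) (`|shift_kernel (rho n) a t| * nrm X (u t - u a)).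
  rewrite -[in RHS](setIidr aD) Rintegral_mkcondr.
  apply: eq_Rintegral => t _; rewrite patchE; case: ifPn => // /negP tb.
  suff -> : shift_kernel (rho n) a t = 0 by rewrite normr0 mul0r.
  apply/eqP; apply/negP => /negP /rsupp h; apply: tb; apply/mem_set.
  by rewrite /ball/= /ball_/= distrC.
have mb : measurable (ball a (d n)) by exact: measurable_ball.
have i1 : integ D (fun t => `|shift_kernel (rho n) a t| * nrm X (u t - u a)).
  exact: (integ_weight_norm mD w inu).
have i2 := integrable_ball aD mD inu.
apply: le_trans (_ : \int[mu]_(t in ball a (d n)) (C / d n * nrm X (u t - u a)) <= _).
  apply: le_Rintegral => //.
  - exact: integrable_ball aD mD i1.
  - exact: (integZ _ mb i2).
  - move=> t _; rewrite ler_wpM2r ?(hnrm_ge0 hB)// ger0_norm; last exact: rho0.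
    exact: rC.
rewrite RintegralZl//.
apply: le_trans (_ : C / d n * (e / (C + 1) * d n) <= _).
  by rewrite ler_wpM2l// divr_ge0// ltW.
have -> : C / d n * (e / (C + 1) * d n) = C / (C + 1) * e.
  by field; rewrite !gt_eqF//= ltr_wpDl.
have C1 : 0 < C + 1 by rewrite ltr_wpDl.
by rewrite ler_piMl ?(ltW e0)// ler_pdivrMr// mul1r lerDl.
Unshelve. all: by end_near. Qed.

End MollifiedLimit.

Section Antiderivative.
Context {R : realType}.
Local Notation mu := (@lebesgue_measure R).

Lemma continuous_integ_itv (phi : R -> R) (a b : R) : continuous phi ->
  integ `[a, b] phi.
Proof.
move=> cphi; apply: continuous_compact_integrable; first exact: segment_compact.
exact: continuous_subspaceT.
Qed.

Lemma Rintegral_derive1 (F : R -> R) (a b : R) : a < b -> smooth F ->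
  \int[mu]_(t in `]a, b[) derive1 F t = F b - F a.
Proof.
move=> ab sF; have c' := smooth_continuous (smooth_derive1 sF).
have c := smooth_continuous sF.
have i := continuous_integ_itv a b c'.
rewrite Rintegral_itv_bndo_bndc; last first.
  apply: integrableS i => //; exact: subset_itv_oo_cc.
rewrite Rintegral_itv_obnd_cbnd; last first.
  apply: integrableS i => //; exact: subset_itv_oc_cc.
rewrite /Rintegral (@continuous_FTC2 _ _ F)//=; first exact: continuous_subspaceT.
split => [x _||]; first exact: smooth_derivable.
- by apply: cvg_at_right_filter; exact: c.
- by apply: cvg_at_left_filter; exact: c.
Qed.

Lemma antiderivative (phi : R -> R) (al be : R) : continuous phi ->
  exists Phi, (forall x : R, al <= x <= be -> is_derive x 1 Phi (phi x)) /\
  forall a b, al <= a -> a <= b -> b <= be ->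
    Phi b - Phi a = \int[mu]_(t in `]a, b[) phi t.
Proof.
move=> cphi.
(* The base point lies strictly to the left of [al], so that the derivative is two-sided at [al]
   too. *)
exists (fun x => \int[mu]_(t in `[al - 1, x]) phi t); split.
  move=> x /andP[ax xb].
  have xx : x < x + 1 by rewrite ltrDl.
  have ax1 : al - 1 < x by rewrite (lt_le_trans _ ax)// ltrBlDr ltrDl.
  have [df <-] := @continuous_FTC1_closed _ phi (al - 1) x (x + 1) xx
    (continuous_integ_itv _ _ cphi) ax1 (cphi x).
  exact: derivable_is_derive1.
move=> a b ala ab bbe.
rewrite (Rintegral_itvB (continuous_integ_itv (al - 1) b cphi)); last 2 first.
- by rewrite bnd_simp (le_trans _ ala)// gerBl.
- by rewrite bnd_simp.
rewrite Rintegral_itv_bndo_bndc//.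
apply: integrableS (continuous_integ_itv a b cphi) => //.
exact: subset_itv_oo_cc.
Qed.

End Antiderivative.

(** * Energy of an abstract evolution equation *)

Section Evolution.
Context {R : realType} {E : lmodType R} {H V : nspace E} {BH BV : E -> E -> R}.
Hypothesis hH : hilbert_form H BH.
Hypothesis hV : hilbert_form V BV.
Hypothesis VH : forall v, pts V v -> pts H v.
Hypothesis VHle : forall v, pts V v -> nrm H v <= nrm V v.
Local Notation mu := (@lebesgue_measure R).
Variable T : R.
Let D : set R := `]0, T[%classic.
Variables (u du : R -> E) (kap : R -> R).
Hypothesis su : strongly_measurable V D u.
Hypothesis sdu : strongly_measurable H D du.
Hypothesis iu2 : integ D (fun t => nrm V (u t) ^+ 2).
Hypothesis idu2 : integ D (fun t => nrm H (du t) ^+ 2).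
Hypothesis kap0 : forall t, D t -> 0 <= kap t.
Hypothesis mkap : measurable_fun D kap.
Hypothesis ikap2 : integ D (fun t => kap t ^+ 2).
Hypothesis weak_u : forall theta, test_fun D theta -> forall h, pts H h ->
  \int[mu]_(t in D) (derive1 theta t * BH (u t) h) =
    - \int[mu]_(t in D) (theta t * BH (du t) h).
(** The equation enters as an inequality: [kap] is a scalar majorant of the forcing, and the
    right-hand side sees only the H norm of [v]. That norm stays under control when [v] is the
    mollified velocity, whereas its V norm would not. *)
Hypothesis weak_du : forall theta, test_fun D theta -> forall v, pts V v ->
  `|\int[mu]_(t in D) (derive1 theta t * BH (du t) v) -
    \int[mu]_(t in D) (theta t * BV (u t) v)| <=
  nrm H v * \int[mu]_(t in D) (`|theta t| * kap t).

Let mD : measurable D. Proof. exact: measurable_itv. Qed.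
Let Dfin : (mu D < +oo)%E.
Proof. by rewrite /D lebesgue_measure_itv/=; case: ifP => // _; rewrite ltry. Qed.

Let iu : integ D (nrm V \o u).
Proof. by apply: integ_of_sqr => //; exact: (measurable_nrm hV su). Qed.
Let idu : integ D (nrm H \o du).
Proof. by apply: integ_of_sqr => //; exact: (measurable_nrm hH sdu). Qed.
Let ikap : integ D kap.
Proof. exact: integ_of_sqr. Qed.

Let Y := mollified (X := V) (B := BV) D u.
Let Z := mollified (X := H) (B := BH) D du.

Let pY Psi a : pts V (Y Psi a). Proof. exact: (mean_pts hV). Qed.
Let pZ Psi a : pts H (Z Psi a). Proof. exact: (mean_pts hH). Qed.
Let pYH Psi a : pts H (Y Psi a). Proof. exact: VH. Qed.

Let YE Psi a v : bounded_smooth Psi -> pts V v ->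
  BV (Y Psi a) v = \int[mu]_(t in D) (shift_kernel Psi a t * BV (u t) v).
Proof. by move=> kP pv; apply: (meanE hV) => //; exact: weight_kernel. Qed.

Let ZE Psi a v : bounded_smooth Psi -> pts H v ->
  BH (Z Psi a) v = \int[mu]_(t in D) (shift_kernel Psi a t * BH (du t) v).
Proof. by move=> kP pv; apply: (meanE hH) => //; exact: weight_kernel. Qed.

(** [Y] is a mean in V, known only through its [BV] pairings. Representing [BH _ h] by a vector of V
    gives access to its [BH] pairings as well. *)
Lemma form_representation h : pts H h ->
  exists2 w, pts V w & forall v, pts V v -> BH v h = BV v w.
Proof.
move=> ph.
have [w pw hw] : exists2 y, pts V y & forall v, pts V v -> BV y v = BH v h.
  apply: (hf_riesz hV (C := nrm H h)).
    by move=> a v w pv pw; apply: (hf_lin hH) => //; exact: VH.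
  move=> v pv; rewrite (le_trans (hf_cauchy_schwarz hH (VH pv) ph))// mulrC.
  by rewrite ler_wpM2l ?(hnrm_ge0 hH)// VHle.
by exists w => // v pv; rewrite -hw// (hf_sym hV).
Qed.

Lemma mollified_formH Psi a h : bounded_smooth Psi -> pts H h ->
  BH (Y Psi a) h = \int[mu]_(t in D) (shift_kernel Psi a t * BH (u t) h).
Proof.
move=> kP ph; have [w pw hw] := form_representation ph.
rewrite hw ?pY// YE//; apply: eq_Rintegral => t /set_mem Dt.
by rewrite -hw//; exact: su.1.
Qed.

(** Up to an H-null vector, [Z Psi a] is the opposite of [Y (derive1 Psi) a]. The mollified
    velocity, a priori only in H, is thus represented by a point of V and may be inserted in
    [weak_du]. *)
Lemma mollified_deriv Psi a h : bounded_smooth Psi ->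
  test_fun D (shift_kernel Psi a) -> pts H h ->
  BH (Y (derive1 Psi) a) h = - BH (Z Psi a) h.
Proof.
move=> kP tP ph; rewrite mollified_formH//; last exact: kernel_derive1.
by rewrite ZE// -(weak_u tP ph) (shift_kernel_derive1 a kP).
Qed.

Lemma mollified_deriv2 Psi a v : bounded_smooth Psi ->
  test_fun D (shift_kernel Psi a) -> pts V v ->
  `|BH (Z (derive1 Psi) a) v - BV (Y Psi a) v| <=
    nrm H v * \int[mu]_(t in D) (`|shift_kernel Psi a t| * kap t).
Proof.
move=> kP tP pv; have := weak_du tP pv.
by rewrite (shift_kernel_derive1 a kP) (ZE _ (kernel_derive1 kP) (VH pv)) (YE _ kP pv).
Qed.

Lemma mollified_deriv_nrm Psi a : bounded_smooth Psi ->
  test_fun D (shift_kernel Psi a) -> nrm H (Y (derive1 Psi) a) = nrm H (Z Psi a).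
Proof.
move=> kP tP; rewrite !(hf_nrm hH) (mollified_deriv kP tP (pYH _ _)).
by rewrite (hf_sym hH) (mollified_deriv kP tP (pZ _ _)) opprK.
Qed.

Definition energy Psi a := BH (Z Psi a) (Z Psi a) + BV (Y Psi a) (Y Psi a).
Definition denergy Psi a :=
  - 2 * BH (Z Psi a) (Z (derive1 Psi) a) - 2 * BV (Y Psi a) (Y (derive1 Psi) a).

Lemma is_derive_energy Psi (a : R) : bounded_smooth Psi ->
  is_derive a 1 (energy Psi) (denergy Psi a).
Proof.
move=> kP; rewrite /denergy -mulNr; apply: is_derive_add.
  exact: (is_derive_mollified hH).
exact: (is_derive_mollified hV).
Qed.

(** Replacing [Z Psi] by minus [Y (derive1 Psi)] turns both terms of [denergy] into pairings with
    the same vector [v = Y (derive1 Psi) a] of V. Their difference is what [mollified_deriv2]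
    bounds, and [v] has the H norm of [Z Psi a]: the smoothed form of multiplying the equation by
    the velocity. *)
Lemma denergy_le Psi a : bounded_smooth Psi -> test_fun D (shift_kernel Psi a) ->
  `|denergy Psi a| <=
    2 * (nrm H (Z Psi a) * \int[mu]_(t in D) (`|shift_kernel Psi a t| * kap t)).
Proof.
move=> kP tP; rewrite /denergy -(mollified_deriv_nrm kP tP).
have -> : - 2 * BH (Z Psi a) (Z (derive1 Psi) a) =
    2 * BH (Z (derive1 Psi) a) (Y (derive1 Psi) a).
  have := mollified_deriv kP tP (pZ (derive1 Psi) a).
  by rewrite (hf_sym hH (Z (derive1 Psi) a)) => ->; ring.
rewrite -mulrBr normrM ger0_norm// ler_wpM2l//.
exact: mollified_deriv2.
Qed.

(* [W] dominates [Psi] in the sense that [|Psi| <= W']; the average of [kap ^+ 2]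
   against [W'] is then minus the derivative in [a] of its average against [W]. *)
Lemma denergy_le_dominated Psi W a (lam m : R) : 0 < lam ->
  bounded_smooth Psi -> bounded_smooth W -> test_fun D (shift_kernel Psi a) ->
  (forall x, `|Psi x| <= derive1 W x) ->
  \int[mu]_(t in D) (shift_kernel (derive1 W) a t) = m ->
  `|denergy Psi a| <=
    lam * \int[mu]_(t in D) (shift_kernel (derive1 W) a t * kap t ^+ 2) +
    m / lam * BH (Z Psi a) (Z Psi a).
Proof.
move=> lam0 kP kW tP PW Wm; apply: le_trans (denergy_le kP tP) _.
have kW' := kernel_derive1 kW.
have wW := weight_kernel D a kW'.
set w := shift_kernel (derive1 W) a in wW *.
have w0 t : 0 <= w t by exact: le_trans (PW _).
have iw1 : integ D w.
  by have := integ_weight mD wW (integ_cst 1 mD Dfin); under eq_fun do rewrite mulr1.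
have iwk2 := integ_weight mD wW ikap2.
have iPk := integ_weight_norm mD (weight_kernel D a kP) ikap.
set z := nrm H (Z Psi a).
have iz : integ D (fun t => lam^-1 * z ^+ 2 * w t) by exact: (integZ _ mD iw1).
have il : integ D (fun t => lam * (w t * kap t ^+ 2)) by exact: (integZ _ mD iwk2).
have -> : m / lam * BH (Z Psi a) (Z Psi a) =
    \int[mu]_(t in D) (lam^-1 * z ^+ 2 * w t).
  by rewrite RintegralZl// Wm /z (hnrm_sqr hH); ring.
rewrite mulrA -!RintegralZl// -RintegralD//.
apply: le_Rintegral => //.
- exact: (integZ _ mD iPk).
- exact: (integD mD il iz).
move=> t Dt; have k0 := kap0 Dt; have z0 : 0 <= z := hnrm_ge0 hH _.
have Pw : `|shift_kernel Psi a t| <= w t := PW _.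
apply: le_trans (_ : 2 * z * (w t * kap t) <= _).
  by rewrite ler_wpM2l ?mulr_ge0// ler_wpM2r.
have -> : lam * (w t * kap t ^+ 2) + lam^-1 * z ^+ 2 * w t =
  w t * (lam * kap t ^+ 2 + lam^-1 * z ^+ 2) by ring.
have -> : 2 * z * (w t * kap t) = w t * (2 * z * kap t) by ring.
rewrite ler_wpM2l//.
(* Young's inequality, with its deficit written as a square. *)
have -> : lam * kap t ^+ 2 + lam^-1 * z ^+ 2 =
  2 * z * kap t + lam^-1 * (lam * kap t - z) ^+ 2 by field; rewrite gt_eqF.
by rewrite lerDl mulr_ge0 ?sqr_ge0 ?invr_ge0 ?ltW.
Qed.

Let kinetic_continuous Psi : bounded_smooth Psi -> continuous (fun c => BH (Z Psi c) (Z Psi c)).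
Proof.
move=> kP c; apply: is_derive_continuous.
exact: (is_derive_mollified hH mD Dfin sdu idu c kP).
Qed.

(** Meant for [Psi] the difference of two mollifiers, where the energy itself must be shown small.
    The forcing term is not small but carries the free factor [lam]; the kinetic term carries
    [1 / lam] but will tend to zero. *)
Lemma energy_increment_dominated Psi W (al be lam m : R) : 0 < lam ->
  bounded_smooth Psi -> bounded_smooth W -> (forall x, 0 <= W x) ->
  (forall x, `|Psi x| <= derive1 W x) ->
  (forall a, al <= a <= be -> test_fun D (shift_kernel Psi a)) ->
  (forall a, al <= a <= be -> \int[mu]_(t in D) (shift_kernel (derive1 W) a t) = m) ->
  forall a b, al <= a -> a <= b -> b <= be ->
  `|energy Psi b - energy Psi a| <=
    lam * \int[mu]_(t in D) (shift_kernel W a t * kap t ^+ 2) +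
    m / lam * \int[mu]_(t in `]al, be[) BH (Z Psi t) (Z Psi t).
Proof.
move=> lam0 kP kW W0 PW tP Wm a b ala ab bbe.
have k20 t : D t -> 0 <= kap t ^+ 2 by move=> _; exact: sqr_ge0.
have [Phi [dPhi PhiE]] := antiderivative al be (kinetic_continuous kP).
pose S a := \int[mu]_(t in D) (shift_kernel W a t * kap t ^+ 2).
pose S' a := \int[mu]_(t in D) (shift_kernel (derive1 W) a t * kap t ^+ 2).
have dS (c : R) : is_derive c 1 S (- S' c) by exact: is_derive_weighted_integral.
have S0 c : 0 <= S c.
  by apply: Rintegral_ge0 => t _; rewrite mulr_ge0 ?sqr_ge0//; exact: W0.
have m0 : 0 <= m.
  have aal : al <= a <= be by rewrite ala (le_trans ab).
  rewrite -(Wm _ aal); apply: Rintegral_ge0 => t _.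
  exact: le_trans (PW _).
have inab z : a <= z <= b -> al <= z <= be.
  by move=> /andP[az zb]; rewrite (le_trans ala)// (le_trans zb).
have key (s : R) : `|s| = 1 ->
    s * (energy Psi b - energy Psi a) <= lam * (S a - S b) + m / lam * (Phi b - Phi a).
  move=> s1.
  (* The bound on [denergy] says that [G] is nondecreasing; the two signs [s] give the two halves of
     the absolute value, and [- S'] is the derivative of [S]. *)
  pose G c := m / lam * Phi c - (lam * S c + s * energy Psi c).
  have dG (c : R) : a <= c <= b -> is_derive c 1 G
      (m / lam * BH (Z Psi c) (Z Psi c) - (lam * - S' c + s * denergy Psi c)).
    move=> /inab cab.
    exact: (is_derive_sub (is_derive_scal _ (dPhi c cab))
      (is_derive_add (is_derive_scal _ (dS c)) (is_derive_scal _ (is_derive_energy c kP)))).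
  have : G a <= G b.
    apply: (nondecreasing_derive ab dG) => c /inab cab.
    have := denergy_le_dominated lam0 kP kW (tP _ cab) PW (Wm _ cab).
    rewrite -/(S' c) => h.
    have : s * denergy Psi c <= `|denergy Psi c|.
      by rewrite (le_trans (ler_norm _))// normrM s1 mul1r.
    by rewrite mulrN; lra.
  by rewrite /G; lra.
have int_le : m / lam * (Phi b - Phi a) <=
    m / lam * \int[mu]_(t in `]al, be[) BH (Z Psi t) (Z Psi t).
  have albe := le_trans ala (le_trans ab bbe).
  rewrite ler_wpM2l ?divr_ge0 ?(ltW lam0)// -(PhiE al be (lexx _) albe (lexx _)).
  have mono x y : al <= x -> x <= y -> y <= be -> Phi x <= Phi y.
    move=> ax xy yb; rewrite -subr_ge0 PhiE//.
    by apply: Rintegral_ge0 => t _; exact: (hf_ge0 hH).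
  have := mono al a (lexx _) ala (le_trans ab bbe).
  by have := mono b be (le_trans ala ab) bbe (lexx _); lra.
have Sle : lam * (S a - S b) <= lam * S a.
  by rewrite ler_wpM2l ?(ltW lam0)// gerBl.
rewrite ler_norml; apply/andP; split.
  have := key (-1); rewrite normrN1 => /(_ erefl); rewrite mulN1r -/(S a); lra.
by have := key 1; rewrite normr1 => /(_ erefl); rewrite mul1r -/(S a); lra.
Qed.

(** Here [Psi] is a genuine mollifier, so Young's inequality with [lam = 1] suffices: Jensen bounds
    the kinetic term by the average of [nrm H (du t) ^+ 2] against the same kernel. The remaining
    weight [W (t - a) - W (t - b)] approximates the indicator of ]a, b[. *)
Lemma energy_increment Psi W (al be : R) :
  bounded_smooth Psi -> bounded_smooth W -> (forall x, 0 <= Psi x) ->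
  Psi = derive1 W ->
  (forall a, al <= a <= be -> test_fun D (shift_kernel Psi a)) ->
  (forall a, al <= a <= be -> \int[mu]_(t in D) (shift_kernel Psi a t) = 1) ->
  forall a b, al <= a -> a <= b -> b <= be ->
  `|energy Psi b - energy Psi a| <=
    \int[mu]_(t in D) ((shift_kernel W a t - shift_kernel W b t) *
                       (kap t ^+ 2 + nrm H (du t) ^+ 2)).
Proof.
move=> kP kW P0 PW tP Pm a b ala ab bbe.
pose K t := kap t ^+ 2 + nrm H (du t) ^+ 2.
have K0 t : D t -> 0 <= K t by move=> _; rewrite addr_ge0 ?sqr_ge0.
have iK : integ D K by exact: (integD mD ikap2 idu2).
pose S a := \int[mu]_(t in D) (shift_kernel W a t * K t).
pose S' a := \int[mu]_(t in D) (shift_kernel (derive1 W) a t * K t).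
have dS (c : R) : is_derive c 1 S (- S' c) by exact: is_derive_weighted_integral.
have iw c f : integ D f -> integ D (fun t => shift_kernel W c t * f t).
  by move=> jf; apply: (integ_weight mD _ jf); exact: weight_kernel.
have -> : \int[mu]_(t in D) ((shift_kernel W a t - shift_kernel W b t) *
    (kap t ^+ 2 + nrm H (du t) ^+ 2)) = S a - S b.
  rewrite -RintegralB//; do ?[exact: iw].
  by apply: eq_Rintegral => t _; rewrite mulrBl.
have inab z : a <= z <= b -> al <= z <= be.
  by move=> /andP[az zb]; rewrite (le_trans ala)// (le_trans zb).
have key (s : R) : `|s| = 1 -> s * (energy Psi b - energy Psi a) <= S a - S b.
  move=> s1.
  pose G c := -1 * S c - s * energy Psi c.
  have dG (c : R) : a <= c <= b -> is_derive c 1 G (-1 * (- S' c) - s * denergy Psi c).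
    move=> _; exact: (is_derive_sub (is_derive_scal _ (dS c))
      (is_derive_scal _ (is_derive_energy c kP))).
  have : G a <= G b.
    apply: (nondecreasing_derive ab dG) => c /inab cab.
    have PW' x : `|Psi x| <= derive1 W x by rewrite -PW ger0_norm.
    have Wm : \int[mu]_(t in D) shift_kernel (derive1 W) c t = 1 by rewrite -PW Pm.
    have := denergy_le_dominated ltr01 kP kW (tP _ cab) PW' Wm.
    rewrite divr1 !mul1r -PW -(hnrm_sqr hH) => h.
    have := mean_sqr_le hH mD Dfin sdu idu (weight_kernel D c kP) (Pm _ cab)
      (fun t => P0 _) idu2; rewrite -/(mollified D du Psi c) -/(Z Psi c) => hZ.
    have : s * denergy Psi c <= `|denergy Psi c|.
      by rewrite (le_trans (ler_norm _))// normrM s1 mul1r.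
    have -> : S' c = \int[mu]_(t in D) (shift_kernel Psi c t * kap t ^+ 2) +
        \int[mu]_(t in D) (shift_kernel Psi c t * nrm H (du t) ^+ 2).
      rewrite /S' -PW -RintegralD//; do ?[apply: (integ_weight mD) => //; exact: weight_kernel].
      by apply: eq_Rintegral => t _; rewrite mulrDr.
    by lra.
  by rewrite /G; lra.
rewrite ler_norml; apply/andP; split.
  by have := key (-1); rewrite normrN1 => /(_ erefl); rewrite mulN1r; lra.
by have := key 1; rewrite normr1 => /(_ erefl); rewrite mul1r; lra.
Qed.

Definition lebesgue_vector_pt (X : nspace E) (w : R -> E) (a : R) :=
  forall e : R, 0 < e -> exists2 r0 : R, 0 < r0 & forall r, 0 < r < r0 ->
    ball a r `<=` D /\ \int[mu]_(t in ball a r) nrm X (w t - w a) <= e * r.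

Definition regular_time (a : R) :=
  [/\ D a, lebesgue_vector_pt V u a & lebesgue_vector_pt H du a].

Lemma ae_regular_time : {ae mu, forall a, D a -> regular_time a}.
Proof.
have oD : open D by exact: itv_open.
apply: ae_imp2 (ae_vector_lebesgue_pt hV mD Dfin su iu oD)
  (ae_vector_lebesgue_pt hH mD Dfin sdu idu oD) => a h1 h2 Da.
by split => //; [exact: h1|exact: h2].
Qed.

Lemma energy_sub Psi Phi a : bounded_smooth Psi -> bounded_smooth Phi ->
  energy (fun x => Psi x - Phi x) a =
  nrm H (Z Psi a - Z Phi a) ^+ 2 + nrm V (Y Psi a - Y Phi a) ^+ 2.
Proof.
move=> kP kF; rewrite /energy.
by rewrite (mollified_sub hH mD Dfin sdu idu)// (mollified_sub hV mD Dfin su iu).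
Qed.

(** * The limit of the mollified solutions on a closed interval *)

Section MollifierSequence.
Variables (P : nat -> R -> R) (d : nat -> R) (C al be : R).
Hypothesis albe : al < be.
Hypothesis albeD : `]al, be[ `<=` D.
Hypothesis kP : forall n, bounded_smooth (P n).
Hypothesis P01 : forall n x, 0 <= P n x <= 1.
Hypothesis rho_ge0 : forall n x, 0 <= derive1 (P n) x.
Hypothesis rho_test : forall n a, al <= a <= be ->
  test_fun D (shift_kernel (derive1 (P n)) a).
Hypothesis rho_mass : forall n a, al <= a <= be ->
  \int[mu]_(t in D) (shift_kernel (derive1 (P n)) a t) = 1.
Hypothesis d_gt0 : forall n, 0 < d n.
Hypothesis d_cvg0 : d n @[n --> \oo] --> (0 : R).
Hypothesis rho_supp : forall n x, derive1 (P n) x != 0 -> `|x| < d n.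
Hypothesis rho_le : forall n x, derive1 (P n) x <= C / d n.

Let rho n := derive1 (P n).
Let krho n : bounded_smooth (rho n). Proof. exact: kernel_derive1. Qed.

Lemma mollified_cvgV a : al <= a <= be -> regular_time a ->
  nrm V (Y (rho n) a - u a) @[n --> \oo] --> (0 : R).
Proof.
move=> aab [Da lV _].
exact: (mollified_cvg hV mD Dfin su iu krho rho_ge0
  (fun n => rho_mass n aab) d_gt0 d_cvg0 rho_supp rho_le Da lV).
Qed.

Lemma mollified_cvgH a : al <= a <= be -> regular_time a ->
  nrm H (Z (rho n) a - du a) @[n --> \oo] --> (0 : R).
Proof.
move=> aab [Da _ lH].
exact: (mollified_cvg hH mD Dfin sdu idu krho rho_ge0
  (fun n => rho_mass n aab) d_gt0 d_cvg0 rho_supp rho_le Da lH).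
Qed.

Lemma exists_regular_time : exists2 a, al <= a <= be & regular_time a.
Proof.
have [x /andP[ax xb] rx] := ae_exists_itv albe ae_regular_time.
exists x; first by rewrite !ltW.
by apply: rx; apply: albeD; rewrite /= in_itv/= ax.
Qed.

Let K t := kap t ^+ 2 + nrm H (du t) ^+ 2.
Let K0 t : 0 <= K t. Proof. by rewrite addr_ge0 ?sqr_ge0. Qed.
Let iK : integ D K. Proof. exact: (integD mD ikap2 idu2). Qed.

Lemma mollified_energy_increment n a b : al <= a <= be -> al <= b <= be ->
  `|energy (rho n) b - energy (rho n) a| <= \int[mu]_(t in D) K t.
Proof.
wlog ab : a b / a <= b.
  move=> wl ha hb; have [ab|/ltW ba] := leP a b; first exact: wl.
  by rewrite distrC; exact: wl.
move=> /andP[ala _] /andP[_ bbe].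
have := energy_increment (krho n) (kP n) (rho_ge0 n) erefl
  (rho_test n) (rho_mass n) ala ab bbe.
move=> /le_trans; apply.
apply: le_Rintegral => //.
  apply: (integ_bndM (C := 1) mD) iK => //.
    by apply: measurable_funB; apply: (weight_kernel _ _ _).1.
  move=> t _; have := P01 n (t - a); have := P01 n (t - b); rewrite /shift_kernel.
  by rewrite ler_norml => /andP[? ?] /andP[? ?]; apply/andP; split; lra.
move=> t _; apply: ler_piMl; first exact: K0.
have := P01 n (t - a); have := P01 n (t - b); rewrite /shift_kernel.
by move=> /andP[? ?] /andP[? ?]; lra.
Qed.

(** At one regular time the mollified functions converge, hence are bounded; the increments of the
    energy are bounded uniformly in [n]. *)
Lemma mollified_energy_bounded : exists2 M : R, 0 <= M &
  forall n a, al <= a <= be -> energy (rho n) a <= M.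
Proof.
have [a0 a0ab ra0] := exists_regular_time.
have [Da0 _ _] := ra0.
have pu0 : pts V (u a0) := su.1 a0 Da0.
have pdu0 : pts H (du a0) := sdu.1 a0 Da0.
have bnd (x : nat -> R) : x n @[n --> \oo] --> (0 : R) ->
    exists M, forall n, `|x n| <= M.
  move=> xc; have : cvgn x by apply/cvg_ex; exists 0.
  move=> /cvg_seq_bounded[M [_ hM]].
  by exists (M + 1) => n; apply: (hM (M + 1)) => //; rewrite ltrDl.
have [M1 hM1] := bnd _ (mollified_cvgV a0ab ra0).
have [M2 hM2] := bnd _ (mollified_cvgH a0ab ra0).
pose M := (M2 + nrm H (du a0)) ^+ 2 + (M1 + nrm V (u a0)) ^+ 2 + \int[mu]_(t in D) K t.
have M0 : 0 <= M by rewrite !addr_ge0 ?sqr_ge0//; apply: Rintegral_ge0.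
exists M => // n a aab.
have := mollified_energy_increment n a0ab aab.
have : energy (rho n) a0 <= (M2 + nrm H (du a0)) ^+ 2 + (M1 + nrm V (u a0)) ^+ 2.
  rewrite /energy -(hnrm_sqr hH) -(hnrm_sqr hV); apply: lerD.
    rewrite lerXn2r ?nnegrE ?(hnrm_ge0 hH)//.
      by rewrite addr_ge0 ?(hnrm_ge0 hH)// (le_trans _ (hM2 0%N)).
    rewrite -[Z (rho n) a0](subrK (du a0)).
    apply: le_trans (hnrmD hH _ _) _ => //; first exact: (hptsB hH).
    by rewrite lerD2r (le_trans _ (hM2 n))// ler_norm.
  rewrite lerXn2r ?nnegrE ?(hnrm_ge0 hV)//.
    by rewrite addr_ge0 ?(hnrm_ge0 hV)// (le_trans _ (hM1 0%N)).
  rewrite -[Y (rho n) a0](subrK (u a0)).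
  apply: le_trans (hnrmD hV _ _) _ => //; first exact: (hptsB hV).
  by rewrite lerD2r (le_trans _ (hM1 n))// ler_norm.
move=> h k; rewrite -(subrK (energy (rho n) a0) (energy (rho n) a)) addrC.
exact: lerD h (le_trans (ler_norm _) k).
Qed.

Let diff n m x := rho n x - rho m x.
Let kdiff n m : bounded_smooth (diff n m). Proof. exact: kernelB. Qed.

(** Dominated convergence handles sequences, so a failure is turned into a sequence of bad pairs.
    Along it the integrand tends to 0 at every regular time and stays below [4 * M] by the energy
    bound. *)
Lemma mollified_kinetic_cauchy (e : R) : 0 < e -> exists N, forall n m,
  (N <= n)%N -> (N <= m)%N ->
  \int[mu]_(t in `]al, be[) BH (Z (diff n m) t) (Z (diff n m) t) <= e.
Proof.
move=> e0; apply: contrapT => /forallNP h.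
have ex N : exists nm : nat * nat, [/\ (N <= nm.1)%N, (N <= nm.2)%N &
    e < \int[mu]_(t in `]al, be[) BH (Z (diff nm.1 nm.2) t) (Z (diff nm.1 nm.2) t)].
  apply: contrapT => /forallNP hN; apply: (h N) => n m Nn Nm.
  by rewrite leNgt; apply/negP => lt; apply: (hN (n, m)); split.
have [f hf] := choice ex.
have [M M0 hM] := mollified_energy_bounded.
have pD : measurable `]al, be[%classic by exact: measurable_itv.
have pfin : (mu `]al, be[%classic < +oo)%E.
  by rewrite lebesgue_measure_itv/=; case: ifP => // _; rewrite ltry.
pose g N t := BH (Z (diff (f N).1 (f N).2) t) (Z (diff (f N).1 (f N).2) t).
have gE N t : g N t = nrm H (Z (rho (f N).1) t - Z (rho (f N).2) t) ^+ 2.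
  exact: (mollified_sub hH mD Dfin sdu idu).
have [_] : integ `]al, be[ (cst (0 : R)) /\
    \int[mu]_(t in `]al, be[) g N t @[N --> \oo] --> \int[mu]_(t in `]al, be[) (0 : R).
  apply: (@Rintegral_dominated _ _ g (cst 0) (cst (4 * M))) => //.
  - move=> N; apply: measurable_funTS; apply: continuous_measurable_fun.
    exact: kinetic_continuous.
  - apply: ae_imp ae_regular_time => t rt /[dup] tab /albeD /rt {}rt.
    have tab' : al <= t <= be.
      by move: tab; rewrite /= in_itv/= => /andP[/ltW -> /ltW ->].
    have pdut : pts H (du t) by case: rt => Dt _ _; exact: sdu.1.
    have lim (k : nat -> nat) : (forall N, (N <= k N)%N) ->
        nrm H (Z (rho (k N)) t - du t) @[N --> \oo] --> (0 : R).
      move=> kN; apply: (cvg_comp _ _ _ (mollified_cvgH tab' rt)).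
      by apply/cvgnyPge => A; exists A => // n /= /leq_trans; apply.
    have l1 := lim (fun N => (f N).1) (fun N => let: And3 a _ _ := hf N in a).
    have l2 := lim (fun N => (f N).2) (fun N => let: And3 _ a _ := hf N in a).
    apply: (@squeeze_cvgr _ _ _ _ (cst 0) (fun N =>
      (nrm H (Z (rho (f N).1) t - du t) + nrm H (Z (rho (f N).2) t - du t)) ^+ 2));
      last exact: cvg_sqr_sum0 l1 l2.
      near=> N; rewrite gE sqr_ge0/= lerXn2r ?nnegrE ?addr_ge0 ?(hnrm_ge0 hH)//.
      exact: (hnrm_triangle_r hH (pZ (rho (f N).1) t) (pZ (rho (f N).2) t) pdut).
    exact: cvg_cst.
  - exact: integ_cst.
  - move=> N t; rewrite /= in_itv/= => /andP[at' tb].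
    have tab' : al <= t <= be by rewrite !ltW.
    rewrite ger0_norm ?(hf_ge0 hH)// gE.
    have b n : nrm H (Z (rho n) t) ^+ 2 <= M.
      rewrite (le_trans _ (hM n t tab'))// /energy -(hnrm_sqr hH) lerDl.
      exact: (hf_ge0 hV).
    have := hnrmB hH (pZ (rho (f N).1) t) (pZ (rho (f N).2) t).
    have := b (f N).1; have := b (f N).2.
    exact: sqr_triangle_bound (hnrm_ge0 hH _).
rewrite Rintegral_cst// mul0r => /cvgrPdist_lt/(_ e e0)[N _ /(_ N (leqnn N))].
rewrite sub0r normrN ger0_norm; last first.
  by apply: Rintegral_ge0 => t _; exact: (hf_ge0 hH).
by have [_ _ lt] := hf N; rewrite ltNge ltW.
Unshelve. all: by end_near. Qed.

(** Starting from a regular time [a0], where the energy of the difference is small, the increment is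
    bounded with the dominating weight [P n + P m]. The factor [lam] is fixed first, independently
    of [n] and [m], to make the forcing term small; [n] and [m] then make the kinetic term small
    compared with [lam]. *)
Lemma mollified_energy_cauchy (e : R) : 0 < e -> exists N, forall n m a,
  (N <= n)%N -> (N <= m)%N -> al <= a <= be -> energy (diff n m) a <= e.
Proof.
move=> e0.
pose k0 := \int[mu]_(t in D) (kap t ^+ 2).
have k00 : 0 <= k0 by apply: Rintegral_ge0 => t _; exact: sqr_ge0.
(* As the weight [W] is at most 2, the forcing term is at most [lam * (2 * k0)], hence at most
   [e / 4]; the [+ 1] covers [k0 = 0]. *)
pose lam := e / (8 * (k0 + 1)).
have k1 : 0 < k0 + 1 by rewrite ltr_wpDl.
have lam0 : 0 < lam by rewrite divr_gt0// mulr_gt0.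
have [a0 a0ab ra0] := exists_regular_time.
have [Da0 _ _] := ra0.
have pu0 : pts V (u a0) := su.1 a0 Da0.
have pdu0 : pts H (du a0) := sdu.1 a0 Da0.
have el : 0 < e * lam / 8 by rewrite divr_gt0// mulr_gt0.
have [N1 hN1] := mollified_kinetic_cauchy el.
(* A norm of at most [2 * e'] has a square of at most [4 * e'], hence at most [e / 8]. *)
pose e' := Num.min 1 (e / 32).
have e'0 : 0 < e' by rewrite lt_min ltr01 divr_gt0.
have [N2 _ hN2] : \forall n \near \oo, nrm V (Y (rho n) a0 - u a0) <= e'.
  have /cvgrPdist_le/(_ e' e'0) := mollified_cvgV a0ab ra0.
  by apply: filterS => n; rewrite sub0r normrN; exact: le_trans (ler_norm _).
have [N3 _ hN3] : \forall n \near \oo, nrm H (Z (rho n) a0 - du a0) <= e'.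
  have /cvgrPdist_le/(_ e' e'0) := mollified_cvgH a0ab ra0.
  by apply: filterS => n; rewrite sub0r normrN; exact: le_trans (ler_norm _).
exists (maxn N1 (maxn N2 N3)) => n m a; rewrite !geq_max.
move=> /and3P[n1 n2 n3] /and3P[m1 m2 m3] aab.
have small (x y z : R) : 0 <= z -> z <= x + y -> x <= e' -> y <= e' -> z ^+ 2 <= e / 8.
  move=> z0 zxy xe ye.
  have e1 : e' <= 1 by rewrite ge_min lexx.
  have e2 : e' <= e / 32 by rewrite ge_min lexx orbT.
  have : z <= 2 * e' by lra.
  by nra.
have E0 : energy (diff n m) a0 <= e / 4.
  rewrite energy_sub//.
  have h1 : nrm H (Z (rho n) a0 - Z (rho m) a0) ^+ 2 <= e / 8.
    apply: (small _ _ _ (hnrm_ge0 hH _) _ (hN3 n n3) (hN3 m m3)).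
    exact: (hnrm_triangle_r hH (pZ (rho n) a0) (pZ (rho m) a0) pdu0).
  have h2 : nrm V (Y (rho n) a0 - Y (rho m) a0) ^+ 2 <= e / 8.
    apply: (small _ _ _ (hnrm_ge0 hV _) _ (hN2 n n2) (hN2 m m2)).
    exact: (hnrm_triangle_r hV (pY (rho n) a0) (pY (rho m) a0) pu0).
  by lra.
pose W x := P n x + P m x.
have kW : bounded_smooth W by exact: kernelD.
have dW x : derive1 W x = rho n x + rho m x.
  by apply: is_derive_derive1; apply: is_derive_add; exact: kernel_is_derive.
have W02 x : 0 <= W x <= 2.
  by have := P01 n x; have := P01 m x; rewrite /W => /andP[? ?] /andP[? ?]; apply/andP; split; lra.
have dom x : `|diff n m x| <= derive1 W x.
  rewrite dW (le_trans (ler_normB _ _))//.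
  by rewrite (ger0_norm (rho_ge0 n x)) (ger0_norm (rho_ge0 m x)).
have Wm c : al <= c <= be -> \int[mu]_(t in D) (shift_kernel (derive1 W) c t) = 2.
  move=> cab; under eq_Rintegral do rewrite /shift_kernel dW.
  have i1 k : integ D (shift_kernel (rho k) c).
    have := integ_weight mD (weight_kernel D c (krho k)) (integ_cst 1 mD Dfin).
    by under eq_fun do rewrite mulr1.
  by rewrite RintegralD//; [rewrite !rho_mass//|exact: i1|exact: i1].
have test c : al <= c <= be -> test_fun D (shift_kernel (diff n m) c).
  by move=> cab; apply: test_funB; exact: rho_test.
have Sle c : lam * \int[mu]_(t in D) (shift_kernel W c t * kap t ^+ 2) <= e / 4.
  apply: le_trans (_ : lam * (2 * k0) <= _); last first.
    have -> : lam * (2 * k0) = e / 4 * (k0 / (k0 + 1)) by rewrite /lam; field; rewrite gt_eqF.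
    rewrite ler_piMr ?divr_ge0 ?(ltW e0)//.
    by rewrite ler_pdivrMr// mul1r lerDl.
  rewrite ler_wpM2l ?(ltW lam0)// -RintegralZl//.
  apply: le_Rintegral => //.
  - by apply: (integ_weight mD _ ikap2); exact: weight_kernel.
  - exact: (integZ _ mD ikap2).
  - by move=> t _; rewrite ler_wpM2r ?sqr_ge0//; have /andP[] := W02 (t - c).
have Kin := hN1 n m n1 m1.
have Kle : 2 / lam * \int[mu]_(t in `]al, be[) BH (Z (diff n m) t) (Z (diff n m) t) <= e / 4.
  have -> : e / 4 = 2 / lam * (e * lam / 8) by field; rewrite gt_eqF.
  by rewrite ler_wpM2l// divr_ge0// ltW.
have incr := energy_increment_dominated lam0 (kdiff n m) kW
  (fun x => let: conj h _ := andP (W02 x) in h) dom test Wm.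
have [/andP[ala abe] /andP[ala0 a0be]] := (aab, a0ab).
have [aa0|/ltW a0a] := leP a a0.
  have := incr a a0 ala aa0 a0be; rewrite distrC => h.
  exact: (quarter_sum_le (ltW e0) E0 h (Sle a) Kle).
exact: (quarter_sum_le (ltW e0) E0 (incr a0 a ala0 a0a abe) (Sle a0) Kle).
Qed.

Lemma mollified_uniformly_cauchy (e : R) : 0 < e -> exists N, forall n m a,
  (N <= n)%N -> (N <= m)%N -> al <= a <= be ->
  nrm V (Y (rho n) a - Y (rho m) a) <= e /\ nrm H (Z (rho n) a - Z (rho m) a) <= e.
Proof.
move=> e0; have e2 : 0 < e ^+ 2 by rewrite exprn_gt0.
have [N hN] := mollified_energy_cauchy e2.
exists N => n m a Nn Nm aab; have := hN n m a Nn Nm aab.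
rewrite energy_sub// => h.
have sq (x y : R) : 0 <= y -> 0 <= x -> x ^+ 2 + y ^+ 2 <= e ^+ 2 -> x <= e.
  move=> y0 x0 xy; rewrite -(ler_pXn2r (n := 2))// ?nnegrE ?(ltW e0)//.
  by rewrite (le_trans _ xy)// lerDl sqr_ge0.
split; last exact: sq (hnrm_ge0 hV _) (hnrm_ge0 hH _) h.
by rewrite addrC in h; exact: sq (hnrm_ge0 hH _) (hnrm_ge0 hV _) h.
Qed.

Lemma mollified_limit : exists Yc Zc : R -> E,
  (forall a, al <= a <= be -> pts V (Yc a) /\ pts H (Zc a)) /\
  forall e : R, 0 < e -> exists N, forall n a, (N <= n)%N -> al <= a <= be ->
    nrm V (Y (rho n) a - Yc a) <= e /\ nrm H (Z (rho n) a - Zc a) <= e.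
Proof.
have ex a : exists yz : E * E, al <= a <= be -> [/\ pts V yz.1, pts H yz.2,
    nrm V (Y (rho n) a - yz.1) @[n --> \oo] --> (0 : R) &
    nrm H (Z (rho n) a - yz.2) @[n --> \oo] --> (0 : R)].
  have [aab|] := boolP (al <= a <= be); last by exists (0, 0).
  have [y py cy] : exists2 l, pts V l & nrm V (Y (rho n) a - l) @[n --> \oo] --> (0 : R).
    apply: (hf_complete hV) => [n|e e0]; first exact: pY.
    have [N hN] := mollified_uniformly_cauchy e0.
    by exists N => m n Nm Nn; have [] := hN m n a Nm Nn aab.
  have [z pz cz] : exists2 l, pts H l & nrm H (Z (rho n) a - l) @[n --> \oo] --> (0 : R).
    apply: (hf_complete hH) => [n|e e0]; first exact: pZ.
    have [N hN] := mollified_uniformly_cauchy e0.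
    by exists N => m n Nm Nn; have [] := hN m n a Nm Nn aab.
  by exists (y, z).
have [f hf] := choice ex.
exists (fun a => (f a).1), (fun a => (f a).2).
split; first by move=> a /hf[].
move=> e e0; have e2 : 0 < e / 2 by rewrite divr_gt0.
have [N hN] := mollified_uniformly_cauchy e2.
exists N => n a Nn aab; have [py pz cy cz] := hf a aab.
have [k Nk [ky kz]] : exists2 k, (N <= k)%N &
    nrm V (Y (rho k) a - (f a).1) <= e / 2 /\ nrm H (Z (rho k) a - (f a).2) <= e / 2.
  move/cvgrPdist_le : cy => /(_ _ e2)[N1 _ h1].
  move/cvgrPdist_le : cz => /(_ _ e2)[N2 _ h2].
  exists (maxn N (maxn N1 N2)); first exact: leq_maxl.
  have k1 : (N1 <= maxn N (maxn N1 N2))%N by rewrite !leq_max leqnn orbT.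
  have k2 : (N2 <= maxn N (maxn N1 N2))%N by rewrite !leq_max leqnn !orbT.
  have := h1 _ k1; have := h2 _ k2; rewrite /= !sub0r !normrN => b1 b2.
  by split; [exact: le_trans (ler_norm _) b2|exact: le_trans (ler_norm _) b1].
have [hy hz] := hN n k a Nn Nk aab.
split; rewrite [leRHS]splitr.
  exact: le_trans (hnrm_triangle hV (pY (rho n) a) (pY (rho k) a) py) (lerD hy ky).
exact: le_trans (hnrm_triangle hH (pZ (rho n) a) (pZ (rho k) a) pz) (lerD hz kz).
Qed.

Hypothesis P_eq0 : forall n x, x <= - d n -> P n x = 0.
Hypothesis P_eq1 : forall n x, d n <= x -> P n x = 1.

Lemma P_cvg_step (x : R) : x != 0 -> P n x @[n --> \oo] --> (if 0 < x then 1 else 0 : R).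
Proof.
move=> x0; apply/cvgrPdist_le => /= e e0.
have xp : 0 < `|x| by rewrite normr_gt0.
near=> n.
have dx : d n <= `|x|.
  near: n; move/cvgrPdist_le : d_cvg0 => /(_ _ xp).
  by apply: filterS => n; rewrite sub0r normrN; exact: le_trans (ler_norm _).
case: ifPn => [xgt|]; first by rewrite P_eq1 ?subrr ?normr0 ?(ltW e0)// -(gtr0_norm xgt).
rewrite -leNgt => xle; rewrite P_eq0 ?subrr ?normr0 ?(ltW e0)//.
by rewrite lerNr -(ler0_norm xle).
Unshelve. all: by end_near. Qed.

Lemma step_integral_cvg a b : al <= a -> a <= b -> b <= be ->
  \int[mu]_(t in D) ((shift_kernel (P n) a t - shift_kernel (P n) b t) * K t)
    @[n --> \oo] --> \int[mu]_(t in `]a, b[) K t.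
Proof.
move=> ala ab bbe.
have abD : `]a, b[%classic `<=` D.
  apply: subset_trans albeD; apply: subset_itv; rewrite bnd_simp//.
pose f t := (\1_(`]a, b[%classic) t : R) * K t.
have -> : \int[mu]_(t in `]a, b[) K t = \int[mu]_(t in D) f t.
  rewrite -[in LHS](setIidr abD) Rintegral_mkcondr.
  apply: eq_Rintegral => t _; rewrite patchE /f indicE.
  by case: ifP => _; rewrite ?mul1r ?mul0r.
have mK : measurable_fun D K := integ_measurable iK.
have mab : measurable `]a, b[%classic by exact: measurable_itv.
have [] // : integ D f /\
    \int[mu]_(t in D) ((shift_kernel (P n) a t - shift_kernel (P n) b t) * K t)
    @[n --> \oo] --> \int[mu]_(t in D) f t.
apply: (Rintegral_dominated mD _ _ _ iK).
- move=> n; apply: measurable_funM => //; apply: measurable_funB;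
    exact: (weight_kernel D _ (kP n)).1.
- by apply: measurable_funM => //; exact: measurable_indic.
(* Nothing is known about the limit of [P n 0], so the two endpoints form the exceptional null
   set. *)
- exists [set a; b]; split.
  + by apply: measurableU; exact: measurable_set1.
  + by apply: countable_lebesgue_measure0; exact: finite_set_countable.
  + move=> t /= h; apply: contrapT => /not_orP[ta tb]; apply: h => Dt.
    apply: cvgMl.
    have ta0 : t - a != 0 by rewrite subr_eq0; exact/eqP.
    have tb0 : t - b != 0 by rewrite subr_eq0; exact/eqP.
    have -> : (\1_(`]a, b[%classic) t : R) =
        (if 0 < t - a then 1 else 0) - (if 0 < t - b then 1 else 0).
      rewrite indicE !subr_gt0; case: (ltP a t) => hat; case: (ltP b t) => hbt.
      * by rewrite subrr memNset//= in_itv/= hat/= => /(lt_trans hbt); rewrite ltxx.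
      * rewrite subr0 mem_set//= in_itv/= hat/= lt_neqAle hbt andbT.
        exact/eqP.
      * by have := le_lt_trans hat (le_lt_trans ab hbt); rewrite ltxx.
      * by rewrite subrr memNset//= in_itv/= ltNge hat.
    by apply: cvgB; exact: P_cvg_step.
- move=> n t Dt; rewrite normrM (ger0_norm (K0 t)) ler_piMl ?K0//.
  have := P01 n (t - a); have := P01 n (t - b); rewrite /shift_kernel.
  by rewrite ler_norml => /andP[? ?] /andP[? ?]; apply/andP; split; lra.
Qed.

(** Continuity comes from the uniform convergence of Lipschitz curves, the values at regular times
    from [mollified_cvgV] and [mollified_cvgH], and the energy inequality from the limit in
    [energy_increment]. *)
Lemma evolution_local : exists Yc Zc : R -> E,
  [/\ forall a, al <= a <= be -> pts V (Yc a) /\ pts H (Zc a),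
      forall a, al <= a <= be -> forall e : R, 0 < e -> exists2 r : R, 0 < r &
        forall b, al <= b <= be -> `|b - a| < r ->
          nrm V (Yc b - Yc a) <= e /\ nrm H (Zc b - Zc a) <= e,
      forall a, al <= a <= be -> regular_time a ->
        nrm V (Yc a - u a) = 0 /\ nrm H (Zc a - du a) = 0 &
      forall a b, al <= a -> a <= b -> b <= be ->
        (nrm H (Zc b) ^+ 2 + nrm V (Yc b) ^+ 2) -
        (nrm H (Zc a) ^+ 2 + nrm V (Yc a) ^+ 2) <= \int[mu]_(t in `]a, b[) K t].
Proof.
have [Yc [Zc [pc hc]]] := mollified_limit.
exists Yc, Zc; split => //.
- move=> a aab e e0; have e3 : 0 < e / 3 by rewrite divr_gt0.
  have [N hN] := hc _ e3.
  have [pya pza] := pc a aab.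
  have [LV LV0 hLV] := mollified_lipschitz hV mD Dfin su iu (krho N).
  have [LH LH0 hLH] := mollified_lipschitz hH mD Dfin sdu idu (krho N).
  have L0 : 0 < LV + LH + 1 by rewrite ltr_wpDl// addr_ge0.
  exists (e / 3 / (LV + LH + 1)); first by rewrite divr_gt0.
  move=> b bab; rewrite ltr_pdivlMr// => ba.
  have [pyb pzb] := pc b bab.
  have [aV aH] := hN N a (leqnn N) aab.
  have [bV bH] := hN N b (leqnn N) bab.
  have lip (L L' : R) : 0 <= L' -> L * `|b - a| <= `|b - a| * (L + L' + 1).
    move=> L'0; rewrite mulrC ler_wpM2l// -addrA lerDl addr_ge0//.
  split.
    apply: (three_piece hV (pY (rho N) b) (pY (rho N) a) pyb pya bV aV).
    rewrite (le_trans (hLV a b))// (le_trans _ (ltW ba))//.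
    exact: lip.
  apply: (three_piece hH (pZ (rho N) b) (pZ (rho N) a) pzb pza bH aH).
  rewrite (le_trans (hLH a b))// (le_trans _ (ltW ba))// (addrC LV).
  exact: lip.
- move=> a aab ra; have [pya pza] := pc a aab; have [Da _ _] := ra.
  have pu0 : pts V (u a) := su.1 a Da.
  have pdu0 : pts H (du a) := sdu.1 a Da.
  split; apply/eqP; rewrite eq_le ?(hnrm_ge0 hV) ?(hnrm_ge0 hH) andbT;
    apply/ler_addgt0Pl => e e0; rewrite addr0.
    have e2 : 0 < e / 2 by rewrite divr_gt0.
    have [N1 hN1] := hc _ e2.
    move/cvgrPdist_le : (mollified_cvgV aab ra) => /(_ _ e2)[N2 _ hN2].
    have k1 : (N1 <= maxn N1 N2)%N by rewrite leq_max leqnn.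
    have k2 : (N2 <= maxn N1 N2)%N by rewrite leq_max leqnn orbT.
    have [h1 _] := hN1 _ a k1 aab; have := hN2 _ k2.
    rewrite /= sub0r normrN => /(le_trans (ler_norm _)) h2.
    exact: (two_piece hV (pY (rho (maxn N1 N2)) a) pya pu0 h1 h2).
  have e2 : 0 < e / 2 by rewrite divr_gt0.
  have [N1 hN1] := hc _ e2.
  move/cvgrPdist_le : (mollified_cvgH aab ra) => /(_ _ e2)[N2 _ hN2].
  have k1 : (N1 <= maxn N1 N2)%N by rewrite leq_max leqnn.
  have k2 : (N2 <= maxn N1 N2)%N by rewrite leq_max leqnn orbT.
  have [_ h1] := hN1 _ a k1 aab; have := hN2 _ k2.
  rewrite /= sub0r normrN => /(le_trans (ler_norm _)) h2.
  exact: (two_piece hH (pZ (rho (maxn N1 N2)) a) pza pdu0 h1 h2).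
move=> a b ala ab bbe.
have aab : al <= a <= be by rewrite ala (le_trans ab).
have bab : al <= b <= be by rewrite bbe (le_trans ala).
have cV c : al <= c <= be -> nrm V (Y (rho n) c - Yc c) @[n --> \oo] --> (0 : R).
  move=> cab; apply/cvgrPdist_le => e e0; have [N hN] := hc e e0.
  exists N => // n /= Nn; rewrite sub0r normrN ger0_norm ?(hnrm_ge0 hV)//.
  by have [] := hN n c Nn cab.
have cH c : al <= c <= be -> nrm H (Z (rho n) c - Zc c) @[n --> \oo] --> (0 : R).
  move=> cab; apply/cvgrPdist_le => e e0; have [N hN] := hc e e0.
  exists N => // n /= Nn; rewrite sub0r normrN ger0_norm ?(hnrm_ge0 hH)//.
  by have [] := hN n c Nn cab.
have Elim c : al <= c <= be ->
    energy (rho n) c @[n --> \oo] --> nrm H (Zc c) ^+ 2 + nrm V (Yc c) ^+ 2.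
  move=> cab; have [pyc pzc] := pc c cab.
  apply: cvgD.
    exact: (hf_sqr_cvg hH (fun n => pZ (rho n) c) pzc (cH c cab)).
  exact: (hf_sqr_cvg hV (fun n => pY (rho n) c) pyc (cV c cab)).
have Einc : energy (rho n) b - energy (rho n) a @[n --> \oo] -->
    (nrm H (Zc b) ^+ 2 + nrm V (Yc b) ^+ 2) -
    (nrm H (Zc a) ^+ 2 + nrm V (Yc a) ^+ 2).
  exact: (cvgB (Elim b bab) (Elim a aab)).
apply: (ler_cvg_to Einc (step_integral_cvg ala ab bbe)).
apply: nearW => n; apply: le_trans (ler_norm _) _.
exact: (energy_increment (krho n) (kP n) (rho_ge0 n) erefl (rho_test n) (rho_mass n) ala ab bbe).
Qed.

End MollifierSequence.

End Evolution.

(** * One-sided mollifiers, and the closed interval [0, T] *)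

Section StandardMollifier.
Context {R : realType}.
Local Notation mu := (@lebesgue_measure R).

(* Smooth approximations of the Heaviside function; the derivative is supported in
   [[dl * (1/3 - s), dl * (2/3 - s)]], to the right of 0 for [s = 0] and to the
   left of 0 for [s = 1]. *)
Definition heaviside_approx (s dl x : R) : R := smooth_step (dl^-1 * x + s).

Lemma heaviside_approx_smooth s dl : bounded_smooth (heaviside_approx s dl).
Proof. exact: (kernel_affine dl^-1 s kernel_smooth_step). Qed.

Lemma heaviside_approx_derive1 s dl x :
  derive1 (heaviside_approx s dl) x = dl^-1 * derive1 smooth_step (dl^-1 * x + s).
Proof.
apply: is_derive_derive1; apply: is_derive_affine.
exact: kernel_is_derive kernel_smooth_step.
Qed.

Lemma heaviside_approx_support s dl x : 0 < dl ->
  derive1 (heaviside_approx s dl) x != 0 ->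
  dl * (3^-1 - s) <= x <= dl * (2 / 3 - s).
Proof.
move=> dl0; rewrite heaviside_approx_derive1 mulf_eq0 negb_or => /andP[_].
move=> /derive1_smooth_step_support/andP[h1 h2].
apply/andP; split; first by rewrite -ler_pdivlMl//; lra.
by rewrite -ler_pdivrMl//; lra.
Qed.

Lemma Rintegral_shift_derive1 (W : R -> R) (T a : R) : 0 < T -> bounded_smooth W ->
  \int[mu]_(t in `]0, T[) (shift_kernel (derive1 W) a t) = W (T - a) - W (- a).
Proof.
move=> T0 kW; rewrite -shift_kernel_derive1// Rintegral_derive1//.
  by rewrite /shift_kernel sub0r.
have := smooth_affine 1 (- a) kW.1.
by rewrite /shift_kernel; under eq_fun do rewrite mul1r.
Qed.

End StandardMollifier.

Section EvolutionGlobal.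
Context {R : realType} {E : lmodType R} {H V : nspace E} {BH BV : E -> E -> R}.
Hypothesis hH : hilbert_form H BH.
Hypothesis hV : hilbert_form V BV.
Hypothesis VH : forall v, pts V v -> pts H v.
Hypothesis VHle : forall v, pts V v -> nrm H v <= nrm V v.
Local Notation mu := (@lebesgue_measure R).
Variable T : R.
Hypothesis T0 : 0 < T.
Let D : set R := `]0, T[%classic.
Variables (u du : R -> E) (kap : R -> R).
Hypothesis su : strongly_measurable V D u.
Hypothesis sdu : strongly_measurable H D du.
Hypothesis iu2 : integ D (fun t => nrm V (u t) ^+ 2).
Hypothesis idu2 : integ D (fun t => nrm H (du t) ^+ 2).
Hypothesis kap0 : forall t, D t -> 0 <= kap t.
Hypothesis mkap : measurable_fun D kap.
Hypothesis ikap2 : integ D (fun t => kap t ^+ 2).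
Hypothesis weak_u : forall theta, test_fun D theta -> forall h, pts H h ->
  \int[mu]_(t in D) (derive1 theta t * BH (u t) h) =
    - \int[mu]_(t in D) (theta t * BH (du t) h).
Hypothesis weak_du : forall theta, test_fun D theta -> forall v, pts V v ->
  `|\int[mu]_(t in D) (derive1 theta t * BH (du t) v) -
    \int[mu]_(t in D) (theta t * BV (u t) v)| <=
  nrm H v * \int[mu]_(t in D) (`|theta t| * kap t).

Let K t := kap t ^+ 2 + nrm H (du t) ^+ 2.
Let mD : measurable D. Proof. exact: measurable_itv. Qed.
Let iK : integ D K. Proof. exact: (integD mD ikap2 idu2). Qed.

Definition evolution_on (Yc Zc : R -> E) (al be : R) :=
  [/\ forall a, al <= a <= be -> pts V (Yc a) /\ pts H (Zc a),
      forall a, al <= a <= be -> forall e : R, 0 < e -> exists2 r : R, 0 < r &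
        forall b, al <= b <= be -> `|b - a| < r ->
          nrm V (Yc b - Yc a) <= e /\ nrm H (Zc b - Zc a) <= e,
      forall a, al <= a <= be -> regular_time (H := H) (V := V) T u du a ->
        nrm V (Yc a - u a) = 0 /\ nrm H (Zc a - du a) = 0 &
      forall a b, al <= a -> a <= b -> b <= be ->
        (nrm H (Zc b) ^+ 2 + nrm V (Yc b) ^+ 2) -
        (nrm H (Zc a) ^+ 2 + nrm V (Yc a) ^+ 2) <= \int[mu]_(t in `]a, b[) K t].

(** The number [eta] bounds the mollification scales, so that the translated supports stay inside
    ]0, T[. With [s = 0] only times after [a] are averaged, which permits [al = 0]; with [s = 1]
    only times before [a], which permits [be = T]. *)
Lemma evolution_one_sided (s eta al be : R) : 0 <= s <= 1 -> 0 < eta ->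
  0 <= al -> al < be -> be <= T ->
  (forall a dl, al <= a <= be -> 0 < dl <= eta ->
     0 < a + dl * (3^-1 - s) /\ a + dl * (2 / 3 - s) < T) ->
  exists Yc Zc, evolution_on Yc Zc al be.
Proof.
move=> /andP[s0 s1] eta0 al0 albe beT hJ.
pose dl (n : nat) := eta * n.+1%:R^-1.
have dl0 n : 0 < dl n by rewrite mulr_gt0// invr_gt0.
have dle n : 0 < dl n <= eta.
  by rewrite dl0/= ler_piMr ?(ltW eta0)// invf_le1// ler1n.
have [C C0 hC] := kernel_bnd (kernel_derive1 (@kernel_smooth_step R)).
have dlc : dl n @[n --> \oo] --> (0 : R).
  have h : eta * n.+1%:R^-1 @[n --> \oo] --> eta * 0.
    by apply: cvgMr; exact: cvg_harmonic.
  by rewrite mulr0 in h.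
have supp n x : derive1 (heaviside_approx s (dl n)) x != 0 ->
    dl n * (3^-1 - s) <= x <= dl n * (2 / 3 - s) by exact: heaviside_approx_support.
have dV n : 0 < (dl n)^-1 by rewrite invr_gt0.
have H0 n x : x <= - dl n -> heaviside_approx s (dl n) x = 0.
  move=> h; apply: smooth_step_eq0.
  have : (dl n)^-1 * x <= -1 by rewrite ler_pdivrMl// mulrN1.
  by lra.
have H1 n x : dl n <= x -> heaviside_approx s (dl n) x = 1.
  move=> h; apply: smooth_step_eq1.
  have : 1 <= (dl n)^-1 * x by rewrite ler_pdivlMl// mulr1.
  by lra.
have := @evolution_local _ _ _ _ _ _ hH hV VH VHle T u du kap su sdu iu2 idu2 kap0 mkap
  ikap2 weak_u weak_du (fun n => heaviside_approx s (dl n)) dl C al be albe.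
apply.
- by apply: subset_itv; rewrite bnd_simp.
- by move=> n; exact: heaviside_approx_smooth.
- by move=> n x; exact: smooth_step_bnd.
- move=> n x; rewrite heaviside_approx_derive1 mulr_ge0 ?(ltW (dV n))//.
  exact: derive1_smooth_step_ge0.
- move=> n a aab; have [ha hb] := hJ a (dl n) aab (dle n).
  apply: (test_fun_smooth (l := a + dl n * (3^-1 - s)) (r := a + dl n * (2 / 3 - s))).
  + have [sm _] := kernel_derive1 (heaviside_approx_smooth s (dl n)).
    have := smooth_affine 1 (- a) sm.
    by under eq_fun do rewrite mul1r.
  + by move=> x /supp; rewrite lerBrDl lerBlDl.
  + by apply: subset_itv; rewrite bnd_simp.
- move=> n a aab; have [ha hb] := hJ a (dl n) aab (dle n).
  rewrite Rintegral_shift_derive1//; last exact: heaviside_approx_smooth.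
  rewrite /heaviside_approx smooth_step_eq1 ?smooth_step_eq0 ?subr0//.
    have : (dl n)^-1 * - a <= 3^-1 - s by rewrite ler_pdivrMl//; lra.
    by lra.
  have : 2 / 3 - s <= (dl n)^-1 * (T - a) by rewrite ler_pdivlMl//; lra.
  by lra.
- exact: dl0.
- exact: dlc.
- move=> n x /supp/andP[h1 h2]; rewrite ltr_norml; apply/andP; split.
    by apply: lt_le_trans h1; have := dl0 n; nra.
  by apply: le_lt_trans h2 _; have := dl0 n; nra.
- move=> n x; rewrite heaviside_approx_derive1 mulrC ler_wpM2r ?(ltW (dV n))//.
  exact: le_trans (ler_norm _) (hC _).
- exact: H0.
- exact: H1.
Qed.

(** Regular times exist arbitrarily close to [m] on its right, and there both pairs agree with [u]
    and [du]; continuity carries the equality to [m]. *)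
Lemma evolution_on_eq Y1 Z1 Y2 Z2 a1 b1 a2 b2 m : 0 <= a1 -> 0 <= a2 -> b1 <= T -> b2 <= T ->
  evolution_on Y1 Z1 a1 b1 -> evolution_on Y2 Z2 a2 b2 ->
  a1 <= m < b1 -> a2 <= m < b2 ->
  nrm V (Y1 m - Y2 m) = 0 /\ nrm H (Z1 m - Z2 m) = 0.
Proof.
move=> a10 a20 b1T b2T [p1 c1 r1 _] [p2 c2 r2 _] /andP[am1 mb1] /andP[am2 mb2].
have m1 : a1 <= m <= b1 by rewrite am1 ltW.
have m2 : a2 <= m <= b2 by rewrite am2 ltW.
have [pY1 pZ1] := p1 _ m1; have [pY2 pZ2] := p2 _ m2.
suff small (e : R) : 0 < e -> nrm V (Y1 m - Y2 m) <= e /\ nrm H (Z1 m - Z2 m) <= e.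
  split; apply/eqP; rewrite eq_le ?(hnrm_ge0 hV) ?(hnrm_ge0 hH) andbT;
    apply/ler_addgt0Pl => e /small[]; by rewrite addr0.
move=> e0; have e2 : 0 < e / 2 by rewrite divr_gt0.
have [d1 d10 h1] := c1 _ m1 _ e2; have [d2 d20 h2] := c2 _ m2 _ e2.
pose M := Num.min (Num.min b1 b2) (m + Num.min d1 d2).
have mM : m < M by rewrite !lt_min mb1 mb2 ltrDl lt_min d10 d20.
have [x /andP[mx]] := ae_exists_itv mM (ae_regular_time hH hV su sdu iu2 idu2).
rewrite !lt_min -ltrBlDl lt_min => /andP[/andP[xb1 xb2] /andP[xd1 xd2]] rx.
have {}rx : regular_time (H := H) (V := V) T u du x.
  apply: rx; rewrite /= in_itv/= (le_lt_trans a10)//=; last exact: le_lt_trans am1 mx.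
  exact: lt_le_trans xb1 b1T.
have x1 : a1 <= x <= b1 by rewrite (le_trans am1 (ltW mx)) ltW.
have x2 : a2 <= x <= b2 by rewrite (le_trans am2 (ltW mx)) ltW.
have nx : `|x - m| = x - m by rewrite gtr0_norm// subr_gt0.
have [Dx _ _] := rx.
have [g1V g1H] := h1 _ x1 (ltac:(by rewrite nx)).
have [g2V g2H] := h2 _ x2 (ltac:(by rewrite nx)).
have [q1V q1H] := r1 _ x1 rx; have [q2V q2H] := r2 _ x2 rx.
have [px1 qx1] := p1 _ x1; have [px2 qx2] := p2 _ x2.
split.
  exact: (five_piece hV pY1 px1 (su.1 x Dx) px2 pY2).
exact: (five_piece hH pZ1 qx1 (sdu.1 x Dx) qx2 pZ2).
Qed.

(** The forward construction on [0, 2T/3] and the backward one on [T/3, T] overlap; they are glued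
    at T/2, inside the overlap, where they agree up to null vectors. *)
Lemma evolution_global : exists Yc Zc, evolution_on Yc Zc 0 T.
Proof.
have T3 : 0 < T / 3 by rewrite divr_gt0.
have [Y1 [Z1 ev1]] : exists Yc Zc, evolution_on Yc Zc 0 (2 * T / 3).
  apply: (@evolution_one_sided 0 (T / 3)) => //; do ?lra.
  by move=> a dl /andP[? ?] /andP[? ?]; split; lra.
have [Y2 [Z2 ev2]] : exists Yc Zc, evolution_on Yc Zc (T / 3) T.
  apply: (@evolution_one_sided 1 (T / 3)) => //; do ?lra.
  by move=> a dl /andP[? ?] /andP[? ?]; split; lra.
pose m := T / 2.
have m01 : 0 <= m < 2 * T / 3 by rewrite /m; apply/andP; split; lra.
have m02 : T / 3 <= m < T by rewrite /m; apply/andP; split; lra.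
have T23 : 2 * T / 3 <= T by lra.
have [mV mH] :=
  evolution_on_eq (lexx 0) (ltW T3) T23 (lexx T) ev1 ev2 m01 m02.
move: ev1 ev2 => [p1 c1 r1 e1] [p2 c2 r2 e2].
have m1 : 0 <= m <= 2 * T / 3 by rewrite /m; apply/andP; split; lra.
have m2 : T / 3 <= m <= T by rewrite /m; apply/andP; split; lra.
have in1 a : 0 <= a -> a <= m -> 0 <= a <= 2 * T / 3.
  by rewrite /m => ? ?; apply/andP; split; lra.
have in2 a : m <= a -> a <= T -> T / 3 <= a <= T.
  by rewrite /m => ? ?; apply/andP; split; lra.
have [pY1 pZ1] := p1 _ m1; have [pY2 pZ2] := p2 _ m2.
exists (fun a => if a <= m then Y1 a else Y2 a), (fun a => if a <= m then Z1 a else Z2 a).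
split.
- move=> a /andP[a0 aT]; case: ltP => am.
    by apply: p2; apply: in2 => //; exact: ltW.
  by apply: p1; exact: in1.
- move=> a /andP[a0 aT] e e0.
  have [am|ma|am] := ltgtP a m.
  + have [r r0 hr] := c1 _ (in1 _ a0 (ltW am)) _ e0.
    exists (Num.min r (m - a)); first by rewrite lt_min r0 subr_gt0.
    move=> b /andP[b0 bT]; rewrite lt_min => /andP[br bm].
    have bm' : b <= m by have := le_lt_trans (ler_norm _) bm; rewrite ltrBlDr subrK => /ltW.
    by rewrite bm'; apply: hr => //; exact: in1.
  + have [r r0 hr] := c2 _ (in2 _ (ltW ma) aT) _ e0.
    exists (Num.min r (a - m)); first by rewrite lt_min r0 subr_gt0.
    move=> b /andP[b0 bT]; rewrite lt_min => /andP[br bm].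
    have bm' : m < b.
      rewrite distrC in bm; have := le_lt_trans (ler_norm _) bm.
      by rewrite ltrD2l ltrN2.
    by rewrite (leNgt b m) bm'/=; apply: hr => //; apply: in2 => //; exact: ltW.
  + rewrite am.
    have [r r0 hr] := c1 _ m1 _ e0; have [r' r'0 hr'] := c2 _ m2 _ e0.
    exists (Num.min r r'); first by rewrite lt_min r0.
    move=> b /andP[b0 bT]; rewrite lt_min => /andP[br br'].
    case: (leP b m) => bm; first by apply: hr => //; exact: in1.
    have bin := in2 _ (ltW bm) bT; have [pb qb] := p2 _ bin.
    have [h1 h2] := hr' _ bin br'.
    split.
      have := hnrm_triangle hV pb pY2 pY1; rewrite (hnrmC hV pY2 pY1) mV addr0.
      by move=> /le_trans; apply.
    have := hnrm_triangle hH qb pZ2 pZ1; rewrite (hnrmC hH pZ2 pZ1) mH addr0.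
    by move=> /le_trans; apply.
- move=> a /andP[a0 aT] ra; case: ltP => am.
    by apply: r2 => //; apply: in2 => //; exact: ltW.
  by apply: r1 => //; exact: in1.
move=> a b a0 ab bT.
case: (leP b m) => bm; first by rewrite (le_trans ab bm); apply: e1 => //; case/andP: (in1 b (le_trans a0 ab) bm).
case: (leP a m) => am; last by apply: e2 => //; case/andP : (in2 a (ltW am) (le_trans ab bT)).
have h1 := e1 a m a0 am (proj2 (andP m1)).
have h2 := e2 m b (proj1 (andP m2)) (ltW bm) bT.
have eV : nrm V (Y1 m) = nrm V (Y2 m).
  apply/eqP; rewrite -subr_eq0 -normr_le0 -mV; exact: hnrm_dist hV _ _ _ _.
have eH : nrm H (Z1 m) = nrm H (Z2 m).
  apply/eqP; rewrite -subr_eq0 -normr_le0 -mH; exact: hnrm_dist hH _ _ _ _.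
have iKab : integ `]a, b[ K.
  by apply: integrableS iK => //; apply: subset_itv; rewrite bnd_simp.
have -> : \int[mu]_(t in `]a, b[) K t =
    \int[mu]_(t in `]a, m[) K t + \int[mu]_(t in `]m, b[) K t.
  have := @Rintegral_itvB _ K (BRight a) (BLeft b) m iKab.
  rewrite !bnd_simp => /(_ am bm) <-.
  rewrite (Rintegral_itv_bndo_bndc (r := m)); first by rewrite addrC subrK.
  by apply: integrableS iKab => //; apply: subset_itv; rewrite bnd_simp// ltW.
by move: h1 h2; rewrite eV eH; exact: telescope_le.
Qed.

End EvolutionGlobal.

(** * Gronwall inequality *)

Section Gronwall.
Context {R : realType}.
Local Notation mu := (@lebesgue_measure R).

(** Composition with the clamp onto [0, T], which is 1-Lipschitz; [antiderivative] wants a function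
    continuous on the whole line. *)
Lemma continuous_extension (f : R -> R) (T : R) : 0 <= T ->
  (forall a, 0 <= a <= T -> forall e : R, 0 < e -> exists2 r : R, 0 < r &
     forall b, 0 <= b <= T -> `|b - a| < r -> `|f b - f a| <= e) ->
  exists2 phi, continuous phi & forall x, 0 <= x <= T -> phi x = f x.
Proof.
move=> T0 cf.
pose cl x := Num.max 0 (Num.min T x).
have clin x : 0 <= cl x <= T by rewrite /cl le_max lexx/= ge_max T0 ge_min lexx.
have clE x : 0 <= x <= T -> cl x = x.
  by move=> /andP[x0 xT]; rewrite /cl (min_idPr xT) (max_idPr x0).
have cl_lip x y : `|cl x - cl y| <= `|x - y|.
  have clc z : [\/ z <= 0 /\ cl z = 0, 0 <= z <= T /\ cl z = z | T <= z /\ cl z = T].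
    have [z0|/ltW z0] := leP z 0.
      by constructor 1; rewrite /cl max_l// ge_min z0 orbT.
    have [zT|/ltW zT] := leP z T.
      by constructor 2; rewrite clE ?z0.
    by constructor 3; rewrite /cl min_l// max_r.
  have h1 := ler_norm (x - y); have h2 := ler_norm (y - x).
  rewrite distrC in h2; rewrite ler_norml.
  by case: (clc x) => -[hx ->]; case: (clc y) => -[hy ->]; apply/andP; split;
    do ?move/andP: hx => [? ?]; do ?move/andP: hy => [? ?]; lra.
pose phi x := f (cl x).
have cphi : continuous phi.
  move=> x; apply/cvgrPdist_le => /= e e0.
  have [r r0 hr] := cf _ (clin x) e e0.
  apply/nbhs_normP; exists r => //= y /= xy.
  by rewrite distrC; apply: hr => //; rewrite distrC; exact: le_lt_trans (cl_lip _ _) xy.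
by exists phi => // x xT; rewrite /phi clE.
Qed.

Lemma gronwall (f : R -> R) (T A k : R) : 0 <= T -> 0 < k ->
  (forall a, 0 <= a <= T -> forall e : R, 0 < e -> exists2 r : R, 0 < r &
     forall b, 0 <= b <= T -> `|b - a| < r -> `|f b - f a| <= e) ->
  (forall b, 0 <= b <= T -> f b <= A + k * \int[mu]_(t in `]0, b[) f t) ->
  f T <= A * expR (k * T).
Proof.
move=> T0 k0 cf hf.
have [phi cphi phiE] := continuous_extension T0 cf.
have [Phi [dPhi PhiE]] := antiderivative 0 T cphi.
have intE b : 0 <= b <= T -> \int[mu]_(t in `]0, b[) f t = Phi b - Phi 0.
  move=> /andP[b0 bT]; rewrite PhiE//; apply: eq_Rintegral => t /set_mem.
  rewrite /= in_itv/= => /andP[t0 tb].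
  by rewrite phiE// (ltW t0) (le_trans (ltW tb)).
(* The shift by [A / k] makes [A + k * (Phi x - Phi 0)] equal to [k] times the first factor. Its
   product with exp(-kx) is nonincreasing by hypothesis, so [F] is nondecreasing. *)
pose F x := -1 * ((Phi x - (Phi 0 - A / k)) * expR (- k * x)).
have dF x : 0 <= x <= T -> is_derive x 1 F
    (-1 * ((phi x - 0) * expR (- k * x) + (Phi x - (Phi 0 - A / k)) * (expR (- k * x) * (- k * 1)))).
  move=> xT; have d1 := is_derive_sub (dPhi x xT) (is_derive_cst (Phi 0 - A / k) x 1).
  have d2 := is_derive_expR_comp (is_derive_scal (- k) (is_derive_id x 1)).
  exact: (is_derive_scal (-1) (is_derive_mul d1 d2)).
have : F 0 <= F T.
  apply: (nondecreasing_derive T0 dF) => x xT.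
  have := hf x xT; rewrite intE// => h.
  have -> : -1 * ((phi x - 0) * expR (- k * x) +
      (Phi x - (Phi 0 - A / k)) * (expR (- k * x) * (- k * 1))) =
    (A + k * (Phi x - Phi 0) - phi x) * expR (- k * x) by field; rewrite gt_eqF.
  by rewrite mulr_ge0 ?expR_ge0// subr_ge0 phiE.
rewrite /F mulr0 expR0 mulr1 !mulN1r lerN2 subKr.
have TT : 0 <= T <= T by rewrite T0 lexx.
have := hf T TT; rewrite intE// => h1 h2.
rewrite mulNr expRN ler_pdivrMr ?expR_gt0// in h2.
apply: le_trans h1 _.
have -> : A + k * (Phi T - Phi 0) = k * (Phi T - (Phi 0 - A / k)) by field; rewrite gt_eqF.
have -> : A * expR (k * T) = k * (A / k * expR (k * T)) by field; rewrite gt_eqF.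
by rewrite ler_pM2l.
Qed.

End Gronwall.

(** * The spaces H and V *)

(** Nested intervals: [a k] minus and plus the full geometric tail are respectively nondecreasing
    and nonincreasing in [k], and the limit is the supremum of the lower ends. The argument also
    yields the explicit tail bound. *)
Lemma geometric_increments_cvg (R : realType) (a : nat -> R) (c : R) :
  (forall k, `|a k.+1 - a k| <= c / 2 ^+ k) ->
  exists2 l, a n @[n --> \oo] --> l & forall k, `|l - a k| <= 2 * c / 2 ^+ k.
Proof.
move=> ac.
have c0 : 0 <= c by have := ac 0%N; rewrite expr0 divr1; exact: le_trans.
pose b k := a k - 2 * c / 2 ^+ k; pose e k := a k + 2 * c / 2 ^+ k.
have half k : 2 * c / 2 ^+ k.+1 = c / 2 ^+ k.
  by rewrite exprS invfM; field; rewrite expf_neq0.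
have dbl k : 2 * c / 2 ^+ k = 2 * (c / 2 ^+ k) by rewrite mulrA.
have bS k m : (k <= m)%N -> b k <= b m.
  move=> /subnKC <-; elim: (m - k)%N => [|j IH]; first by rewrite addn0.
  rewrite addnS; apply: le_trans IH _; rewrite /b half dbl.
  by have := ac (k + j)%N; rewrite ler_norml => /andP[? ?]; lra.
have eS k m : (k <= m)%N -> e m <= e k.
  move=> /subnKC <-; elim: (m - k)%N => [|j IH]; first by rewrite addn0.
  rewrite addnS; apply: le_trans IH; rewrite /e half dbl.
  by have := ac (k + j)%N; rewrite ler_norml => /andP[? ?]; lra.
have pos k : 0 <= 2 * c / 2 ^+ k by rewrite divr_ge0 ?mulr_ge0 ?exprn_ge0.
have be k m : b k <= e m.
  apply: le_trans (bS _ _ (leq_maxl k m)) _.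
  apply: le_trans (eS _ _ (leq_maxr k m)).
  by rewrite /b /e; have := pos (maxn k m); lra.
have hs : has_sup (range b).
  by split; [exists (b 0%N), 0%N|exists (e 0%N) => _ [k _ <-]].
have bl k : b k <= sup (range b) by apply: ub_le_sup; [case: hs|exists k].
have le k : sup (range b) <= e k by apply: ge_sup; [case: hs|move=> _ [j _ <-]].
have dist k : `|sup (range b) - a k| <= 2 * c / 2 ^+ k.
  rewrite ler_norml; have := bl k; have := le k; rewrite /b /e => h1 h2.
  by apply/andP; split; lra.
exists (sup (range b)) => //.
apply/subr_cvg0; apply: norm_cvg0.
apply: (@squeeze_cvgr _ _ _ _ (cst 0) (fun k => 2 * c / 2 ^+ k)).
- by near=> n; rewrite normr_ge0/= distrC.
- exact: cvg_cst.
- have h : 2 * c * (2^-1) ^+ n @[n --> \oo] --> 2 * c * 0.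
    apply: cvgMr; apply: cvg_expr; rewrite ger0_norm ?invr_ge0// invf_lt1//.
    by rewrite ltr1n.
  rewrite mulr0 in h; apply: cvg_trans h; apply: near_eq_cvg.
  by near=> n; rewrite exprVn.
Unshelve. all: by end_near. Qed.

Section SquareIntegrable.
Context {R : realType}.
Local Notation mu := (@lebesgue_measure R).
Variable L : \bar R.
Local Notation I := (itvL L).
Local Notation H := (spaceH L).
Implicit Types u v w : R -> R.

Lemma itvLE : itvL L = [set` Interval (match L with l%:E => BRight (- l) | +oo%E => -oo%O | -oo%E => +oo%O end)
   (match L with l%:E => BLeft l | +oo%E => +oo%O | -oo%E => -oo%O end)].
Proof.
rewrite /itvL; apply/seteqP; case: L => [l| |]; split => x //=;
  rewrite ?in_itv//= ?lte_fin ?ltry ?ltNyr//.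
- by move=> [-> ->].
- by move=> /andP[].
- by move=> [].
Qed.

Lemma measurable_itvL : measurable (itvL L).
Proof. by rewrite itvLE; exact: measurable_itv. Qed.

Lemma open_itvL : open (itvL L).
Proof. by rewrite itvLE; apply: interval_open; case: L. Qed.

Lemma ptsHP u : pts H u <-> measurable_fun I u /\ integ I (fun x => u x ^+ 2).
Proof.
have mI := measurable_itvL.
have mkc : integ I (fun x => u x ^+ 2) <-> integ setT (fun x => (u \_ I) x ^+ 2).
  have := @integrable_mkcond _ _ _ mu I (EFin \o (fun x => u x ^+ 2)) mI.
  have -> // : (EFin \o (fun x => u x ^+ 2)) \_ I = EFin \o (fun x => (u \_ I) x ^+ 2).
  by apply/funext => x; rewrite /= !patchE; case: ifP => // _; rewrite expr0n.
rewrite /=; split => [h|[mu' /mkc iu]].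
  have mu' : measurable_fun setT (u \_ I) by move: h => /andP[/set_mem].
  have /Lfun2_integrable_sqr i := h.
  by split; [exact/(measurable_restrictT _ mI)|exact/mkc].
have m : measurable_fun setT (u \_ I) by exact/(measurable_restrictT _ mI).
apply/andP; split; apply/mem_set => /=; first exact: m.
rewrite /finite_norm unlock/=; apply: poweR_lty.
move/integrableP : iu => [_]; apply: le_lt_trans.
rewrite le_eqVlt; apply/orP; left; apply/eqP; apply: eq_integral => x _.
by rewrite /= powR_mulrn// normrX.
Qed.

Lemma ptsH_measurable u : pts H u -> measurable_fun I u.
Proof. by move=> /ptsHP[]. Qed.

Lemma integ_ip u w : pts H u -> pts H w -> integ I (fun x => u x * w x).
Proof.
move=> /ptsHP[mu' iu] /ptsHP[mw iw]; have mI := measurable_itvL.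
apply: (le_integ (g := fun x => u x ^+ 2 + w x ^+ 2)) => //.
- exact: measurable_funM.
- move=> x _; rewrite normrM -(real_normK (num_real (u x))) -(real_normK (num_real (w x))).
  have := sqr_ge0 (`|u x| - `|w x|); have := sqr_ge0 (`|u x|); have := sqr_ge0 `|w x|.
  by rewrite sqrrB; lra.
- exact: integD.
Qed.

Lemma fct_combE (a : R) u v x : (a *: u + v) x = a * u x + v x.
Proof. by []. Qed.

Lemma ptsH_comb (a : R) u v : pts H u -> pts H v -> pts H (a *: u + v).
Proof.
move=> pu pv; have mI := measurable_itvL; apply/ptsHP.
move: (pu) (pv) => /ptsHP[mu' iu] /ptsHP[mv iv]; split.
  by apply: measurable_funD => //; exact: measurable_funM.
have -> : (fun x => (a *: u + v) x ^+ 2) =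
    (fun x => a ^+ 2 * (u x ^+ 2) + (2 * a * (u x * v x) + v x ^+ 2)).
  by apply/funext => x; rewrite fct_combE; ring.
apply: (integD mI (integZ _ mI iu)); apply: (integD mI) => //.
by apply: (integZ _ mI); exact: integ_ip.
Qed.

Lemma ip_ge0 u : 0 <= ip L u u.
Proof. by apply: Rintegral_ge0 => x _; rewrite -expr2 sqr_ge0. Qed.

Lemma ip_lin (a : R) u v w : pts H u -> pts H v -> pts H w ->
  ip L (a *: u + v) w = a * ip L u w + ip L v w.
Proof.
move=> pu pv pw; have mI := measurable_itvL.
have iu := integ_ip pu pw; have iv := integ_ip pv pw.
rewrite /ip -RintegralZl//.
rewrite -RintegralD//; last exact: (integZ _ mI iu).
by apply: eq_Rintegral => x _; rewrite fct_combE; ring.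
Qed.

Lemma ptsH0 : pts H 0.
Proof.
apply/ptsHP; split; first exact: measurable_cst.
have -> : (fun x : R => (0 : R -> R) x ^+ 2) = cst 0 by apply/funext => x; rewrite expr0n.
exact: integrable0.
Qed.

Lemma nrmH_sqr u : nrm H u ^+ 2 = \int[mu]_(x in I) (u x ^+ 2).
Proof. by rewrite /= sqr_sqrtr ?ip_ge0. Qed.

Lemma ptsH_sub u v : pts H u -> pts H v -> pts H (u - v).
Proof.
move=> pu pv; have := ptsH_comb (-1) pv pu.
by rewrite scaleN1r addrC.
Qed.

(* Along a fast subsequence [v], the series of [4 ^ k * (v (k+1) - v k)^2] is
   integrable, hence finite almost everywhere, and its sum controls the tails. *)
Lemma spaceH_complete_fast (v : nat -> R -> R) : (forall k, pts H (v k)) ->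
  (forall k, nrm H (v k.+1 - v k) <= (4 ^+ k)^-1) ->
  exists2 l, pts H l & nrm H (v k - l) @[k --> \oo] --> (0 : R).
Proof.
move=> pv hv; have mI := measurable_itvL.
have mv k : measurable_fun I (v k) := ptsH_measurable (pv k).
pose h (k : nat) (x : R) : \bar R := (4 ^+ k * (v k.+1 x - v k x) ^+ 2)%:E.
have h0 k x : (0 <= h k x)%E by rewrite lee_fin mulr_ge0 ?sqr_ge0 ?exprn_ge0.
have mh k : measurable_fun I (h k).
  apply/measurable_EFinP; apply: measurable_funM => //.
  by apply: measurable_funX; exact: measurable_funB.
pose S x := (\sum_(0 <= k <oo) h k x)%E.
have mS : measurable_fun I S by apply: ge0_emeasurable_sum => // k x _ _; exact: h0.
have S0 x : (0 <= S x)%E by apply: nneseries_ge0 => k _ _; exact: h0.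
have ih k : (\int[mu]_(x in I) h k x <= ((2 ^+ k)^-1)%:E)%E.
  have pd := ptsH_sub (pv k.+1) (pv k).
  have [md id2] := (ptsHP _).1 pd.
  have := hv k; rewrite -(ler_pXn2r (n := 2))// ?nnegrE ?sqrtr_ge0//.
  rewrite nrmH_sqr => hk.
  have -> : (\int[mu]_(x in I) h k x =
      (4 ^+ k)%:E * \int[mu]_(x in I) (((v k.+1 - v k) x) ^+ 2)%:E)%E.
    rewrite -(@ge0_integralZl_EFin _ _ _ mu I mI)//.
    - by move=> x _; rewrite lee_fin sqr_ge0.
    - by apply/measurable_EFinP; exact: measurable_funX.
  rewrite -[X in (_ * X)%E]fineK; last by apply: integrable_fin_num => //; exact: id2.
  rewrite -EFinM lee_fin.
  apply: (@le_trans _ _ (4 ^+ k * ((4 ^+ k)^-1 ^+ 2))); first by rewrite ler_wpM2l.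
  have e4 : (4 : R) ^+ k = 2 ^+ k * 2 ^+ k by rewrite -exprMn; congr (_ ^+ _); ring.
  have p2 : 0 < (2 : R) ^+ k by rewrite exprn_gt0.
  have -> : 4 ^+ k * ((4 ^+ k)^-1 ^+ 2) = (2 ^+ k)^-1 * (2 ^+ k)^-1 :> R.
    by rewrite e4; field; rewrite gt_eqF.
  by rewrite ler_piMl ?invr_ge0 ?(ltW p2)// invf_le1// exprn_ege1// ler1n.
have iS : (\int[mu]_(x in I) S x <= 2%:E)%E.
  rewrite (integral_nneseries mu mI mh)//.
  (* The bound [(2 ^+ k)^-1] is rewritten as [2 / 2 ^ k.+1], the shape that [epsilon_trick] sums to
     2. *)
  apply: le_trans (_ : \sum_(0 <= k <oo) (0 + (2 / (2 ^ k.+1)%:R)%:E) <= _)%E.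
    apply: lee_nneseries => [k _ _|k _]; first by apply: integral_ge0.
    rewrite add0e; apply: le_trans (ih k) _; rewrite lee_fin natrX exprS invfM mulrA.
    by rewrite mulfV// mul1r.
  apply: le_trans (epsilon_trick _ _ _) _ => //.
  by rewrite eseries0// add0e.
have intS : mu.-integrable I S.
  apply/integrableP; split => //.
  under eq_integral do rewrite gee0_abs//.
  by rewrite (le_lt_trans iS)// ltry.
pose Sr x := fine (S x).
have aeS : {ae mu, forall x, I x -> S x \is a fin_num} by exact: (@integrable_ae _ _ _ mu I mI S intS).
pose G := [set x | S x \is a fin_num].
have mG : measurable (I `&` G) by exact: emeasurable_fin_num.
have incr x : G x -> forall k, `|v k.+1 x - v k x| <= Num.sqrt (Sr x) / 2 ^+ k.
  move=> Gx k; have hk : (h k x <= S x)%E.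
    apply: le_trans (nneseries_lim_ge k.+1 (fun n _ _ => h0 n x)).
    by rewrite big_nat_recr//= leeDr// sume_ge0// => i _; exact: h0.
  have {}hk : 4 ^+ k * (v k.+1 x - v k x) ^+ 2 <= Sr x.
    by rewrite -lee_fin /Sr fineK.
  have Sr0 : 0 <= Sr x by rewrite fine_ge0.
  have p2 : 0 < (2 : R) ^+ k by rewrite exprn_gt0.
  rewrite ler_pdivlMr// -(ler_pXn2r (n := 2))// ?nnegrE ?mulr_ge0 ?(ltW p2) ?sqrtr_ge0//.
  rewrite sqr_sqrtr// exprMn real_normK ?num_real// mulrC.
  by rewrite -exprM mulnC exprM (_ : 2 ^+ 2 = 4)//; ring.
have ex x : exists l : R, G x -> v k x @[k --> \oo] --> l /\
    forall k, `|l - v k x| <= 2 * Num.sqrt (Sr x) / 2 ^+ k.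
  have [Gx|nGx] := pselect (G x); last by exists 0.
  by have [l cl bl] := geometric_increments_cvg (incr x Gx); exists l.
have [l0 hl0] := choice ex.
(* Off the set [G] where the series is finite the limit is set to 0; the truncated sequence then
   converges at every point of [I], which makes [l] measurable. *)
pose l x := (\1_(I `&` G) x : R) * l0 x.
have ml : measurable_fun I l.
  apply: (measurable_fun_cvg (h := fun k x => (\1_(I `&` G) x : R) * v k x)).
    by move=> k; apply: measurable_funM => //; exact: measurable_indic.
  move=> x Ix; rewrite /l indicE; case: (boolP (x \in _)) => [/set_mem[_ Gx]|_].
    by apply: cvgMr; have [] := hl0 x Gx.
  by under eq_fun do rewrite mul0r; rewrite mul0r; exact: cvg_cst.
have mSr : measurable_fun I Sr by apply: (measurableT_comp (f := fine)); [exact: fine_measurable|].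
have iSr : integ I Sr.
  apply: (@le_integrable _ _ _ mu I mI _ S) intS; first exact/measurable_EFinP.
  move=> x _; rewrite /= /Sr; have := S0 x; case: (S x) => //= _.
  exact: leey.
have key k : integ I (fun x => (v k x - l x) ^+ 2) /\
    \int[mu]_(x in I) ((v k x - l x) ^+ 2) <= 4 * (4 ^+ k)^-1 * \int[mu]_(x in I) Sr x.
  have ae : {ae mu, forall x, I x ->
      (((v k x - l x) ^+ 2)%:E <= (4 * (4 ^+ k)^-1 * Sr x)%:E)%E}.
    apply: ae_imp aeS => x Gx Ix; have {}Gx : G x := Gx Ix.
    have [_ /(_ k)] := hl0 x Gx.
    rewrite lee_fin /l indicE mem_set ?mul1r// distrC => hk.
    have Sr0 : 0 <= Sr x by rewrite fine_ge0.
    have p2 : 0 < (2 : R) ^+ k by rewrite exprn_gt0.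
    rewrite -(real_normK (num_real (v k x - l0 x))).
    have -> : 4 * (4 ^+ k)^-1 * Sr x = (2 * Num.sqrt (Sr x) / 2 ^+ k) ^+ 2.
      rewrite !exprMn sqr_sqrtr// exprVn -exprM mulnC exprM.
      by rewrite (_ : (2 : R) ^+ 2 = 4); [ring|ring].
    by rewrite lerXn2r// nnegrE !mulr_ge0 ?invr_ge0 ?sqrtr_ge0 ?(ltW p2).
  have m1 : measurable_fun I (fun x => (v k x - l x) ^+ 2).
    by apply: measurable_funX; exact: measurable_funB.
  have i2 : integ I (fun x => 4 * (4 ^+ k)^-1 * Sr x) by exact: (integZ _ mI iSr).
  have Sr0 x : 0 <= Sr x by rewrite fine_ge0.
  have c0 : 0 <= 4 * (4 ^+ k)^-1 :> R by rewrite mulr_ge0// invr_ge0 exprn_ge0.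
  have le : (\int[mu]_(x in I) ((v k x - l x) ^+ 2)%:E <=
      \int[mu]_(x in I) (4 * (4 ^+ k)^-1 * Sr x)%:E)%E.
    apply: (@ae_ge0_le_integral _ _ _ mu I mI) ae => //.
    - by move=> x _; rewrite lee_fin sqr_ge0.
    - exact/measurable_EFinP.
    - by move=> x _; rewrite lee_fin mulr_ge0.
    - by case/integrableP : i2.
  have fin2 : (\int[mu]_(x in I) (4 * (4 ^+ k)^-1 * Sr x)%:E)%E \is a fin_num.
    by apply: integrable_fin_num => //; exact: i2.
  have i1 : integ I (fun x => (v k x - l x) ^+ 2).
    apply/integrableP; split; first exact/measurable_EFinP.
    under eq_integral do rewrite /= ger0_norm ?sqr_ge0//.
    by rewrite (le_lt_trans le)// ltey_eq fin2.
  split => //; rewrite -RintegralZl//.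
  by rewrite /Rintegral fine_le//; apply: integrable_fin_num => //; exact: i1.
have pvl k : pts H (v k - l).
  apply/ptsHP; split; last by have [] := key k.
  exact: measurable_funB.
exists l.
  by have := ptsH_sub (pv 0%N) (pvl 0%N); rewrite opprB addrC subrK.
pose C := 4 * \int[mu]_(x in I) Sr x.
have C0 : 0 <= C by rewrite mulr_ge0// Rintegral_ge0// => x _; rewrite fine_ge0.
apply: (@squeeze_cvgr _ _ _ _ (cst 0) (fun k => Num.sqrt C * (2^-1) ^+ k)).
- near=> k; rewrite sqrtr_ge0/=.
  rewrite -(ler_pXn2r (n := 2))// ?nnegrE ?mulr_ge0 ?sqrtr_ge0 ?exprn_ge0 ?invr_ge0//.
  rewrite nrmH_sqr exprMn sqr_sqrtr//.
  have [_ hk] := key k; apply: le_trans hk _.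
  have -> : ((2^-1) ^+ k) ^+ 2 = (4 ^+ k)^-1 :> R.
    by rewrite -exprM mulnC exprM -exprVn; congr (_ ^+ k); field.
  by rewrite /C mulrAC.
- exact: cvg_cst.
- have h2 : Num.sqrt C * (2^-1) ^+ k @[k --> \oo] --> Num.sqrt C * 0.
    apply: cvgMr; apply: cvg_expr; rewrite ger0_norm ?invr_ge0// invf_lt1//.
    by rewrite ltr1n.
  by rewrite mulr0 in h2.
Unshelve. all: by end_near. Qed.

Lemma nrmH_ge0 u : 0 <= nrm H u. Proof. exact: sqrtr_ge0. Qed.

Lemma nrmH_addW u v : pts H u -> pts H v ->
  nrm H (u + v) ^+ 2 <= 2 * nrm H u ^+ 2 + 2 * nrm H v ^+ 2.
Proof.
move=> pu pv; have mI := measurable_itvL.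
have [_ iu] := (ptsHP u).1 pu; have [_ iv] := (ptsHP v).1 pv.
have [_ iuv] := (ptsHP _).1 (ptsH_comb 1 pu pv).
rewrite scale1r in iuv.
rewrite !nrmH_sqr -!RintegralZl// -RintegralD//; last 2 first.
- exact: (integZ _ mI iu).
- exact: (integZ _ mI iv).
apply: le_Rintegral => //.
- exact: (integD mI (integZ 2 mI iu) (integZ 2 mI iv)).
- move=> x _; have -> : (u + v) x = u x + v x by [].
  by have := sqr_ge0 (u x - v x); rewrite sqrrB sqrrD; lra.
Qed.

Lemma spaceH_complete (s : nat -> R -> R) : (forall n, pts H (s n)) ->
  (forall e : R, 0 < e -> exists N, forall m n, (N <= m)%N -> (N <= n)%N ->
     nrm H (s m - s n) <= e) ->
  exists2 l, pts H l & nrm H (s n - l) @[n --> \oo] --> (0 : R).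
Proof.
move=> ps cs.
have p4 k : 0 < (4 ^+ k)^-1 :> R by rewrite invr_gt0 exprn_gt0.
have [N hN] := choice (fun k => cs _ (p4 k)).
(* Partial sums of [(N i).+1] give a strictly increasing choice of indices that dominates [N]. *)
pose M k := (\sum_(i < k.+1) (N i).+1)%N.
have MN k : (N k <= M k)%N.
  by rewrite /M big_ord_recr/= (leq_trans (leqnSn _))// leq_addl.
have MS k : (M k < M k.+1)%N by rewrite /M [ltnRHS]big_ord_recr/= addnS ltnS leq_addr.
have Mk k : (k <= M k)%N by elim: k => // k IH; exact: leq_ltn_trans (MS k).
have [l pl lim] : exists2 l, pts H l & nrm H (s (M k) - l) @[k --> \oo] --> (0 : R).
  apply: (@spaceH_complete_fast (fun k => s (M k))) => [k|k]; first exact: ps.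
  by apply: hN => //; exact: leq_trans (MN k) (ltnW (MS k)).
exists l => //.
apply/cvgrPdist_le => /= e e0.
have e2 : 0 < e / 2 by rewrite divr_gt0.
have [N0 hN0] := cs _ e2.
move/cvgrPdist_le : lim => /(_ _ e2)[K _ hK].
exists N0 => // n /= N0n; rewrite sub0r normrN ger0_norm ?nrmH_ge0//.
pose k := maxn K N0.
have h1 : nrm H (s n - s (M k)) <= e / 2.
  by apply: hN0 => //; apply: leq_trans (Mk k); exact: leq_maxr.
have h2 : nrm H (s (M k) - l) <= e / 2.
  have := hK k (leq_maxl _ _); rewrite /= sub0r normrN.
  exact: le_trans (ler_norm _).
have := nrmH_addW (ptsH_sub (ps n) (ps (M k))) (ptsH_sub (ps (M k)) pl).
rewrite subrKA => h3.
rewrite -(ler_pXn2r (n := 2))// ?nnegrE ?nrmH_ge0 ?(ltW e0)//.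
apply: le_trans h3 _.
have sq (x : R) : 0 <= x -> x <= e / 2 -> x ^+ 2 <= (e / 2) ^+ 2.
  by move=> x0 xe; rewrite lerXn2r// nnegrE ltW.
have := sq _ (nrmH_ge0 _) h1; have := sq _ (nrmH_ge0 _) h2.
by rewrite [X in _ <= X -> _]expr_div_n; move: (nrm H _ ^+ 2) (nrm H _ ^+ 2) => x y; lra.
Qed.

Lemma spaceH_hilbert : hilbert_form H (ip L).
Proof.
split.
- exact: ptsH0.
- exact: ptsH_comb.
- by move=> u v; apply: eq_Rintegral => x _; rewrite mulrC.
- exact: ip_lin.
- exact: ip_ge0.
- by [].
- exact: spaceH_complete.
Qed.

Lemma test_fun_bounded (U : set R) th : test_fun U th ->
  [/\ smooth th, exists2 C, 0 <= C & forall x, `|th x| <= C,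
   compact (closure [set x | th x != 0]) & closure [set x | th x != 0] `<=` U].
Proof.
move=> [/smoothP sth cpt sub]; split => //.
have [M [_ hM]] := compact_bounded cpt.
have supp x : th x != 0 -> - (M + 1) <= x <= M + 1.
  move=> thx; rewrite -ler_norml.
  by apply: (hM (M + 1)); [rewrite ltrDl|exact: subset_closure].
by have [C C0 hC] := bounded_support (smooth_continuous sth) supp; exists C.
Qed.

Lemma test_fun_derive1 (U : set R) th : test_fun U th -> test_fun U (derive1 th).
Proof.
move=> tth; have [sth _ cpt sub] := test_fun_bounded tth.
have cl : closure [set x | derive1 th x != 0] `<=` closure [set x | th x != 0].
  rewrite [X in _ `<=` X](closure_id _).1; last exact: closed_closure.
  apply: closure_subset => x /= d0.
  apply: contrapT => nx; move: d0; apply/negP; rewrite negbK; apply/eqP.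
  apply: is_derive_derive1; apply: (@near_eq_is_derive _ R R (cst (0 : R))).
  have op : open (~` closure [set x | th x != 0]) by rewrite openC; exact: closed_closure.
  have : nbhs x (~` closure [set x | th x != 0]) by exact: open_nbhs_nbhs.
  apply: filterS => z nz; rewrite /cst; apply/esym/eqP; apply: contrapT => /negP thz.
  by apply: nz; exact: subset_closure.
split.
- by apply/smoothP; exact: smooth_derive1.
- exact: (subclosed_compact (@closed_closure _ _) cpt cl).
- exact: subset_trans cl sub.
Qed.

Lemma test_fun_ptsH (U : set R) th : test_fun U th -> pts H th.
Proof.
move=> /test_fun_bounded[sth [C C0 hC] cpt _]; have mI := measurable_itvL.
have cth := smooth_continuous sth.
have mth : measurable_fun I th by apply: measurable_funTS; exact: continuous_measurable_fun.
apply/ptsHP; split => //.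
set K := closure _ in cpt.
have mK : measurable K by apply: closed_measurable; exact: closed_closure.
have iK : integ I (fun x => C ^+ 2 * \1_K x).
  apply: (integZ _ mI).
  apply: (@integrableS _ _ _ mu setT) => //.
  apply/integrableP; split; first by apply/measurable_EFinP; exact: measurable_indic.
  rewrite (_ : (fun x => `|(EFin \o \1_K) x|)%E = (fun x => (\1_K x)%:E)).
    by rewrite integral_indic// setIT; exact: compact_finite_measure.
  by apply/funext => x; rewrite /= ger0_norm// indicE.
apply: (le_integ _ _ _ iK) => //; first exact: measurable_funX.
move=> x _; have [th0|th0] := eqVneq (th x) 0.
  by rewrite th0 expr0n normr0 mulr_ge0 ?sqr_ge0// indicE.
rewrite indicE mem_set ?mulr1; last exact: subset_closure.
by rewrite normrX lerXn2r// nnegrE.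
Qed.

End SquareIntegrable.

(** * The fundamental lemma of the calculus of variations *)

Section TestFunctions.
Context {R : realType}.
Local Notation mu := (@lebesgue_measure R).
Variable L : \bar R.
Local Notation I := (itvL L).
Local Notation H := (spaceH L).
Implicit Types u v w : R -> R.

Lemma interval_bumps (p q : R) : p < q -> exists b : nat -> R -> R,
  [/\ forall n, smooth (b n), forall n x, b n x != 0 -> p <= x <= q,
      forall n x, 0 <= b n x <= 1 &
      forall x, b n x @[n --> \oo] --> (\1_(`]p, q[) x : R)].
Proof.
move=> pq.
pose b (n : nat) x := smooth_step (n%:R * x + - (n%:R * p)) *
                      smooth_step ((- n%:R) * x + n%:R * q) : R.
have b0 n x : ~ (p < x < q) -> b n x = 0.
  move=> npq; rewrite /b; have [xp|px] := leP x p.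
    rewrite smooth_step_eq0 ?mul0r// -mulrBr (@le_trans _ _ 0)//.
    by rewrite mulr_ge0_le0// subr_le0.
  have [qx|xq] := leP q x; last by exfalso; apply: npq; rewrite px.
  rewrite [X in _ * X]smooth_step_eq0 ?mulr0// mulNr addrC -mulrBr (@le_trans _ _ 0)//.
    by rewrite mulr_ge0_le0// subr_le0.
exists b; split.
- by move=> n; apply: smoothM; apply: smooth_affine; exact: smooth_smooth_step.
- move=> n x; apply: contra_neqT => npq; apply: b0 => /andP[px xq].
  by move/negP : npq; apply; rewrite !ltW.
- move=> n x; rewrite /b.
  have /andP[? ?] := smooth_step_bnd (n%:R * x + - (n%:R * p)).
  have /andP[? ?] := smooth_step_bnd ((- n%:R) * x + n%:R * q).
  by rewrite mulr_ge0//= mulr_ile1.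
- move=> x; rewrite indicE; case: (boolP (x \in _)) => [/set_mem|/negP npq]; last first.
    have b0x n : b n x = 0.
      by apply: b0 => h; apply: npq; apply/mem_set; rewrite /= in_itv.
    by under eq_fun do rewrite b0x; exact: cvg_cst.
  rewrite /= in_itv/= => /andP[px xq].
  apply: cvg_near_cst; near=> n.
  have n1 : 1 <= n%:R * (x - p).
    by rewrite -ler_pdivrMr ?subr_gt0//; near: n; exact: nbhs_infty_ger.
  have n2 : 1 <= n%:R * (q - x).
    by rewrite -ler_pdivrMr ?subr_gt0//; near: n; exact: nbhs_infty_ger.
  rewrite /b !smooth_step_eq1 ?mulr1//; lra.
Unshelve. all: by end_near. Qed.

Lemma ip_test_Rintegral_itv u (p q : R) : pts H u ->
  (forall th, test_fun I th -> ip L u th = 0) -> p < q -> `[p, q] `<=` I ->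
  \int[mu]_(x in `]p, q[) u x = 0.
Proof.
move=> pu u0 pq pqI; have mI := measurable_itvL L.
have [mu' iu] := (ptsHP _ _).1 pu.
have [b [sb bs b01 bc]] := interval_bumps pq.
have tb n : test_fun I (b n) := test_fun_smooth (sb n) (bs n) pqI.
have i1 : integ I (\1_(`[p, q])).
  apply: (@integrableS _ _ _ mu setT) => //.
  apply/integrableP; split; first by apply/measurable_EFinP; exact: measurable_indic.
  rewrite (_ : (fun x => `|(EFin \o \1_(`[p, q])) x|)%E = (fun x => (\1_(`[p, q]) x)%:E)).
    rewrite integral_indic// setIT; apply: compact_finite_measure.
    exact: segment_compact.
  by apply/funext => x; rewrite /= ger0_norm// indicE.
have hb n x : `|u x * b n x| <= u x ^+ 2 + \1_(`[p, q]) x.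
  have [b0|bn] := eqVneq (b n x) 0.
    by rewrite b0 mulr0 normr0 addr_ge0// ?sqr_ge0// indicE.
  rewrite indicE mem_set/=; last by rewrite in_itv/=; exact: (bs n).
  have /andP[h0 h1] := b01 n x; rewrite normrM (ger0_norm h0).
  apply: (@le_trans _ _ `|u x|); first by rewrite ler_piMr.
  rewrite -(real_normK (num_real (u x))); have := sqr_ge0 (`|u x| - 1).
  by have := normr_ge0 (u x); rewrite sqrrB; nra.
have [_ c] := @Rintegral_dct _ I (fun n x => u x * b n x) (fun x => u x * \1_(`]p, q[) x)
  (fun x => u x ^+ 2 + \1_(`[p, q]) x) mI
  (fun n => measurable_funM mu' (ptsH_measurable (test_fun_ptsH L (tb n))))
  (fun x _ => cvgMr (bc x)) (integD mI iu i1) (fun n x _ => hb n x).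
have : \int[mu]_(x in I) (u x * \1_(`]p, q[) x) = 0.
  have z n : \int[mu]_(x in I) (u x * b n x) = 0 by exact: (u0 _ (tb n)).
  rewrite /= in c; rewrite (eq_cvg _ _ z) in c.
  rewrite -(cvg_lim (@Rhausdorff R) c); apply: cvg_lim => //.
  exact: cvg_cst.
move=> <-; rewrite [LHS]Rintegral_mkcond [RHS]Rintegral_mkcond.
congr (Rintegral _ _ _); apply/funext => x; rewrite !patchE indicE.
case: (boolP (x \in `]p, q[%classic)) => [/set_mem xpq|_].
  rewrite mem_set ?mulr1//; apply: pqI; exact: (subset_itv_oo_cc xpq).
by rewrite mulr0; case: ifP.
Qed.

Lemma locally_integrable_ptsH u : pts H u -> locally_integrable setT (u \_ I).
Proof.
move=> pu; have mI := measurable_itvL L; have [mu' iu] := (ptsHP _ _).1 pu.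
have mu1 : measurable_fun setT (u \_ I) by exact/(measurable_restrictT _ mI).
have iu1 : integ setT (fun x => (u \_ I) x ^+ 2).
  have := @integrable_mkcond _ _ _ mu I (EFin \o (fun x => u x ^+ 2)) mI.
  have -> : (EFin \o (fun x => u x ^+ 2)) \_ I = EFin \o (fun x => (u \_ I) x ^+ 2).
    by apply/funext => x; rewrite /= !patchE; case: ifP => // _; rewrite expr0n.
  by move=> <-.
split => //; first exact: openT.
move=> K _ cK; have mK : measurable K.
  by apply: closed_measurable; apply: compact_closed => //; exact: Rhausdorff.
have : integ K (u \_ I).
  apply: (le_integ (g := fun x => (u \_ I) x ^+ 2 + 1)) => //.
  - exact: measurable_funTS.
  - move=> x _; rewrite -(real_normK (num_real ((u \_ I) x))).
    move: (normr_ge0 ((u \_ I) x)); move: (`|(u \_ I) x|) => y y0.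
    by have := sqr_ge0 (y - 1); rewrite sqrrB; nra.
  - apply: integD => //; first exact: (@integrableS _ _ _ mu setT).
    by apply: integ_cst => //; exact: compact_finite_measure.
by move/integrableP => [_].
Qed.

(* The fundamental lemma of the calculus of variations: the integral of [u] over
   every small interval vanishes, hence so does [u] at its Lebesgue points. *)
Lemma ip_test_eq0 u : pts H u -> (forall th, test_fun I th -> ip L u th = 0) ->
  nrm H u = 0.
Proof.
move=> pu u0; have mI := measurable_itvL L; have [mu' iu] := (ptsHP _ _).1 pu.
have li := locally_integrable_ptsH pu.
have ae0 : {ae mu, forall x, I x -> u x = 0}.
  apply: ae_imp (lebesgue_differentiation li) => a la Ia.
  have uE : (u \_ I) a = u a by rewrite patchE mem_set.
  have [d0 d00 hd0] : exists2 d, 0 < d & `[a - d, a + d] `<=` I.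
    have := open_nbhs_nbhs (conj (@open_itvL _ L) Ia).
    move=> /nbhs_ballP[d /= d0 hd]; exists (d / 2); first by rewrite divr_gt0.
    move=> x; rewrite /= in_itv/= => /andP[h1 h2]; apply: hd; rewrite /= ball_itv/= in_itv/=.
    by apply/andP; split; lra.
  apply/eqP; rewrite -normr_eq0 eq_le normr_ge0 andbT; apply/ler_addgt0Pl => e e0.
  rewrite addr0.
  have [d d1 hd] := lebesgue_pt_le e0 la.
  pose r := Num.min d d0 / 2.
  have m0 : 0 < Num.min d d0 by rewrite lt_min d1 d00.
  have r0 : 0 < r by rewrite divr_gt0.
  have rm : r < Num.min d d0 by rewrite /r; lra.
  have [rd rd0] : r < d /\ r < d0 by move: rm; rewrite lt_min => /andP[].
  have := hd r; rewrite r0 rd => /(_ isT); rewrite ball_itv.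
  have sI : `[a - r, a + r] `<=` I.
    move=> x; rewrite /= in_itv/= => /andP[h1 h2]; apply: hd0; rewrite /= in_itv/=.
    by apply/andP; split; lra.
  have ar : a - r < a + r by lra.
  have z0 := ip_test_Rintegral_itv pu u0 ar sI.
  set J := `](a - r), (a + r)[%classic : set R in z0 *.
  have mJ : measurable J by exact: measurable_itv.
  have JI : J `<=` I by apply: subset_trans sI; exact: subset_itv_oo_cc.
  have muJ : mu J = (r *+ 2)%:E.
    rewrite lebesgue_measure_itv/= lte_fin ar -EFinB; congr (_%:E); ring.
  have iJ : integ J (u \_ I).
    apply: (@integrableS _ _ _ mu `[a - r, a + r]) => //; first exact: subset_itv_oo_cc.
    apply/integrableP; split.
      by apply/measurable_EFinP; apply: measurable_funTS; case: li.
    by case: li => _ _; apply => //; exact: segment_compact.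
  have ic : integ J (cst (u a)) by apply: integ_cst => //; rewrite muJ ltry.
  have id : integ J (fun y => (u \_ I) y - u a) by exact: integB.
  rewrite uE => h.
  have : \int[mu]_(y in J) `|(u \_ I) y - u a| <= e * r.
    rewrite -lee_fin /Rintegral fineK//.
    by apply: integrable_fin_num => //; exact: integ_norm.
  move/(le_trans (normr_Rintegral_le mJ id)).
  rewrite RintegralB// Rintegral_cst//.
  have -> : \int[mu]_(x in J) ((u \_ I) x) = 0.
    rewrite -z0; apply: eq_Rintegral => x /set_mem Jx.
    by rewrite patchE mem_set//; exact: JI.
  have fJ : fine (mu J) = r *+ 2 by rewrite muJ.
  rewrite [fine _]fJ sub0r normrN normrM [X in _ * X]ger0_norm ?mulrn_wge0 ?(ltW r0)// => k.
  have {k} : `|u a| * 2 * r <= e * r by rewrite -mulrA mulr_natl.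
  rewrite ler_pM2r// => k; have := normr_ge0 (u a); lra.
apply/eqP; rewrite sqrtr_eq0 le_eqVlt; apply/orP; left.
rewrite /ip /Rintegral; apply/eqP.
suff -> : (\int[mu]_(x in I) (u x * u x)%:E = 0)%E by [].
rewrite -(integral0 mu I); apply: (@ge0_ae_eq_integral _ _ _ mu I _ _ mI) => //.
- by apply/measurable_EFinP; exact: measurable_funM.
- by move=> x _; rewrite lee_fin -expr2 sqr_ge0.
- by apply: ae_imp ae0 => x ux Ix; rewrite /= ux// mulr0.
Qed.

End TestFunctions.

(** * The Sobolev spaces and their Hilbert forms *)

Section Sobolev.
Context {R : realType}.
Local Notation mu := (@lebesgue_measure R).
Variable L : \bar R.
Local Notation I := (itvL L).
Local Notation H := (spaceH L).
Local Notation V1 := (spaceH1 L).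
Local Notation V10 := (spaceH10 L).
Implicit Types u v w th : R -> R.

Let hH : hilbert_form H (ip L) := spaceH_hilbert L.

Let test_ptsH th : test_fun I th -> pts H th := @test_fun_ptsH R L I th.

Let dtest_ptsH th : test_fun I th -> pts H (derive1 th).
Proof. by move=> tth; apply: test_ptsH; exact: test_fun_derive1. Qed.

Lemma test_fun_Rintegral_derive1 th : test_fun I th ->
  \int[mu]_(x in I) derive1 th x = 0.
Proof.
move=> tth; have [sth _ cpt sub] := test_fun_bounded tth.
have [M [_ hM]] := compact_bounded cpt.
pose K := `|M| + 1.
have supp x : th x != 0 -> - K <= x <= K.
  move=> thx; rewrite -ler_norml; apply: hM; last exact: subset_closure.
  by rewrite /K (le_lt_trans (ler_norm _))// ltrDl.
have dsupp := derive1_support supp.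
have K0 : 0 < K by rewrite /K ltr_wpDl.
have dsub x : derive1 th x != 0 -> I x.
  move=> dx0; have [_ _ s] := test_fun_derive1 tth; apply: s.
  exact: subset_closure.
have z x : K < `|x| -> th x = 0.
  by move=> Kx; apply: contraTeq Kx => /supp; rewrite -ler_norml -leNgt.
have lt : - (K + 1) < K + 1 by lra.
transitivity (\int[mu]_(x in `](- (K + 1)), (K + 1)[) derive1 th x).
  rewrite [LHS]Rintegral_mkcond [RHS]Rintegral_mkcond.
  congr (Rintegral _ _ _); apply/funext => x; rewrite !patchE.
  have [dx0|dx0] := eqVneq (derive1 th x) 0; first by rewrite dx0 !if_same.
  rewrite (mem_set (dsub x dx0)) mem_set//= in_itv/=.
  by have /andP[h1 h2] := dsupp _ dx0; apply/andP; split; lra.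
rewrite Rintegral_derive1// !z ?subrr// ?normrN ger0_norm; lra.
Qed.

(** Integration by parts: the product of two test functions is a test function, and its derivative
    has integral zero. *)
Lemma test_fun_weak_deriv th : test_fun I th -> L2_weak_deriv L th (derive1 th).
Proof.
move=> tth; split; first exact: dtest_ptsH.
move=> psi tpsi; have mI := measurable_itvL L.
have [sth _ _ _] := test_fun_bounded tth; have [spsi _ _ _] := test_fun_bounded tpsi.
have [_ _ cth subth] := test_fun_bounded tth.
have tt : test_fun I (fun x => th x * psi x).
  have sub : closure [set x | th x * psi x != 0] `<=` closure [set x | th x != 0].
    apply: closure_subset => x /=; apply: contra_neq => ->; exact: mul0r.
  split.
  - by apply/smoothP; exact: smoothM.
  - exact: (subclosed_compact (@closed_closure _ _) cth sub).
  - exact: subset_trans sub subth.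
have i1 := integ_ip (test_ptsH tth) (dtest_ptsH tpsi).
have i2 := integ_ip (dtest_ptsH tth) (test_ptsH tpsi).
apply/eqP; rewrite -addr_eq0 -RintegralD//; apply/eqP.
rewrite -(test_fun_Rintegral_derive1 tt); apply: eq_Rintegral => x _.
apply/esym; rewrite addrC; apply: is_derive_derive1; apply: is_derive_mul.
- by apply: derivable_is_derive1; exact: smooth_derivable.
- by apply: derivable_is_derive1; exact: smooth_derivable.
Qed.

Lemma weak_deriv_comb (a : R) u v w z : pts H u -> pts H v ->
  L2_weak_deriv L u w -> L2_weak_deriv L v z ->
  L2_weak_deriv L (a *: u + v) (a *: w + z).
Proof.
move=> pu pv [pw hw] [pz hz]; split; first exact: ptsH_comb.
move=> th tth; rewrite !ip_lin//; try exact: test_ptsH; try exact: dtest_ptsH.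
by rewrite hw// hz//; ring.
Qed.

(** [dx] is selected by [xget] and is linear only modulo null functions; identities about it go
    through this uniqueness, a consequence of the fundamental lemma. *)
Lemma weak_deriv_uniq u v w z : pts H u -> pts H v -> nrm H (u - v) = 0 ->
  L2_weak_deriv L u w -> L2_weak_deriv L v z -> nrm H (w - z) = 0.
Proof.
move=> pu pv uv [pw hw] [pz hz]; apply: ip_test_eq0; first exact: ptsH_sub.
move=> th tth; rewrite (hfBl hH)//; last exact: test_ptsH.
have pd := dtest_ptsH tth.
have := hf_nrm0l hH (ptsH_sub pu pv) pd uv.
by rewrite (hfBl hH)// hw// hz//; lra.
Qed.

Lemma dxP u : pts V1 u -> L2_weak_deriv L u (dx L u).
Proof. by move=> [_ ex]; rewrite /dx; exact: xgetPex. Qed.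

Lemma ptsH1_ptsH u : pts V1 u -> pts H u. Proof. by case. Qed.

Lemma dx_ptsH u : pts V1 u -> pts H (dx L u). Proof. by move=> /dxP[]. Qed.

Lemma ptsH1_comb (a : R) u v : pts V1 u -> pts V1 v -> pts V1 (a *: u + v).
Proof.
move=> pu pv; split; first by apply: ptsH_comb; exact: ptsH1_ptsH.
exists (a *: dx L u + dx L v).
by apply: weak_deriv_comb; [exact: ptsH1_ptsH|exact: ptsH1_ptsH|exact: dxP|exact: dxP].
Qed.

Lemma ip_eq_null w z h : pts H w -> pts H z -> pts H h -> nrm H (w - z) = 0 ->
  ip L w h = ip L z h.
Proof.
move=> pw pz ph wz; apply/eqP; rewrite -subr_eq0 -(hfBl hH)//; apply/eqP.
by apply: (hf_nrm0l hH) => //; exact: ptsH_sub.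
Qed.

Lemma ip_dx_weak_deriv u w h : pts H u -> L2_weak_deriv L u w -> pts H h ->
  ip L (dx L u) h = ip L w h.
Proof.
move=> pu hw ph; have p1 : pts V1 u by split => //; exists w.
have hd := dxP p1.
apply: ip_eq_null => //; [exact: hd.1|exact: hw.1|].
apply: (weak_deriv_uniq pu pu _ hd hw); rewrite subrr; exact: (hnrm0 hH).
Qed.

Definition ipV u v := ip L u v + ip L (dx L u) (dx L v).

Lemma ip_dx_comb (a : R) u v h : pts V1 u -> pts V1 v -> pts H h ->
  ip L (dx L (a *: u + v)) h = a * ip L (dx L u) h + ip L (dx L v) h.
Proof.
move=> pu pv ph; rewrite -ip_lin//; [|exact: dx_ptsH|exact: dx_ptsH].
have [hu hv] := (ptsH1_ptsH pu, ptsH1_ptsH pv).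
apply: ip_dx_weak_deriv => //; first exact: ptsH_comb.
by apply: weak_deriv_comb => //; exact: dxP.
Qed.

Lemma ipV_ge0 u : 0 <= ipV u u.
Proof. by rewrite addr_ge0 ?ip_ge0. Qed.

Lemma nrmV_def u : nrm V1 u = Num.sqrt (ipV u u).
Proof. by rewrite /ipV -!(hnrm_sqr hH). Qed.

Lemma nrmV_sqr u : nrm V1 u ^+ 2 = nrm H u ^+ 2 + nrm H (dx L u) ^+ 2.
Proof. by rewrite nrmV_def sqr_sqrtr ?ipV_ge0// /ipV -!(hnrm_sqr hH). Qed.

Lemma nrmH_le_nrmV u : nrm H u <= nrm V1 u.
Proof.
rewrite -(ler_pXn2r (n := 2))// ?nnegrE ?(hnrm_ge0 hH) ?sqrtr_ge0// nrmV_sqr.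
by rewrite lerDl sqr_ge0.
Qed.

Lemma nrmdx_le_nrmV u : nrm H (dx L u) <= nrm V1 u.
Proof.
rewrite -(ler_pXn2r (n := 2))// ?nnegrE ?(hnrm_ge0 hH) ?sqrtr_ge0// nrmV_sqr.
by rewrite lerDr sqr_ge0.
Qed.

Lemma nrm_dx_weak_deriv u w : pts H u -> L2_weak_deriv L u w ->
  nrm H (dx L u) = nrm H w.
Proof.
move=> pu hw; have p1 : pts V1 u by split => //; exists w.
have [pd pw] := (dx_ptsH p1, hw.1).
congr Num.sqrt; rewrite (ip_dx_weak_deriv pu hw)//.
by rewrite (hf_sym hH) (ip_dx_weak_deriv pu hw).
Qed.

Lemma weak_deriv_sub u v w z : pts H u -> pts H v ->
  L2_weak_deriv L u w -> L2_weak_deriv L v z -> L2_weak_deriv L (u - v) (w - z).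
Proof.
move=> pu pv hw hz; have := weak_deriv_comb (-1) pv pu hz hw.
by rewrite !scaleN1r ![- _ + _]addrC.
Qed.

(** The weak derivative sees only the class of [u] modulo null sets. This is what upgrades the
    initial condition, which is imposed in H, to an equality in V. *)
Lemma nrmH_null_nrmV u : pts V1 u -> nrm H u = 0 -> nrm V1 u = 0.
Proof.
move=> pu u0; have hu := ptsH1_ptsH pu.
have p0 : pts H 0 := ptsH0 L.
have d0 : L2_weak_deriv L 0 0.
  split=> // th tth; rewrite !(hf0l hH) ?oppr0//; [exact: test_ptsH|exact: dtest_ptsH].
have : nrm H (dx L u - 0) = 0.
  by apply: (weak_deriv_uniq hu p0 _ (dxP pu) d0); rewrite subr0.
rewrite subr0 => du0; apply/eqP; rewrite -sqrf_eq0 nrmV_sqr u0 du0.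
by rewrite expr0n addr0.
Qed.

Lemma spaceH1_complete (s : nat -> R -> R) : (forall n, pts V1 (s n)) ->
  (forall e : R, 0 < e -> exists N, forall m n, (N <= m)%N -> (N <= n)%N ->
     nrm V1 (s m - s n) <= e) ->
  exists2 l, pts V1 l & nrm V1 (s n - l) @[n --> \oo] --> (0 : R).
Proof.
move=> ps cs.
have hs n := ptsH1_ptsH (ps n); have ds n := dxP (ps n).
have dds n m : nrm H (dx L (s n) - dx L (s m)) = nrm H (dx L (s n - s m)).
  apply/esym; apply: nrm_dx_weak_deriv; first exact: ptsH_sub.
  by apply: weak_deriv_sub.
have [l pl cl] : exists2 l, pts H l & nrm H (s n - l) @[n --> \oo] --> (0 : R).
  apply: (hf_complete hH) => // e /cs[N hN]; exists N => m n Nm Nn.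
  exact: le_trans (nrmH_le_nrmV _) (hN m n Nm Nn).
have [k pk ck] : exists2 l, pts H l & nrm H (dx L (s n) - l) @[n --> \oo] --> (0 : R).
  apply: (hf_complete hH) => [n|e /cs[N hN]]; first exact: (ds n).1.
  exists N => m n Nm Nn; rewrite dds.
  exact: le_trans (nrmdx_le_nrmV _) (hN m n Nm Nn).
have lk : L2_weak_deriv L l k.
  split=> // th tth; have [pt pd] := (test_ptsH tth, dtest_ptsH tth).
  have c1 := hf_cvgl hH hs pl pd cl.
  have c2 := hf_cvgl hH (fun n => (ds n).1) pk pt ck.
  have c3 : - ip L (dx L (s n)) th @[n --> \oo] --> - ip L k th by exact: cvgN.
  rewrite -(cvg_lim (@Rhausdorff R) c3); apply/esym/cvg_lim => //.
  by rewrite -(eq_cvg _ _ (fun n => (ds n).2 th tth)).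
exists l; first by split => //; exists k.
have e n : nrm V1 (s n - l) = Num.sqrt (nrm H (s n - l) ^+ 2 + nrm H (dx L (s n) - k) ^+ 2).
  have <- := nrm_dx_weak_deriv (ptsH_sub (hs n) pl) (weak_deriv_sub (hs n) pl (ds n) lk).
  by [].
apply: (@squeeze_cvgr _ _ _ _ (cst 0) (fun n => nrm H (s n - l) + nrm H (dx L (s n) - k))).
- near=> n; rewrite e; apply/andP; split; first exact: sqrtr_ge0.
  move: (hnrm_ge0 hH (s n - l)) (hnrm_ge0 hH (dx L (s n) - k)).
  move: (nrm H _) (nrm H _) => x y x0 y0.
  rewrite -(ler_pXn2r (n := 2))// ?nnegrE ?sqrtr_ge0 ?addr_ge0//.
  rewrite sqr_sqrtr ?addr_ge0 ?sqr_ge0//.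
  by have := mulr_ge0 x0 y0; rewrite sqrrD; lra.
- exact: cvg_cst.
- by rewrite -[X in _ --> X](addr0 0); apply: cvgD.
Unshelve. all: by end_near. Qed.

Lemma spaceH1_hilbert : hilbert_form V1 ipV.
Proof.
split.
- split; first exact: ptsH0.
  exists 0; split; first exact: ptsH0.
  move=> th tth; rewrite !(hf0l hH) ?oppr0//; [exact: test_ptsH|exact: dtest_ptsH].
- exact: ptsH1_comb.
- by move=> u v; rewrite /ipV (hf_sym hH) [ip L (dx L u) _](hf_sym hH).
- move=> a u v w pu pv pw; rewrite /ipV ip_dx_comb//; last exact: dx_ptsH.
  have e := ip_lin a (ptsH1_ptsH pu) (ptsH1_ptsH pv) (ptsH1_ptsH pw).
  by rewrite e mulrDr addrACA.
- exact: ipV_ge0.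
- exact: nrmV_def.
- exact: spaceH1_complete.
Qed.

Lemma test_fun_ptsH1 th : test_fun I th -> pts V1 th.
Proof.
move=> tth; split; first exact: test_ptsH.
by exists (derive1 th); exact: test_fun_weak_deriv.
Qed.

Let h1 := spaceH1_hilbert.

Lemma test_fun_ptsH10 th : test_fun I th -> pts V10 th.
Proof.
move=> tth; split; first exact: test_fun_ptsH1.
by move=> e e0; exists th => //; rewrite subrr (hnrm0 h1).
Qed.

Lemma ptsH10_0 : pts V10 0.
Proof.
apply: test_fun_ptsH10.
have c0 : closure [set x : R | (0 : R -> R) x != 0] = set0.
  rewrite (_ : [set x : R | _] = set0) ?closure0//.
  by apply/seteqP; split => x //=; rewrite eqxx.
split; rewrite ?c0//; last exact: compact0.
by apply/smoothP => k; exact: derivable_n_cst.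
Qed.

Lemma ptsH10_comb (a : R) u v : pts V10 u -> pts V10 v -> pts V10 (a *: u + v).
Proof.
move=> [pu au] [pv av]; split; first exact: ptsH1_comb.
move=> e e0; pose d := e / (2 * (`|a| + 1)).
have a1 : 0 < `|a| + 1 by rewrite ltr_wpDl.
have d0 : 0 < d by rewrite divr_gt0// mulr_gt0.
have e2 : 0 < e / 2 by rewrite divr_gt0.
have [th1 t1 hu] := au d d0; have [th2 t2 hv] := av (e / 2) e2.
exists (a *: th1 + th2); first exact: test_fun_comb.
have -> : a *: u + v - (a *: th1 + th2) = a *: (u - th1) + (v - th2).
  by rewrite scalerBr opprD addrACA.
have [p1 p2] := (test_fun_ptsH1 t1, test_fun_ptsH1 t2).
have q1 := hptsB h1 pu p1; have q2 := hptsB h1 pv p2.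
apply: le_lt_trans (hnrmD h1 (hptsZ h1 a q1) q2) _; rewrite (hnrmZ h1)//.
have le1 : `|a| * nrm V1 (u - th1) <= e / 2.
  apply: (@le_trans _ _ ((`|a| + 1) * d)).
    by apply: ler_pM => //; [exact: (hnrm_ge0 h1)|rewrite lerDl|exact: ltW].
  by rewrite le_eqVlt /d; apply/orP; left; apply/eqP; field; rewrite gt_eqF.
by rewrite [ltRHS](splitr e); apply: ler_ltD.
Qed.

Lemma spaceH10_hilbert : hilbert_form V10 ipV.
Proof.
split.
- exact: ptsH10_0.
- exact: ptsH10_comb.
- exact: (hf_sym h1).
- by move=> a u v w [pu _] [pv _] [pw _]; exact: (hf_lin h1).
- exact: ipV_ge0.
- exact: nrmV_def.
move=> s ps cs; have [l pl cl] := hf_complete h1 (fun n => (ps n).1) cs.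
exists l => //; split => // e e0.
have e2 : 0 < e / 2 by rewrite divr_gt0.
have [N hN] : exists N, nrm V1 (s N - l) < e / 2.
  move/cvgrPdist_lt : (cl) => /(_ _ e2)[N _ /(_ N (leqnn N)) h]; exists N.
  by apply: le_lt_trans h; rewrite distrC subr0 ler_norm.
have [th tth hth] := (ps N).2 _ e2; exists th => //.
have [p1 p2] := ((ps N).1, test_fun_ptsH1 tth).
have tri := hnrm_triangle h1 pl p1 p2; rewrite (hnrmC h1 pl p1) in tri.
apply: (le_lt_trans tri); rewrite [ltRHS](splitr e).
exact: (ltrD hN hth).
Qed.

Variable bc : boundary_condition.
Local Notation V := (spaceV L bc).

Lemma spaceV_hilbert : hilbert_form V ipV.
Proof. by case: bc; [exact: spaceH10_hilbert|exact: spaceH1_hilbert]. Qed.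

Lemma ptsV_ptsH1 u : pts V u -> pts V1 u.
Proof. by case: bc => // -[]. Qed.

Lemma nrmVE u : nrm V u = nrm V1 u. Proof. by case: bc. Qed.

Lemma test_fun_ptsV th : test_fun I th -> pts V th.
Proof. by case: bc; [exact: test_fun_ptsH10|exact: test_fun_ptsH1]. Qed.

End Sobolev.

(** * Weak solutions *)

Section DualSpace.
Context {R : realType}.
Local Notation mu := (@lebesgue_measure R).
Variables (L : \bar R) (bc : boundary_condition).
Local Notation H := (spaceH L).
Local Notation V := (spaceV L bc).
Local Notation V' := (spaceVdual L bc).
Implicit Types (u v h : R -> R) (F G : (R -> R) -> R).

Let hH : hilbert_form H (ip L) := spaceH_hilbert L.
Let hV : hilbert_form V (ipV L) := spaceV_hilbert L bc.

Lemma ptsV_ptsH u : pts V u -> pts H u.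
Proof. by move=> /ptsV_ptsH1[]. Qed.

Lemma nrmH_le u : nrm H u <= nrm V u.
Proof. by rewrite nrmVE; exact: nrmH_le_nrmV. Qed.

Lemma dual_pts0 : pts V' 0.
Proof.
split=> [a u v _ _|]; first by rewrite -[LHS]/(0 : R) -[(0 : (R -> R) -> R) u]/(0 : R)
  -[(0 : (R -> R) -> R) v]/(0 : R) mulr0 addr0.
by exists 0 => v _; rewrite -[(0 : (R -> R) -> R) v]/(0 : R) normr0 mul0r.
Qed.

Lemma dual_pts_comb (a : R) F G : pts V' F -> pts V' G -> pts V' (a *: F + G).
Proof.
have E u : (a *: F + G) u = a * F u + G u by [].
move=> [lF [C hC]] [lG [C' hC']]; split=> [b u v pu pv|].
  by rewrite !E lF// lG//; ring.
exists (`|a| * C + C') => v pv; rewrite E.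
apply: le_trans (ler_normD _ _) _; rewrite mulrDl normrM -mulrA lerD//.
  by rewrite ler_wpM2l//; exact: hC.
exact: hC'.
Qed.

Lemma dual_le F v : pts V' F -> pts V v -> `|F v| <= nrm V' F * nrm V v.
Proof.
move=> [lF [C hC]] pv.
have F0 : F 0 = 0.
  have := lF 1 0 0 (hf0 hV) (hf0 hV); rewrite scaler0 addr0 mul1r.
  by move/eqP; rewrite -subr_eq0 opprD addNKr oppr_eq0 => /eqP.
have FZ a u : pts V u -> F (a *: u) = a * F u.
  by move=> pu; have := lF a u 0 pu (hf0 hV); rewrite !addr0 F0 addr0.
(* A null vector cannot be normalized, but any bound [C] for [F] already forces [F v = 0] there. *)
have [v0|vn0] := eqVneq (nrm V v) 0.
  by have := hC v pv; rewrite v0 !mulr0.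
have vp : 0 < nrm V v by rewrite lt_neqAle eq_sym vn0 (hnrm_ge0 hV).
rewrite -ler_pdivrMr//; apply: ub_le_sup.
  exists `|C| => _ [w [pw w1] <-]; apply: le_trans (hC w pw) _.
  apply: le_trans (_ : `|C| * nrm V w <= _).
    by rewrite ler_wpM2r ?(hnrm_ge0 hV)// ler_norm.
  by rewrite ler_piMr.
exists ((nrm V v)^-1 *: v).
  split; first exact: (hptsZ hV).
  by rewrite (hnrmZ hV)// gtr0_norm ?invr_gt0// mulVf.
by rewrite FZ// normrM gtr0_norm ?invr_gt0// mulrC.
Qed.

Lemma emb_dual h : pts H h -> pts V' (emb L h).
Proof.
move=> ph; split=> [a u v pu pv|].
  have [qu qv] := (ptsV_ptsH pu, ptsV_ptsH pv).
  rewrite /emb [LHS](hf_sym hH) (hf_lin hH)//.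
  by congr (_ * _ + _); exact: (hf_sym hH).
exists (nrm H h) => v pv; apply: le_trans (hf_cauchy_schwarz hH ph (ptsV_ptsH pv)) _.
by rewrite ler_wpM2l ?(hnrm_ge0 hH)// nrmH_le.
Qed.

End DualSpace.

Section InitialValue.
Context {R : realType} {E : lmodType R} {X : nspace E}.
Local Notation mu := (@lebesgue_measure R).
Variables (l : E -> R) (C : R).
Hypothesis p0 : pts X 0.
Hypothesis pL : forall (a : R) u v, pts X u -> pts X v -> pts X (a *: u + v).
Hypothesis lL : forall (a : R) u v, pts X u -> pts X v ->
  l (a *: u + v) = a * l u + l v.
Hypothesis C0 : 0 <= C.
Hypothesis lC : forall u, pts X u -> `|l u| <= C * nrm X u.

(* Two continuous representatives are compared through the functional [l]. *)
Lemma initial_value_functional (T : R) (u : R -> E) (a : E) (f : R -> R) : 0 < T ->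
  (forall t, 0 < t < T -> pts X (u t)) -> pts X a ->
  initial_value X T u a ->
  (forall e : R, 0 < e -> exists2 r : R, 0 < r &
     forall t, 0 <= t <= T -> `|t - 0| < r -> `|f t - f 0| <= e) ->
  {ae mu, forall t, 0 < t < T -> f t = l (u t)} ->
  f 0 = l a.
Proof.
move=> T0 pu pa [w [[pw cw] wu wa]] cf fu.
have p00 : (0 : R) \in `[0, T] by rewrite in_itv/= lexx ltW.
have lB x y : pts X x -> pts X y -> l (x - y) = l x - l y by exact: functionalB.
have pB x y : pts X x -> pts X y -> pts X (x - y) by exact: ptsB.
have l0 x y : pts X x -> pts X y -> nrm X (x - y) = 0 -> l x = l y.
  move=> px py xy; apply/eqP; rewrite -subr_eq0 -lB// -normr_le0.
  by apply: le_trans (lC (pB _ _ px py)) _; rewrite xy mulr0.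
rewrite -(l0 _ _ (pw 0 p00) pa wa).
apply/eqP; rewrite -subr_eq0 -normr_le0; apply/ler_addgt0Pl => e e0; rewrite addr0.
have e2 : 0 < e / 2 by rewrite divr_gt0.
have [r r0 hr] := cf _ e2.
have C1 : 0 < C + 1 by rewrite ltr_wpDl.
have := cw 0 p00; move/cvgrPdist_lt => /(_ (e / 2 / (C + 1))).
rewrite divr_gt0// => /(_ isT) /nbhs_ballP[d /= d0 hd].
have m0 : 0 < Num.min T (Num.min r d) by rewrite !lt_min T0 r0 d0.
(* At a time [t] close to 0 where both almost-everywhere identities hold, [f 0] is close to
   [f t = l (u t) = l (w t)], which is close to [l (w 0)]. *)
have [t /andP[t0]] := ae_exists_itv m0 (ae_imp2 (fun t h1 h2 => conj h1 h2) fu wu).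
rewrite !lt_min => /and3P[tT tr td] [h1 h2].
have tD : 0 < t < T by rewrite t0.
have tI : t \in `[0, T] by rewrite in_itv/= !ltW.
have wt : l (w t) = l (u t).
  by apply: l0; [exact: pw|exact: pu|apply: h2; rewrite in_itv].
have b1 : `|f t - f 0| <= e / 2.
  by apply: hr; rewrite ?ltW// subr0 gtr0_norm.
have b2 : `|l (w t) - l (w 0)| <= e / 2.
  rewrite -lB; [|exact: pw..]; apply: le_trans (lC (pB _ _ (pw t tI) (pw 0 p00))) _.
  have {}hd : nrm X (w t - w 0) <= e / 2 / (C + 1).
    apply: le_trans (ler_norm _) _; apply/ltW.
    have := hd t; rewrite /= !sub0r !normrN; apply => //.
    by rewrite /ball /= sub0r normrN gtr0_norm.
  apply: (@le_trans _ _ (C * (e / 2 / (C + 1)))); first by rewrite ler_wpM2l.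
  rewrite mulrCA ler_piMr ?(ltW e2)// ler_pdivrMr// mul1r.
  by rewrite lerDl.
rewrite wt -(h1 tD) in b2.
by rewrite distrC; move: b1 b2; rewrite !ler_norml => /andP[? ?] /andP[? ?]; apply/andP; split; lra.
Qed.

End InitialValue.

Section Nonlinearity.
Context {R : realType}.
Variable L : \bar R.
Local Notation H := (spaceH L).

Lemma sin_lipschitz (x y : R) : `|sin x - sin y| <= `|x - y|.
Proof.
rewrite -[leRHS]mul1r; apply: (@mean_value_le _ sin cos) => z _.
exact: cos_max.
Qed.

Lemma halfplane_slice_measurable (phi : R -> R -> R) (t : R) (D : set R) :
  smooth_halfplane phi -> 0 < t -> measurable_fun D (fun x => phi x t).
Proof.
move=> [d [dE _ dd]] t0; apply: measurable_funTS.
have -> : (fun x => phi x t) = (fun x => d 0%N 0%N x t).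
  by apply/funext => x; rewrite dE// ltW.
apply: continuous_measurable_fun => x.
exact: is_derive_continuous (dd 0%N 0%N x t t0).1.
Qed.

(** The Lipschitz bound for the sine produces a factor [eps] that cancels [eps^-1]; this keeps the
    final constant independent of [eps] and [phi]. *)
Lemma rhs_bound (phi g eta : R -> R -> R) (eps t : R) :
  smooth_halfplane phi -> 0 < eps -> 0 < t ->
  pts H (eta t) -> pts H (g t) ->
  pts H (rhs eps phi g eta t) /\
  nrm H (rhs eps phi g eta t) <= nrm H (eta t) + nrm H (g t).
Proof.
move=> sphi eps0 t0 pe pg; have mI := measurable_itvL L; have hH := spaceH_hilbert L.
have [me ie] := (ptsHP _ _).1 pe.
pose f x := eps^-1 * (sin (phi x t) - sin (phi x t + eps * eta t x)).
have fle x : `|f x| <= `|eta t x|.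
  rewrite /f normrM gtr0_norm ?invr_gt0// ler_pdivrMl//.
  apply: le_trans (sin_lipschitz _ _) _.
  by rewrite opprD addNKr normrN normrM gtr0_norm.
have mphi := halfplane_slice_measurable (D := itvL L) sphi t0.
have ms : measurable_fun setT (@sin R).
  by apply: continuous_measurable_fun; exact: continuous_sin.
have mf : measurable_fun (itvL L) f.
  apply: measurable_funM => //; apply: measurable_funB.
    exact: (measurableT_comp ms).
  apply: (measurableT_comp ms); apply: measurable_funD => //.
  exact: measurable_funM.
have fle2 x : f x ^+ 2 <= eta t x ^+ 2.
  by rewrite -(real_normK (num_real (f x))) -(real_normK (num_real (eta t x))) lerXn2r.
have if2 : integ (itvL L) (fun x => f x ^+ 2).
  apply: (le_integ mI _ _ ie); first exact: measurable_funX.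
  by move=> x _; rewrite ger0_norm ?sqr_ge0.
have pf : pts H f by apply/ptsHP.
have fn : nrm H f <= nrm H (eta t).
  rewrite -(ler_pXn2r (n := 2))// ?nnegrE ?(hnrm_ge0 hH)// !nrmH_sqr.
  by apply: le_Rintegral.
have -> : rhs eps phi g eta t = f + g t by [].
split; first exact: (hptsD hH).
by apply: le_trans (hnrmD hH pf pg) _; rewrite lerD2r.
Qed.

End Nonlinearity.

Lemma ae_ge0_le_Rintegral (R : realType) (D : set R) (f g : R -> R) :
  measurable D -> integ D f -> integ D g ->
  (forall t, D t -> 0 <= f t) -> (forall t, D t -> 0 <= g t) ->
  {ae (@lebesgue_measure R), forall t, D t -> f t <= g t} ->
  \int[lebesgue_measure]_(t in D) f t <= \int[lebesgue_measure]_(t in D) g t.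
Proof.
move=> mD fi gi f0 g0 fg; rewrite /Rintegral fine_le//.
- by apply: integrable_fin_num => //; exact: fi.
- by apply: integrable_fin_num => //; exact: gi.
apply: (@ae_ge0_le_integral _ _ _ (@lebesgue_measure R) D mD) => //.
- by case/integrableP : fi.
- by case/integrableP : gi.
Qed.

Lemma test_fun_weight (R : realType) (U D : set R) th : test_fun U th -> weight D th.
Proof.
move=> /test_fun_bounded[sth [C _ hC] _ _]; split; last by exists C.
by apply: measurable_funTS; apply: continuous_measurable_fun; exact: smooth_continuous.
Qed.

Lemma strongly_measurable_sub (R : realType) (E : lmodType R) (X Y : nspace E)
    (D : set R) (u : R -> E) :
  (forall v w, pts X v -> pts X w -> pts X (v - w)) ->
  (forall v, pts X v -> pts Y v) -> (forall v, pts X v -> 0 <= nrm Y v <= nrm X v) ->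
  strongly_measurable X D u -> strongly_measurable Y D u.
Proof.
move=> pB XY le [pu [s [ss cs]]]; split=> [t Dt|]; first by apply: XY; exact: pu.
exists s; split=> [n|t Dt]; first by have [? ? ps] := ss n; split => // t; exact: XY.
apply: (@squeeze_cvgr _ _ _ _ (cst 0) (fun n => nrm X (u t - s n t)));
  [|exact: cvg_cst|exact: cs].
near=> n.
by apply: le; apply: pB; [exact: pu|have [_ _] := ss n; exact].
Unshelve. all: by end_near. Qed.

Lemma sqr_near (R : realType) (y e : R) : 0 <= y -> 0 < e ->
  exists2 d, 0 < d & forall x, 0 <= x -> `|x - y| <= d -> `|x ^+ 2 - y ^+ 2| <= e.
Proof.
move=> y0 e0; have y1 : 0 < 2 * y + 1 by rewrite ltr_wpDl// mulr_ge0.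
exists (Num.min 1 (e / (2 * y + 1))); first by rewrite lt_min ltr01 divr_gt0.
move=> x x0; rewrite le_min => /andP[xy1 xye].
rewrite subr_sqr normrM [X in _ * X]ger0_norm ?addr_ge0//.
have xy : x + y <= 2 * y + 1 by have := le_trans (ler_norm _) xy1; lra.
apply: (@le_trans _ _ (e / (2 * y + 1) * (2 * y + 1))); last by rewrite divfK ?gt_eqF.
by apply: ler_pM => //; exact: addr_ge0.
Qed.

Section CurveContinuity.
Context {R : realType} {E : lmodType R} {X : nspace E} {B : E -> E -> R}.
Hypothesis hB : hilbert_form X B.
Variables (c : R -> E) (T a : R).
Hypothesis aT : 0 <= a <= T.
Hypothesis pc : forall t, 0 <= t <= T -> pts X (c t).
Hypothesis cc : forall e : R, 0 < e -> exists2 r : R, 0 < r &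
  forall b, 0 <= b <= T -> `|b - a| < r -> nrm X (c b - c a) <= e.

Lemma form_curve_continuous h (e : R) : pts X h -> 0 < e -> exists2 r : R, 0 < r &
  forall b, 0 <= b <= T -> `|b - a| < r -> `|B (c b) h - B (c a) h| <= e.
Proof.
move=> ph e0; have h1 : 0 < nrm X h + 1 by rewrite ltr_wpDl ?(hnrm_ge0 hB).
have [r r0 hr] := cc (divr_gt0 e0 h1); exists r => // b bT ba.
rewrite -(hfBl hB)//; [|exact: pc..].
apply: le_trans (hf_cauchy_schwarz hB (hptsB hB (pc bT) (pc aT)) ph) _.
apply: (@le_trans _ _ (e / (nrm X h + 1) * (nrm X h + 1))).
  by apply: ler_pM; rewrite ?(hnrm_ge0 hB) ?hr// lerDl.
by rewrite divfK ?gt_eqF.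
Qed.

Lemma nrm_sqr_curve_continuous (e : R) : 0 < e -> exists2 r : R, 0 < r &
  forall b, 0 <= b <= T -> `|b - a| < r -> `|nrm X (c b) ^+ 2 - nrm X (c a) ^+ 2| <= e.
Proof.
move=> e0; have [d d0 hd] := sqr_near (hnrm_ge0 hB (c a)) e0.
have [r r0 hr] := cc d0; exists r => // b bT ba; apply: hd; first exact: (hnrm_ge0 hB).
exact: le_trans (hnrm_dist hB (pc bT) (pc aT)) (hr _ bT ba).
Qed.

Lemma curve_within_cvg :
  nrm X (c s - c a) @[s --> within [set` `[0, T]] (nbhs a)] --> (0 : R).
Proof.
apply/cvgrPdist_le => e e0; have [r r0 hr] := cc e0.
apply/nbhs_ballP; exists r => //= s sa sT.
rewrite sub0r normrN ger0_norm ?(hnrm_ge0 hB)//; apply: hr; first by rewrite in_itv in sT.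
by rewrite distrC.
Qed.

End CurveContinuity.

(** * The energy inequality for weak solutions *)

Section WeakSolution.
Context {R : realType}.
Local Notation mu := (@lebesgue_measure R).
Variables (L : \bar R) (bc : boundary_condition) (T eps : R).
Variables (phi g : R -> R -> R) (u0 v0 : R -> R).
Variables (eta deta : R -> R -> R) (ddeta : R -> (R -> R) -> R).
Local Notation H := (spaceH L).
Local Notation V := (spaceV L bc).
Local Notation V' := (spaceVdual L bc).
Hypothesis T0 : 0 < T.
Hypothesis sphi : smooth_halfplane phi.
Hypothesis eps0 : 0 < eps.
Hypothesis hg : L2T H T g.
Hypothesis pu0 : pts V u0.
Hypothesis pv0 : pts H v0.
Hypothesis ws : weak_solution L bc T eps phi g u0 v0 eta deta ddeta.

Let D : set R := `]0, T[%classic.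
Let hH : hilbert_form H (ip L) := spaceH_hilbert L.
Let hV : hilbert_form V (ipV L) := spaceV_hilbert L bc.
Let VH := @ptsV_ptsH R L bc.
Let VHle u : pts V u -> nrm H u <= nrm V u. Proof. by move=> _; exact: nrmH_le. Qed.
Let mD : measurable D. Proof. exact: measurable_itv. Qed.
Let Dfin : (mu D < +oo)%E.
Proof. by rewrite lebesgue_measure_itv/= lte_fin T0 -EFinB ltry. Qed.

Let su : strongly_measurable V D eta. Proof. by case: ws => -[[]]. Qed.
Let iu2 : integ D (fun t => nrm V (eta t) ^+ 2). Proof. by case: ws => -[[]]. Qed.
Let sdu : strongly_measurable H D deta. Proof. by case: ws => -[_ []]. Qed.
Let idu2 : integ D (fun t => nrm H (deta t) ^+ 2). Proof. by case: ws => -[_ []]. Qed.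
Let pddu t : D t -> pts V' (ddeta t). Proof. by case: ws => -[_ _ [[h _] _] _ _] _ _ _ /h. Qed.
Let suH : strongly_measurable H D eta.
Proof.
apply: (strongly_measurable_sub _ _ _ su) => [v w|v|v pv]; first exact: (hptsB hV).
  exact: VH.
by rewrite (hnrm_ge0 hH) VHle.
Qed.

(** One multiple of [nrm H (eta t)] bounds the sine term; the other is the [eta] added to both sides
    to complete [opA] to the form [ipV]. *)
Let kap t := 2 * nrm H (eta t) + nrm H (g t).

Let kap0 t : D t -> 0 <= kap t.
Proof. by move=> _; rewrite addr_ge0 ?mulr_ge0 ?(hnrm_ge0 hH). Qed.

Let mkap : measurable_fun D kap.
Proof.
apply: measurable_funD; last exact: (measurable_nrm hH hg.1).
by apply: measurable_funM => //; exact: (measurable_nrm hH suH).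
Qed.

(** (2x + z)^2 is at most 8 x^2 + 2 z^2. The 8 becomes the Gronwall rate and the 2 the factor in
    front of the data. *)
Lemma kap_sqr_le t : kap t ^+ 2 <= 8 * nrm V (eta t) ^+ 2 + 2 * nrm H (g t) ^+ 2.
Proof.
have := nrmH_le L bc (eta t); have := hnrm_ge0 hH (eta t).
rewrite /kap; move: (nrm H (eta t)) (nrm V (eta t)) (nrm H (g t)) => x y z x0 xy.
have xy2 : x ^+ 2 <= y ^+ 2 by rewrite lerXn2r// nnegrE// (le_trans x0).
by have := sqr_ge0 (2 * x - z); rewrite sqrrB sqrrD exprMn; lra.
Qed.

Let ikap2 : integ D (fun t => kap t ^+ 2).
Proof.
apply: (le_integ mD (g := fun t => 8 * nrm V (eta t) ^+ 2 + 2 * nrm H (g t) ^+ 2)).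
- exact: measurable_funX.
- by move=> t _; rewrite ger0_norm ?sqr_ge0//; exact: kap_sqr_le.
- apply: (integD mD); apply: (integZ _ mD); first exact: iu2.
  exact: hg.2.
Qed.

Let weak_u theta : test_fun D theta -> forall h, pts H h ->
  \int[mu]_(t in D) (derive1 theta t * ip L (eta t) h) =
    - \int[mu]_(t in D) (theta t * ip L (deta t) h).
Proof.
move=> tth h ph; case: ws => -[_ _ _ dd _] _ _ _.
have [y [b1 b2]] := dd theta tth.
have lL a u v : pts H u -> pts H v -> ip L (a *: u + v) h = a * ip L u h + ip L v h.
  by move=> pu pv; exact: (hf_lin hH).
have lC u : pts H u -> `|ip L u h| <= nrm H h * nrm H u.
  by move=> pu; rewrite mulrC; exact: (hf_cauchy_schwarz hH).
have [_ e1] := functional_bochner (hf0 hH) (hfL hH) lL lC mD Dfin (hnrm_ge0 hH h)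
  (fun t Dt => hptsZ hH _ (suH.1 t Dt)) b1.
have [_ e2] := functional_bochner (hf0 hH) (hfL hH) lL lC mD Dfin (hnrm_ge0 hH h)
  (fun t Dt => hptsZ hH _ (sdu.1 t Dt)) b2.
have py : pts H y by case: b1.
have -> : \int[mu]_(t in D) (derive1 theta t * ip L (eta t) h) = ip L y h.
  rewrite -e1; apply: eq_Rintegral => t /set_mem Dt.
  by rewrite (hfZl hH)//; exact: suH.1.
have -> : \int[mu]_(t in D) (theta t * ip L (deta t) h) = ip L (- y) h.
  rewrite -e2; apply: eq_Rintegral => t /set_mem Dt.
  by rewrite (hfZl hH)//; exact: sdu.1.
by rewrite (hfNl hH)// opprK.
Qed.

Let weak_du theta : test_fun D theta -> forall v, pts V v ->
  `|\int[mu]_(t in D) (derive1 theta t * ip L (deta t) v) -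
    \int[mu]_(t in D) (theta t * ipV L (eta t) v)| <=
  nrm H v * \int[mu]_(t in D) (`|theta t| * kap t).
Proof.
move=> tth v pv; have ph := VH pv.
case: (ws) => -[_ _ _ _ dd] eqn _ _.
have [y [b1 b2]] := dd theta tth.
(* Evaluation at [v] is a bounded functional on the dual, with constant [nrm V v], so
   [functional_bochner] turns the distributional equation into a scalar one. *)
have lL (a : R) F G : pts V' F -> pts V' G -> (a *: F + G) v = a * F v + G v by [].
have lC F : pts V' F -> `|F v| <= nrm V v * nrm V' F.
  by move=> pF; rewrite mulrC; exact: dual_le.
have pZ (a : R) F : pts V' F -> pts V' (a *: F).
  by move=> pF; have := dual_pts_comb a pF (dual_pts0 L bc); rewrite addr0.
have [_ e1] := functional_bochner (l := fun F => F v) (dual_pts0 L bc) (@dual_pts_comb R L bc)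
  lL lC mD Dfin (hnrm_ge0 hV v) (fun t Dt => pZ _ _ (emb_dual bc (sdu.1 t Dt))) b1.
have [i2 e2] := functional_bochner (l := fun F => F v) (dual_pts0 L bc) (@dual_pts_comb R L bc)
  lL lC mD Dfin (hnrm_ge0 hV v) (fun t Dt => pZ _ _ (pddu Dt)) b2.
have iV : integ D (fun t => theta t * ipV L (eta t) v).
  apply: (integ_weight mD (test_fun_weight D tth)); apply: (integ_form hV mD su) => //.
  by apply: (integ_of_sqr mD Dfin) => //; exact: (measurable_nrm hV su).
have -> : \int[mu]_(t in D) (derive1 theta t * ip L (deta t) v) = y v by exact: e1.
have -> : y v = - \int[mu]_(t in D) (theta t * ddeta t v).
  by rewrite -[LHS]opprK; congr (- _); exact/esym/e2.
rewrite -opprD normrN -RintegralD//.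
have i3 : integ D (fun t => theta t * ddeta t v + theta t * ipV L (eta t) v).
  exact: (integD mD i2 iV).
apply: le_trans (normr_Rintegral_le mD i3) _.
have ikap : integ D (fun t => `|theta t| * kap t).
  apply: (integ_weight_norm mD (test_fun_weight D tth)).
  exact: (integ_of_sqr mD Dfin mkap ikap2).
rewrite -RintegralZl//; apply: (ae_ge0_le_Rintegral mD).
- exact: (integ_norm mD i3).
- exact: (integZ _ mD ikap).
- by move=> t _; exact: normr_ge0.
- by move=> t Dt; rewrite !mulr_ge0 ?(hnrm_ge0 hH)// kap0.
apply: ae_imp eqn => t et Dt; have {et} := et Dt v pv.
have t0 : 0 < t by move: Dt; rewrite /D/= in_itv/= => /andP[].
have [prhs nrhs] := rhs_bound sphi eps0 t0 (suH.1 t Dt) (hg.1.1 t Dt).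
rewrite /opA /emb => et.
(* [ipV] is [opA] plus the H product, so the equation at time [t] gives the sum the value of the
   forcing plus [eta]. *)
have -> : theta t * ddeta t v + theta t * ipV L (eta t) v =
    theta t * (ip L (rhs eps phi g eta t) v + ip L (eta t) v).
  by rewrite -et /ipV -mulrDr; congr (_ * _); rewrite -!addrA; congr (_ + _); exact: addrC.
rewrite normrM mulrCA ler_wpM2l//; apply: le_trans (ler_normD _ _) _.
have c1 := hf_cauchy_schwarz hH prhs ph.
have c2 := hf_cauchy_schwarz hH (suH.1 t Dt) ph.
apply: le_trans (lerD c1 c2) _; rewrite -mulrDl mulrC ler_wpM2l ?(hnrm_ge0 hH)//.
apply: le_trans (lerD nrhs (lexx _)) _.
by rewrite /kap mulr_natl mulr2n addrAC.
Qed.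

Let Db (b : R) : set R := `]0, b[%classic.

Lemma weak_solution_energy : exists etac detac : R -> R -> R,
  [/\ C0T V T etac,
      ae_equal V T etac eta,
      C0T H T detac,
      ae_equal H T detac deta &
      forall t, t \in `[0, T] ->
        nrm H (detac t) ^+ 2 + nrm V (etac t) ^+ 2 <=
        2 * expR (8 * T) * (nrm H v0 ^+ 2 + nrm V u0 ^+ 2 +
             \int[mu]_(s in `]0, t[) (nrm H (g s) ^+ 2))].
Proof.
have [Y [Z [pYZ cYZ rYZ eYZ]]] := evolution_global hH hV VH VHle T0 su sdu iu2 idu2
  kap0 mkap ikap2 weak_u weak_du.
have pY t : 0 <= t <= T -> pts V (Y t) by move=> /pYZ[].
have pZ t : 0 <= t <= T -> pts H (Z t) by move=> /pYZ[].
have cY a (aT : 0 <= a <= T) (e : R) : 0 < e -> exists2 r : R, 0 < r &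
    forall b, 0 <= b <= T -> `|b - a| < r -> nrm V (Y b - Y a) <= e.
  move=> e0; have [r r0 hr] := cYZ a aT e e0.
  by exists r => // b bT ba; have [] := hr b bT ba.
have cZ a (aT : 0 <= a <= T) (e : R) : 0 < e -> exists2 r : R, 0 < r &
    forall b, 0 <= b <= T -> `|b - a| < r -> nrm H (Z b - Z a) <= e.
  move=> e0; have [r r0 hr] := cYZ a aT e e0.
  by exists r => // b bT ba; have [] := hr b bT ba.
have ae : {ae mu, forall t, 0 < t < T -> nrm V (Y t - eta t) = 0 /\ nrm H (Z t - deta t) = 0}.
  apply: ae_imp (ae_regular_time hH hV su sdu iu2 idu2) => t rt /andP[t0 tT].
  by apply: rYZ; [rewrite !ltW|apply: rt; rewrite /= in_itv/= t0].
have p00 : 0 <= (0 : R) <= T by rewrite lexx ltW.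
have DE t : 0 < t < T -> D t by rewrite /D /= in_itv.
have [pu0H pY0H] := (VH pu0, VH (pY 0 p00)).
(* The initial value is prescribed in H only: all H pairings of [Y 0] and [u0] agree, so their
   difference is H-null, and [nrmH_null_nrmV] makes it V-null. *)
have Y0 : nrm V (Y 0 - u0) = 0.
  rewrite nrmVE; apply: nrmH_null_nrmV.
    by apply: ptsV_ptsH1; apply: (hptsB hV) => //; exact: pY.
  apply/(hnrm_eq0P hH).
  have E h : pts H h -> ip L (Y 0) h = ip L u0 h.
    move=> ph; apply: (@initial_value_functional _ _ H (fun u => ip L u h) (nrm H h)
        (hfL hH) _ (hnrm_ge0 hH h) _ T eta u0 (fun t => ip L (Y t) h)) => //.
    - by move=> a u v pu pv; exact: (hf_lin hH).
    - by move=> u pu; rewrite mulrC; exact: (hf_cauchy_schwarz hH).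
    - by move=> t /DE /(suH.1 t).
    - by case: ws.
    - move=> e e0; apply: (form_curve_continuous hH p00) => // [t /pY/VH//|d d0].
      have [r r0 hr] := cY 0 p00 d d0; exists r => // b bT b0.
      exact: le_trans (nrmH_le L bc _) (hr b bT b0).
    - apply: ae_imp ae => t et t0T; have [Yt _] := et t0T.
      have pe : pts V (eta t) by apply: su.1; exact: DE.
      have pYt : pts V (Y t) by apply: pY; move/andP: t0T => [? ?]; rewrite !ltW.
      apply: ip_eq_null => //; [exact: VH|exact: VH|].
      apply/eqP; rewrite eq_le (hnrm_ge0 hH) andbT -Yt; exact: nrmH_le.
  have pd := hptsB hH pY0H pu0H.
  by rewrite (hfBl hH)// E// subrr.
(* The initial velocity is read in the dual of V, where only pairings with points of V make sense;
   test functions belong to V under either boundary condition, and they detect null functions of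
   H. *)
have Z0 : nrm H (Z 0 - v0) = 0.
  apply: ip_test_eq0; first by apply: (hptsB hH) => //; exact: pZ.
  move=> v tv; have pv := test_fun_ptsV bc tv; have pvH := VH pv.
  rewrite (hfBl hH)//; last exact: pZ.
  apply/eqP; rewrite subr_eq0; apply/eqP.
  apply: (@initial_value_functional _ _ V' (fun F => F v) (nrm V v)
      (@dual_pts_comb R L bc) _ (hnrm_ge0 hV v) _ T (emb L \o deta) (emb L v0)
      (fun t => ip L (Z t) v)) => //.
  - by move=> F pF; rewrite mulrC; exact: dual_le.
  - by move=> t /DE /(sdu.1 t) h; exact: emb_dual.
  - exact: emb_dual.
  - by case: ws.
  - by move=> e e0; apply: (form_curve_continuous hH p00) => //; exact: cZ.
  - apply: ae_imp ae => t et t0T; have [_ Zt] := et t0T.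
    apply: ip_eq_null => //; last by apply: sdu.1; exact: DE.
    by apply: pZ; move/andP: t0T => [? ?]; rewrite !ltW.
pose En t := nrm H (Z t) ^+ 2 + nrm V (Y t) ^+ 2.
have En0 t : 0 <= En t by rewrite addr_ge0 ?sqr_ge0.
have EnE : En 0 = nrm H v0 ^+ 2 + nrm V u0 ^+ 2.
  have eqn (W : nspace (R -> R)) B (hW : hilbert_form W B) x y : pts W x -> pts W y ->
      nrm W (x - y) = 0 -> nrm W x = nrm W y.
    move=> px py xy; apply/eqP; rewrite -subr_eq0 -normr_le0 -xy.
    exact: (hnrm_dist hW).
  by rewrite /En (eqn _ _ hH _ v0 (pZ 0 p00))// (eqn _ _ hV _ u0 (pY 0 p00)).
have cEn a : 0 <= a <= T -> forall e : R, 0 < e -> exists2 r : R, 0 < r &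
     forall b, 0 <= b <= T -> `|b - a| < r -> `|En b - En a| <= e.
  move=> aT e e0; have e2 : 0 < e / 2 by rewrite divr_gt0.
  have [r1 r10 h1] := nrm_sqr_curve_continuous hH aT pZ (cZ a aT) e2.
  have [r2 r20 h2] := nrm_sqr_curve_continuous hV aT pY (cY a aT) e2.
  exists (Num.min r1 r2); first by rewrite lt_min r10.
  move=> b bT; rewrite lt_min => /andP[b1 b2].
  rewrite /En opprD addrACA [leRHS]splitr; apply: le_trans (ler_normD _ _) _.
  by apply: lerD; [exact: h1|exact: h2].
(* The extension serves to make [En] integrable on the intervals [Db b]. *)
have [psi cpsi psiE] := continuous_extension (ltW T0) cEn.
have DbD b : b <= T -> Db b `<=` D.
  by move=> bT t; rewrite /Db /D /= !in_itv/= => /andP[-> /lt_le_trans ->].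
have mDb b : measurable (Db b) by exact: measurable_itv.
have iEn b : b <= T -> integ (Db b) En.
  move=> bT; have i : integ (Db b) psi.
    apply: (@integrableS _ _ _ mu `[0, T]) => //.
    - exact: mDb.
    - by apply: subset_trans (DbD b bT) _; exact: subset_itv_oo_cc.
    - exact: continuous_integ_itv.
  apply: (@eq_integrable _ _ _ mu _ (mDb b) _ _ _ i) => t /set_mem /(DbD b bT).
  by rewrite /D /= in_itv/= => /andP[t0' tT]; rewrite psiE// !ltW.
have iS (f : R -> R) b : b <= T -> integ D f -> integ (Db b) f.
  by move=> bT; apply: integrableS => //; [exact: mDb|exact: DbD].
pose G b := \int[mu]_(s in Db b) (nrm H (g s) ^+ 2).
have G_ge0 b : 0 <= G b by apply: Rintegral_ge0 => t _; exact: sqr_ge0.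
have ig2 : integ D (fun s => nrm H (g s) ^+ 2) by exact: hg.2.
have Gle b t : b <= t -> t <= T -> G b <= G t.
  move=> bt tT; rewrite /G /Rintegral fine_le//.
  - by apply: integrable_fin_num; [exact: mDb|exact: (iS _ _ (le_trans bt tT) ig2)].
  - by apply: integrable_fin_num; [exact: mDb|exact: (iS _ _ tT ig2)].
  apply: ge0_subset_integral; [exact: mDb|exact: mDb|..].
  - by have /integrableP[] := iS _ _ tT ig2.
  - by move=> s _; rewrite lee_fin sqr_ge0.
  - by move=> s; rewrite /Db /= !in_itv/= => /andP[-> /lt_le_trans ->].
(* The integrand [kap t ^+ 2 + nrm H (deta t) ^+ 2] is almost everywhere at most [2 |g|^2 + 8 En],
   since [eta] and [deta] may be replaced by [Y] and [Z] at almost every time. *)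
have growth b : 0 <= b <= T -> En b <= En 0 + 2 * G b + 8 * \int[mu]_(t in Db b) En t.
  move=> /andP[b0 bT]; have h := eYZ 0 b (lexx 0) b0 bT.
  rewrite lerBlDl in h; apply: (le_trans h); rewrite -[leRHS]addrA.
  apply: lerD; first exact: lexx.
  have iK : integ (Db b) (fun t => kap t ^+ 2 + nrm H (deta t) ^+ 2).
    by apply: iS => //; exact: (integD mD ikap2 idu2).
  have ib2 := iS _ _ bT ig2.
  have iE2 := integZ 8 (mDb b) (iEn _ bT); have ig3 := integZ 2 (mDb b) ib2.
  rewrite /G -(@RintegralZl _ _ _ mu _ _ 2 (mDb b) ib2).
  rewrite -(@RintegralZl _ _ _ mu _ _ 8 (mDb b) (iEn _ bT)).
  rewrite -(@RintegralD _ _ _ mu _ _ _ (mDb b) ig3 iE2).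
  apply: (ae_ge0_le_Rintegral (mDb b) iK).
  - exact: (integD (mDb b) ig3 iE2).
  - by move=> t _; rewrite addr_ge0 ?sqr_ge0.
  - by move=> t _; rewrite addr_ge0// mulr_ge0 ?sqr_ge0.
  apply: ae_imp ae => t et /(DbD _ bT) Dt.
  have t0T : 0 < t < T by move: Dt; rewrite /D /= in_itv.
  have [Yt Zt] := et t0T; have t0T' : 0 <= t <= T by move/andP: t0T => [? ?]; rewrite !ltW.
  have d1 := hnrm_dist hV (pY t t0T') (su.1 t Dt); rewrite Yt normr_le0 subr_eq0 in d1.
  have d2 := hnrm_dist hH (pZ t t0T') (sdu.1 t Dt); rewrite Zt normr_le0 subr_eq0 in d2.
  have := kap_sqr_le t; rewrite /En (eqP d1) (eqP d2).
  have := sqr_ge0 (nrm H (deta t)).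
  by move: (kap t ^+ 2) (nrm V _ ^+ 2) (nrm H (deta t) ^+ 2) (nrm H (g t) ^+ 2) => ????; lra.
(* Gronwall is applied on [0, t] for each [t]: [G b] is bounded there by [G t], so the inhomogeneous
   term is a constant and only the data up to time [t] appear. *)
have bound t : 0 <= t <= T -> En t <= (En 0 + 2 * G t) * expR (8 * t).
  move=> /andP[t0 tT]; apply: gronwall => //.
  - move=> a /andP[a0 at_] e e0.
    have aT : 0 <= a <= T by rewrite a0 (le_trans at_).
    have [r r0 hr] := cEn a aT e e0; exists r => // b /andP[b0 bt]; apply: hr.
    by rewrite b0 (le_trans bt).
  - move=> b /andP[b0 bt]; have bT : b <= T := le_trans bt tT.
    apply: le_trans (growth b _) _; first by rewrite b0.
    by rewrite lerD2r lerD2l ler_wpM2l//; exact: Gle.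
exists Y, Z; split.
- split=> t; rewrite in_itv/= => tT; first exact: pY.
  by apply: (curve_within_cvg hV); exact: cY.
- by apply: ae_imp ae => t et; rewrite in_itv/= => /et[].
- split=> t; rewrite in_itv/= => tT; first exact: pZ.
  by apply: (curve_within_cvg hH); exact: cZ.
- by apply: ae_imp ae => t et; rewrite in_itv/= => /et[].
move=> t; rewrite in_itv/= => tT; have /andP[t0 tT'] := tT.
apply: (le_trans (bound t tT)); rewrite -EnE -/(G t).
have e8 : expR (8 * t) <= expR (8 * T) by rewrite ler_expR ler_pM2l.
have A0 : 0 <= En 0 + 2 * G t.
  by apply: addr_ge0; [exact: En0|exact: mulr_ge0 (ler0n _ 2) (G_ge0 t)].
have A2 : En 0 + 2 * G t <= 2 * (En 0 + G t).
  by have := En0 0; move: (En 0) (G t) => x y x0; lra.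
rewrite [leRHS](_ : _ = 2 * (En 0 + G t) * expR (8 * T)).
  exact: (ler_pM A0 (expR_ge0 _) A2 e8).
by move: (En 0) (G t) => x y; ring.
Qed.

End WeakSolution.

Theorem lemma2p2 (R : realType) (T : R) (T_gt0 : 0 < T) :
  exists c : R,
  forall (L : \bar R) (bc : boundary_condition) (phi : R -> R -> R) (eps : R),
  (0 < L)%E -> sine_gordon_solution phi -> 0 < eps <= 1 ->
  forall (g : R -> R -> R) (u0 v0 : R -> R)
         (eta deta : R -> R -> R) (ddeta : R -> (R -> R) -> R),
  L2T (spaceH L) T g -> pts (spaceV L bc) u0 -> pts (spaceH L) v0 ->
  weak_solution L bc T eps phi g u0 v0 eta deta ddeta ->
  exists etac detac : R -> R -> R,
  [/\ C0T (spaceV L bc) T etac,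
      ae_equal (spaceV L bc) T etac eta,
      C0T (spaceH L) T detac,
      ae_equal (spaceH L) T detac deta &
      forall t, t \in `[0, T] ->
        nrm (spaceH L) (detac t) ^+ 2 + nrm (spaceV L bc) (etac t) ^+ 2 <=
        c * (nrm (spaceH L) v0 ^+ 2 + nrm (spaceV L bc) u0 ^+ 2 +
             \int[lebesgue_measure]_(s in `]0, t[) (nrm (spaceH L) (g s) ^+ 2))].
Proof.
exists (2 * expR (8 * T)) => L bc phi eps L0 [sphi _] /andP[eps0 _].
move=> g u0 v0 eta deta ddeta hg pu0 pv0 ws.
exact: (weak_solution_energy T_gt0 sphi eps0 hg pu0 pv0 ws).
Qed.
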